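(* Let $G:\mathbb R\to\mathbb R$ with $G\in L^1(\mathbb R)$, and let $F:\mathbb R\times\mathbb R\to\mathbb R$, $(u,x)\mapsto F(u,x)$, satisfy Assumption (A) of the context with constants $k,l>0$ and function $h$. Let $b\in\mathbb R$, $b\ne 0$, and $a\ge 0$. Consider the problem $$-\frac{d^4u}{dx^4}+b\frac{du}{dx}+au+\int_{-\infty}^{\infty}G(x-y)F(u(y),y)\,dy=0,\quad x\in\mathbb R, \qquad (P)$$ and, for given $v\in H^4(\mathbb R)$, the auxiliary equation for $u\in H^4(\mathbb R)$ $$\frac{d^4u}{dx^4}-b\frac{du}{dx}-au=\int_{-\infty}^{\infty}G(x-y)F(v(y),y)\,dy,\quad x\in\mathbb R. \qquad (Q)$$ I) If $a>0$ and $2\sqrt{\pi}\,N_{a,b}\,l<1$, then equation (Q) defines a map $t_{a,b}:H^4(\mathbb R)\to H^4(\mathbb R)$, $t_{a,b}v=u$, which has a unique fixed point $v_{a,b}$, and $v_{a,b}$ is the only solution of (P) in $H^4(\mathbb R)$. II) If $a=0$, $xG(x)\in L^1(\mathbb R)$, $\int_{-\infty}^{\infty}G(x)\,dx=0$ and $2\sqrt{\pi}\,N_{0,b}\,l<1$, then equation (Q) with $a=0$ defines a map $t_{0,b}:H^4(\mathbb R)\to H^4(\mathbb R)$, $t_{0,b}v=u$, which has a unique fixed point $v_{0,b}$, and $v_{0,b}$ is the only solution of (P) with $a=0$ in $H^4(\mathbb R)$. In both cases I) and II), the fixed point $v_{a,b}$ does not vanish identically on $\mathbb R$ provided that the intersection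 of supports $\operatorname{supp}\widehat{F(0,\cdot)}\cap\operatorname{supp}\widehat G$ is a set of nonzero Lebesgue measure on the real line.
   Context: All functions in physical space are real valued. $H^4(\mathbb R)$ is the Sobolev space with norm $\|u\|_{H^4(\mathbb R)}^2=\|u\|_{L^2(\mathbb R)}^2+\left\|\frac{d^4u}{dx^4}\right\|_{L^2(\mathbb R)}^2$. Assumption (A): $F:\mathbb R\times\mathbb R\to\mathbb R$ satisfies the Carathéodory condition ($F(u,x)$ is measurable in $x$ for every $u$ and continuous in $u$ for almost every $x$), and there are constants $k>0$, $l>0$ and a nonnegative function $h\in L^2(\mathbb R)$ such that $|F(u,x)|\le k|u|+h(x)$ for all $u,x\in\mathbb R$, and $|F(u_1,x)-F(u_2,x)|\le l|u_1-u_2|$ for all $u_1,u_2,x\in\mathbb R$. Fourier transform: $\widehat G(p)=\frac1{\sqrt{2\pi}}\int_{-\infty}^\infty G(x)e^{-ipx}\,dx$, $p\in\mathbb R$ (extended to $L^2(\mathbb R)$ as usual). $\widehat{F(0,\cdot)}$ is the Fourier transform of the $L^2$ function $x\mapsto F(0,x)$. The support of a Fourier transform is understood here as the set where it is nonzero (up to Lebesgue null sets). For $a\ge0$, $b\in\mathbb R$, $b\neq0$: $$N_{a,b}:=\max\left\{\left\|\frac{\widehat G(p)}{p^4-a-ibp}\right\|_{L^\infty(\mathbb R)},\ \left\|\frac{p^4\widehat G(p)}{p^4-a-ibp}\right\|_{L^\infty(\mathbb R)}\right\}.$$ *)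

(* Defs.v *)
From HB Require Import structures.
From mathcomp Require Import all_boot all_order all_algebra.
From mathcomp Require Import all_classical all_reals all_analysis.
From mathcomp Require Import complex.

Set Implicit Arguments.
Unset Strict Implicit.
Unset Printing Implicit Defensive.

Import Order.TTheory GRing.Theory Num.Theory.
Import numFieldNormedType.Exports.

Local Open Scope classical_set_scope.
Local Open Scope ring_scope.

(* "Measurable", "integrable" and "almost everywhere" refer to the complete
   Lebesgue sigma-algebra on R.  [lebT R] is a copy of the type [R] that carries
   this sigma-algebra, whereas [R] itself carries the Borel one; functions are
   written [R -> R] and regarded as [lebT R -> R] by conversion. *)
Notation leb := completed_lebesgue_measure.
Notation lebT R := (caratheodory_type (wlength (R := R) idfun)^*%mu).

Definition ae_equal (R : realType) (u v : R -> R) : Prop :=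
  \forall x \ae (@leb R), u x = v x.

Definition inL1 (R : realType) (f : R -> R) : Prop := f \in Lfun (@leb R) 1%E.

Definition inL2 (R : realType) (f : R -> R) : Prop :=
  f \in Lfun (@leb R) 2%:E.

Definition test_function (R : realType) (phi : R -> R) : Prop :=
  (forall (n : nat) (x : R), derivable (derive1n n phi) x 1) /\
  (exists M : R, forall x : R, M < `|x| -> phi x = 0).

Definition weak_derivative (R : realType) (k : nat) (u w : R -> R) : Prop :=
  forall phi : R -> R, test_function phi ->
    \int[@leb R]_x (u x * derive1n k phi x) =
    (-1) ^+ k * \int[@leb R]_x (w x * phi x).

(* Elements of H^4(R) are represented by functions R -> R, two functions being
   the same element when [ae_equal]. *)
Definition inH4 (R : realType) (u : R -> R) : Prop :=
  inL2 u /\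
  forall k : nat, (1 <= k <= 4)%N ->
    exists w : R -> R, inL2 w /\ weak_derivative k u w.

Definition assumptionA (R : realType) (F : R -> R -> R) (k l : R) (h : R -> R)
    : Prop :=
  [/\ (forall u : R, measurable_fun [set: lebT R] (F u : lebT R -> R)),
      (\forall x \ae (@leb R), continuous (F ^~ (x : R))),
      [/\ 0 < k, 0 < l, inL2 h & forall x, 0 <= h x],
      (forall u x : R, `|F u x| <= k * `|u| + h x) &
      (forall u1 u2 x : R, `|F u1 x - F u2 x| <= l * `|u1 - u2|)].

(* x |-> \int G(x - y) F(v(y), y) dy.  For G in L^1 and F(v(.), .) in L^2 the
   integral converges absolutely for almost every x; elsewhere the value is
   irrelevant since the equations below are required almost everywhere. *)
Definition nonlocal_term (R : realType) (G : R -> R) (F : R -> R -> R)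
    (v : R -> R) (x : R) : R :=
  \int[@leb R]_y (G (x - y) * F (v y) y).

Definition solves_P (R : realType) (G : R -> R) (F : R -> R -> R) (a b : R)
    (u : R -> R) : Prop :=
  exists u1 u4 : R -> R,
    [/\ inL2 u1 /\ weak_derivative 1 u u1,
        inL2 u4 /\ weak_derivative 4 u u4 &
        \forall x \ae (@leb R),
          - u4 x + b * u1 x + a * u x + nonlocal_term G F u x = 0].

Definition solves_Q (R : realType) (G : R -> R) (F : R -> R -> R) (a b : R)
    (v u : R -> R) : Prop :=
  exists u1 u4 : R -> R,
    [/\ inL2 u1 /\ weak_derivative 1 u u1,
        inL2 u4 /\ weak_derivative 4 u u4 &
        \forall x \ae (@leb R),
          u4 x - b * u1 x - a * u x = nonlocal_term G F v x].

(* (2 pi)^(-1/2) \int f(x) e^(-ipx) dx, split into real and imaginary parts. *)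
Definition fourier (R : realType) (f : R -> R) (p : R) : R[i] :=
  ((Num.sqrt (2 * pi))^-1)%:C%C *
  ((\int[@leb R]_x (f x * cos (p * x))) -i*
   (\int[@leb R]_x (f x * sin (p * x))))%C.

Definition cmod (R : realType) (z : R[i]) : R := ComplexField.Normc.normc z.

(* g is (a representative of) the Fourier transform of f in L^2: the limit in
   L^2 of the transforms of the truncations of f to [-n, n]. *)
Definition fourier_L2 (R : realType) (f : R -> R) (g : R -> R[i]) : Prop :=
  [/\ inL2 (fun p => complex.Re (g p)), inL2 (fun p => complex.Im (g p)) &
      ('N[@leb R]_2%:E[(fun p : R =>
          (cmod (fourier (fun x => f x * \1_`[- n%:R, n%:R] x) p - g p))%:E)]
        @[n --> \oo] --> (0 : \bar R))%E].

Definition supp (R : realType) (g : R -> R[i]) : set R := [set p | g p != 0].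

Definition symbol (R : realType) (a b p : R) : R[i] :=
  ((p ^+ 4 - a) -i* (b * p))%C.

Definition N_ab (R : realType) (G : R -> R) (a b : R) : \bar R :=
  Order.max
    ('N[@leb R]_+oo[(fun p : R => (cmod (fourier G p / symbol a b p))%:E)])%E
    ('N[@leb R]_+oo[(fun p : R =>
        (cmod ((p ^+ 4)%:C%C * fourier G p / symbol a b p))%:E)])%E.

(* Main.v *)
Require Import Defs.
From HB Require Import structures.
From mathcomp Require Import all_boot all_order all_algebra.
From mathcomp Require Import all_classical all_reals all_analysis.
From mathcomp Require Import measurable_realfun ess_sup_inf complex.
From mathcomp Require Import ring lra.

Set Implicit Arguments.
Unset Strict Implicit.
Unset Printing Implicit Defensive.

Import Order.TTheory GRing.Theory Num.Theory.
Import numFieldNormedType.Exports.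

Local Open Scope classical_set_scope.
Local Open Scope ring_scope.

(** Why the theorem holds.  On the Fourier side the auxiliary equation reads
    (p^4 - a - i b p) u^ = sqrt(2 pi) G^ f^, where f = F(v(.), .); hence u is
    obtained from f by the multiplier m(p) = sqrt(2 pi) G^(p) / (p^4 - a - i b p).
    The two norms in N bound |m| and p^4 |m| by sqrt(2 pi) N, so f in L2 gives
    u in H4, and f |-> u has norm at most sqrt(2 pi) N on L2.  As F is
    l-Lipschitz in u, the map v |-> u multiplies squared L2 distances by at most
    2 pi N^2 l^2, and the hypothesis 2 sqrt(pi) N l < 1 makes this factor
    smaller than 1/2.  Since F(v(.), .) depends on v as an element of L2 only,
    it is enough to iterate the contraction in L2: its fixed point lies in the
    range of the map, which is contained in H4.  Solutions of the auxiliary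
    equation are unique because its symbol can vanish only at p = 0.  Finally, if
    the fixed point vanished, then u = 0 for f = F(0, .), so G^ f^ = 0 almost
    everywhere, against the assumption on the supports.

    The Plancherel theory that this needs is developed for real functions,
    through the Hartley transform [Hart f p] = (2 pi)^(-1/2) int f(x) cas(p x) dx
    with cas = cos + sin.  Its even and odd parts are the real part and minus the
    imaginary part of f^.  A multiplier alpha + i beta with alpha even and beta
    odd, that is, one that preserves real functions, acts on it as
    phi |-> alpha(p) phi(p) - beta(p) phi(-p), which is [mult alpha beta]; in
    particular d/dx becomes [D].

    Plancherel is proved by means of the weight e^(-eps |p|).  The weighted
    energy of [Hart f] is a quadratic form in f whose kernel is the Poisson
    kernel ([Hart_wexp_energy]).  Its mass is at most 1, so the transform
    contracts L2 ([Hart_contr]); for the indicator of an interval the limit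
    eps -> 0 is explicit and yields equality ([Hart_itv1]).  The extension [U] to
    L2 is thus a symmetric contraction that is isometric on indicators of
    intervals, which forces U (U f) = f ([U_invol]).

    Convolution with G in L1 and weak differentiation are then identified with
    multipliers ([U_convol], [weak_der_of_Hartley]).  For the uniqueness of weak
    solutions ([weak_der_unique]) a solution d of the homogeneous equation is convolved
    with a bump function eta: moving the derivatives onto eta gives
    theta * d = 0 with theta = eta'''' - b eta' - a eta, and theta^ does not vanish
    at a given p <> 0 if the support of eta is small enough.

    All this concerns Borel functions and the Lebesgue measure [mu] on Borel
    sets.  The statement is about the completed measure, and each Lebesgue
    measurable function agrees almost everywhere with a Borel one
    ([Borel_version]), which transfers integrals and norms.  Squared L2 norms
    [n2] are used in place of norms; the triangle inequality becomes
    n2 (f + g) <= 2 n2 f + 2 n2 g.  *)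

(** * Square-integrable Borel functions *)

Section L2kit.
Context {R : realType}.
Local Notation mu := (@lebesgue_measure R).

Definition L1 (f : R -> R) := mu.-integrable setT (EFin \o f).
Definition L2 (f : R -> R) :=
  measurable_fun [set: R] f /\ L1 (fun x => f x ^+ 2).
Definition ip (f g : R -> R) : R := \int[mu]_x (f x * g x).
Definition n2 (f : R -> R) : R := \int[mu]_x (f x ^+ 2).
Definition AE (P : R -> Prop) : Prop := {ae mu, forall x, P x}.
Definition aeq (f g : R -> R) := AE (fun x => f x = g x).

Instance AE_filter : Filter (@AE : set_system R).
Proof. exact: (@ae_filter_ringOfSetsType _ (measurableTypeR R) R mu). Qed.

Lemma AEW (P : R -> Prop) : (forall x, P x) -> AE P.
Proof. exact: filterE. Qed.

Lemma AE1 (P Q : R -> Prop) : (forall x, P x -> Q x) -> AE P -> AE Q.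
Proof. exact: filterS. Qed.

Lemma AE2 (P Q S : R -> Prop) : (forall x, P x -> Q x -> S x) ->
  AE P -> AE Q -> AE S.
Proof. exact: filterS2. Qed.

Lemma AE3 (P Q S V : R -> Prop) : (forall x, P x -> Q x -> S x -> V x) ->
  AE P -> AE Q -> AE S -> AE V.
Proof. exact: filterS3. Qed.

Lemma AE_all (P : nat -> R -> Prop) : (forall n, AE (P n)) ->
  AE (fun x => forall n, P n x).
Proof. exact: ae_foralln. Qed.

Lemma AE_neq (z : R) : AE (fun x => x != z).
Proof.
exists [set z]; split; [exact: measurable_set1|exact: lebesgue_measure_set1|].
by move=> x /= /negP; rewrite negbK => /eqP.
Qed.

Implicit Types f g h : R -> R.

Lemma L1_meas f : L1 f -> measurable_fun [set: R] f.
Proof. by move=> /integrableP[/measurable_EFinP]. Qed.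

Lemma L1_le f g : measurable_fun [set: R] f -> L1 g ->
  (forall x, `|f x| <= g x) -> L1 f.
Proof.
move=> mf ig fg; apply: (le_integrable measurableT _ _ ig).
  exact/measurable_EFinP.
by move=> x _ /=; rewrite lee_fin (le_trans (fg x))// ler_norm.
Qed.

Lemma L1D f g : L1 f -> L1 g -> L1 (fun x => f x + g x).
Proof. by move=> If Ig; apply: (integrableD _ If Ig). Qed.

Lemma L1B f g : L1 f -> L1 g -> L1 (fun x => f x - g x).
Proof. by move=> If Ig; apply: (integrableB _ If Ig). Qed.

Lemma L1Z (k : R) f : L1 f -> L1 (fun x => k * f x).
Proof. by move=> If; apply: (integrableZl _ k If). Qed.

Lemma L1_norm f : L1 f -> L1 (fun x => `|f x|).
Proof. by move=> If; apply: (integrable_norm If). Qed.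

Lemma L1_bounded_mul f g (M : R) : L1 f -> measurable_fun [set: R] g ->
  (forall x, `|g x| <= M) -> L1 (fun x => f x * g x).
Proof.
move=> If mg gM.
apply: (@L1_le _ (fun x => M * `|f x|)).
- by apply: measurable_funM => //; exact: L1_meas.
- exact/L1Z/L1_norm.
- by move=> x; rewrite normrM mulrC ler_wpM2r.
Qed.

Lemma RintD f g : L1 f -> L1 g ->
  \int[mu]_x (f x + g x) = \int[mu]_x f x + \int[mu]_x g x.
Proof. by move=> If Ig; rewrite (RintegralD measurableT If Ig). Qed.

Lemma RintB f g : L1 f -> L1 g ->
  \int[mu]_x (f x - g x) = \int[mu]_x f x - \int[mu]_x g x.
Proof. by move=> If Ig; rewrite (RintegralB measurableT If Ig). Qed.

Lemma RintZ (k : R) f : L1 f -> \int[mu]_x (k * f x) = k * \int[mu]_x f x.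
Proof. by move=> If; rewrite (RintegralZl k measurableT If). Qed.

Lemma Rint_le f g : L1 f -> L1 g -> (forall x, f x <= g x) ->
  \int[mu]_x f x <= \int[mu]_x g x.
Proof. by move=> If Ig fg; apply: (le_Rintegral measurableT If Ig). Qed.

Lemma Rint_norm_le f : L1 f -> `|\int[mu]_x f x| <= \int[mu]_x `|f x|.
Proof. by move=> If; apply: (le_normr_Rintegral measurableT If). Qed.

Lemma EFin_Rint f : L1 f -> (\int[mu]_x f x)%:E = (\int[mu]_x (f x)%:E)%E.
Proof. by move=> If; rewrite /Rintegral fineK//; apply: integrable_fin_num. Qed.

Lemma Rint_ae f g : measurable_fun [set: R] f -> measurable_fun [set: R] g ->
  aeq f g -> \int[mu]_x f x = \int[mu]_x g x.
Proof.
move=> mf mg fg; congr fine; apply: ae_eq_integral => //.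
- exact/measurable_EFinP.
- exact/measurable_EFinP.
- by move: fg; apply: AE1 => x /= ->.
Qed.

Lemma L1_ae f g : L1 f -> measurable_fun [set: R] g -> aeq f g -> L1 g.
Proof.
move=> If mg fg; have [mf fi] := integrableP _ _ _ If.
apply/integrableP; split; first exact/measurable_EFinP.
rewrite (_ : (\int[mu]_x _)%E = \int[mu]_x `|(EFin \o f) x|)%E//.
apply: ae_eq_integral => //.
- by apply: measurableT_comp => //; apply/measurable_EFinP.
- by apply: measurableT_comp.
- by move: fg; apply: AE1 => x /= ->.
Qed.

Lemma eint_eq (f g : R -> \bar R) : f =1 g ->
  (\int[mu]_x f x = \int[mu]_x g x)%E.
Proof. by move=> /funext ->. Qed.

Lemma L1_ge0 f : measurable_fun [set: R] f -> (forall x, 0 <= f x) ->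
  (\int[mu]_x (f x)%:E < +oo)%E -> L1 f.
Proof.
move=> mf f0 fi; apply/integrableP; split; first exact/measurable_EFinP.
rewrite (eint_eq (g := fun x => (f x)%:E))// => x.
by rewrite /= ger0_norm.
Qed.

Lemma L1_lty f : L1 f -> (forall x, 0 <= f x) -> (\int[mu]_x (f x)%:E < +oo)%E.
Proof. by move=> If f0; rewrite -EFin_Rint// ltry. Qed.

Lemma aeq_refl f : aeq f f. Proof. exact: AEW. Qed.
Lemma aeq_sym f g : aeq f g -> aeq g f.
Proof. by apply: AE1 => x ->. Qed.
Lemma aeq_trans f g h : aeq f g -> aeq g h -> aeq f h.
Proof. by apply: AE2 => x -> ->. Qed.

Lemma L2_sq f : L2 f -> L1 (fun x => f x ^+ 2). Proof. by case. Qed.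
Lemma L2_meas f : L2 f -> measurable_fun [set: R] f. Proof. by case. Qed.

Lemma L2_le f g : measurable_fun [set: R] f -> L2 g ->
  (forall x, `|f x| <= `|g x|) -> L2 f.
Proof.
move=> mf [mg ig] fg; split=> //; apply: (L1_le _ ig).
  exact: measurable_funX.
move=> x; rewrite normrX -(real_normK (num_real (g x))).
by rewrite lerXn2r ?nnegrE.
Qed.

Lemma L2_mul f g : L2 f -> L2 g -> L1 (fun x => f x * g x).
Proof.
move=> [mf f2] [mg g2]; apply: (@L1_le _ (fun x => f x ^+ 2 + g x ^+ 2)).
- exact: measurable_funM.
- exact: L1D.
- move=> x; rewrite ler_norml; apply/andP; split; nra.
Qed.

Lemma L2D f g : L2 f -> L2 g -> L2 (fun x => f x + g x).
Proof.
move=> Lf Lg; have [mf f2] := Lf; have [mg g2] := Lg; split.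
  exact: measurable_funD.
rewrite (_ : (fun x => _) = fun x => (f x ^+ 2 + g x ^+ 2) + 2 * (f x * g x)).
  by apply: L1D; [exact: L1D|apply: L1Z; exact: L2_mul].
by apply/funext => x; ring.
Qed.

Lemma L2Z (k : R) f : L2 f -> L2 (fun x => k * f x).
Proof.
move=> [mf f2]; split; first exact: measurable_funM.
rewrite (_ : (fun x => _) = fun x => k ^+ 2 * f x ^+ 2); first exact: L1Z.
by apply/funext => x; rewrite exprMn.
Qed.

Lemma L2N f : L2 f -> L2 (fun x => - f x).
Proof.
move=> Lf; rewrite (_ : (fun x => _) = fun x => (-1) * f x); first exact: L2Z.
by apply/funext => x; rewrite mulN1r.
Qed.

Lemma L2B f g : L2 f -> L2 g -> L2 (fun x => f x - g x).
Proof. by move=> Lf Lg; apply: L2D => //; exact: L2N. Qed.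

Lemma L2_0 : L2 (fun=> 0).
Proof.
split; first exact: measurable_cst.
by rewrite /L1 (_ : _ \o _ = cst 0%E); [exact: integrable0|apply/funext => x /=; rewrite expr0n].
Qed.

Lemma n2_ge0 f : 0 <= n2 f.
Proof. by apply: Rintegral_ge0 => x _; exact: sqr_ge0. Qed.

Lemma n2_0 : n2 (fun=> 0 : R) = 0.
Proof. by rewrite /n2; under eq_Rintegral do rewrite expr0n; rewrite /Rintegral integral0. Qed.

Lemma ipC f g : ip f g = ip g f.
Proof. by apply: eq_Rintegral => x _; rewrite mulrC. Qed.

Lemma ipBl f g h : L2 f -> L2 g -> L2 h ->
  ip (fun x => f x - g x) h = ip f h - ip g h.
Proof.
move=> Lf Lg Lh; rewrite /ip -RintB; [|exact: L2_mul|exact: L2_mul].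
by apply: eq_Rintegral => x _; rewrite mulrBl.
Qed.

Lemma ipZl (k : R) f g : L2 f -> L2 g -> ip (fun x => k * f x) g = k * ip f g.
Proof.
move=> Lf Lg; rewrite /ip -RintZ; last exact: L2_mul.
by apply: eq_Rintegral => x _; rewrite mulrA.
Qed.

Lemma n2B f g : L2 f -> L2 g ->
  n2 (fun x => f x - g x) = n2 f - 2 * ip f g + n2 g.
Proof.
move=> Lf Lg; rewrite /n2 /ip -RintZ; last exact: L2_mul.
rewrite -RintB; [|exact: L2_sq|apply: L1Z; exact: L2_mul].
rewrite -RintD; [|apply: L1B; [exact: L2_sq|apply: L1Z; exact: L2_mul]|exact: L2_sq].
by apply: eq_Rintegral => x _; ring.
Qed.

Lemma n2Z (k : R) f : L2 f -> n2 (fun x => k * f x) = k ^+ 2 * n2 f.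
Proof.
move=> Lf; rewrite /n2 -RintZ; last exact: L2_sq.
by apply: eq_Rintegral => x _; rewrite exprMn.
Qed.

Lemma n2D_le f g : L2 f -> L2 g ->
  n2 (fun x => f x + g x) <= 2 * n2 f + 2 * n2 g.
Proof.
move=> Lf Lg; rewrite /n2 -!RintZ; [|exact: L2_sq|exact: L2_sq].
rewrite -RintD; [|apply: L1Z; exact: L2_sq|apply: L1Z; exact: L2_sq].
apply: Rint_le; [by have [] := L2D Lf Lg| |].
  by apply: L1D; apply: L1Z; exact: L2_sq.
by move=> x; have := sqr_ge0 (f x - g x); nra.
Qed.

Lemma n2_sym f g : n2 (fun x => f x - g x) = n2 (fun x => g x - f x).
Proof. by apply: eq_Rintegral => x _; ring. Qed.

Lemma n2_tri f g h : L2 f -> L2 g -> L2 h ->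
  n2 (fun x => f x - h x) <=
  2 * n2 (fun x => f x - g x) + 2 * n2 (fun x => g x - h x).
Proof.
move=> Lf Lg Lh.
rewrite (_ : (fun x => f x - h x) = fun x => (f x - g x) + (g x - h x)).
  by apply: n2D_le; exact: L2B.
by apply/funext => x; ring.
Qed.

(** The discriminant argument for t |-> n2 (f - t g) >= 0. *)
Lemma cauchy_schwarz f g : L2 f -> L2 g -> ip f g ^+ 2 <= n2 f * n2 g.
Proof.
move=> Lf Lg.
have H (t : R) : 0 <= n2 f - 2 * t * ip f g + t ^+ 2 * n2 g.
  have := n2_ge0 (fun x => f x - t * g x).
  rewrite n2B//; last exact: L2Z.
  by rewrite n2Z// ipC ipZl// ipC mulrA.
have [g0|g0] := eqVneq (n2 g) 0.
  rewrite g0 mulr0; rewrite g0 in H.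
  have [->|i0] := eqVneq (ip f g) 0; first by rewrite expr0n.
  (* With n2 g = 0 the nonnegative function of t is affine, and this t would
     give it the value -1. *)
  have := H ((n2 f + 1) / (2 * ip f g)).
  rewrite mulr0 addr0 (_ : 2 * _ * _ = n2 f + 1); first by (move=> ?; exfalso; lra).
  by field.
have g1 : 0 < n2 g by rewrite lt_def g0 n2_ge0.
have /mulr_ge0/(_ (ltW g1)) := H (ip f g / n2 g).
set t := _ * _; have -> : t = n2 f * n2 g - ip f g ^+ 2 by rewrite /t; field.
by rewrite subr_ge0.
Qed.

Lemma n2_ae f g : measurable_fun [set: R] f -> measurable_fun [set: R] g ->
  aeq f g -> n2 f = n2 g.
Proof.
move=> mf mg fg; apply: Rint_ae; try exact: measurable_funX.
by move: fg; apply: AE1 => x ->.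
Qed.

Lemma ip_ae f f' g g' : measurable_fun [set: R] f -> measurable_fun [set: R] f' ->
  measurable_fun [set: R] g -> measurable_fun [set: R] g' ->
  aeq f f' -> aeq g g' -> ip f g = ip f' g'.
Proof.
move=> mf mf' mg mg' ff' gg'; apply: Rint_ae; try exact: measurable_funM.
by move: ff' gg'; apply: AE2 => x -> ->.
Qed.

Lemma n2_eq0 f : L2 f -> n2 f = 0 -> aeq f (fun=> 0).
Proof.
move=> [mf f2] f0.
have : (\int[mu]_x `|(f x ^+ 2)%:E| = 0)%E.
  rewrite (eint_eq (g := fun x => (f x ^+ 2)%:E)); last first.
    by move=> x; rewrite gee0_abs// lee_fin sqr_ge0.
  by rewrite -EFin_Rint// -/(n2 f) f0.
move/(ae_eq_integral_abs mu measurableT (measurable_int _ f2)).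
by apply: AE1 => x /= /(_ I) [] /eqP; rewrite sqrf_eq0 => /eqP.
Qed.

Lemma aeq_sub0 f g : aeq (fun x => f x - g x) (fun=> 0) -> aeq f g.
Proof. by apply: AE1 => x /subr0_eq. Qed.

Lemma n2_le0_aeq f g : L2 f -> L2 g ->
  (forall e, 0 < e -> n2 (fun x => f x - g x) <= e) -> aeq f g.
Proof.
move=> Lf Lg H; apply: aeq_sub0; apply: n2_eq0; first exact: L2B.
apply/eqP; rewrite eq_le n2_ge0 andbT; apply/ler_addgt0Pl => e e0.
by rewrite addr0 H.
Qed.

End L2kit.

(** * Completeness of L2 *)

Section completeness.
Context {R : realType}.
Local Notation mu := (@lebesgue_measure R).
Implicit Types f g h : R -> R.

Lemma cvgE (u : nat -> R) (l : R) : u n @[n --> \oo] --> l ->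
  (u n)%:E @[n --> \oo] --> l%:E.
Proof. by move=> ul; apply: cvg_EFin; [exact: nearW|exact: ul]. Qed.

(** With c_n = B t^n / (1 - t), the tail of the geometric series, u - c
    increases and u + c decreases, so both squeeze the same limit. *)
Lemma cvg_geometric_increments (u : nat -> R) (B t : R) : 0 <= B -> 0 <= t < 1 ->
  (forall n, `|u n.+1 - u n| <= B * t ^+ n) ->
  exists l, u n @[n --> \oo] --> l /\
    forall n, `|u n - l| <= B * t ^+ n / (1 - t).
Proof.
move=> B0 /andP[t0 t1] ut.
have t1' : 0 < 1 - t by lra.
pose c n := B / (1 - t) * t ^+ n.
have cS n : c n = B * t ^+ n + c n.+1.
  by rewrite /c exprS; field; rewrite gt_eqF.
have c0 : c n @[n --> \oo] --> (0 : R).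
  by apply: (@cvg_geometric R (B / (1 - t)) t); rewrite ger0_norm.
have cge n : 0 <= c n by rewrite /c mulr_ge0 ?exprn_ge0// divr_ge0// ltW.
have na : nondecreasing_seq (fun n => u n - c n).
  apply/nondecreasing_seqP => n; rewrite cS.
  by have := ut n; rewrite ler_norml => /andP[]; lra.
have nb : nonincreasing_seq (fun n => u n + c n).
  apply/nonincreasing_seqP => n; rewrite [in leRHS]cS.
  by have := ut n; rewrite ler_norml => /andP[]; lra.
have ab n m : u n - c n <= u m + c m.
  have := na n (maxn n m) (leq_maxl _ _); have := nb m (maxn n m) (leq_maxr _ _).
  by have := cge (maxn n m); rewrite /=; lra.
have ca : cvgn (fun n => u n - c n).
  apply: nondecreasing_is_cvgn => //; exists (u 0%N + c 0%N).
  by move=> _ [n _ <-]; exact: ab.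
set l := limn (fun n => u n - c n) in ca.
exists l; split.
  rewrite (_ : u = (fun n => (u n - c n) + c n)); last first.
    by apply/funext => n; rewrite subrK.
  by rewrite -[l]addr0; apply: cvgD.
move=> n.
have h1 : u n - c n <= l by exact: nondecreasing_cvgn_le.
have h2 : l <= u n + c n.
  by apply: limr_le => //; apply: nearW => m; exact: ab.
rewrite (_ : B * _ / _ = c n); last by rewrite /c; ring.
by rewrite ler_norml; apply/andP; split; lra.
Qed.

Lemma eint_fin (A : R -> \bar R) : (forall x, (0 <= A x)%E) ->
  (\int[mu]_x A x < +oo)%E -> (\int[mu]_x A x)%E \is a fin_num.
Proof. by move=> A0 Ai; rewrite ge0_fin_numE//; apply: integral_ge0 => x _; exact: A0. Qed.

(** The extended-real bound [A] lets an infinite series serve as a majorant;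
    it may take the value +oo on a null set. *)
Lemma L2_ae_le f (A : R -> \bar R) : measurable_fun [set: R] f ->
  measurable_fun [set: R] A -> (forall x, (0 <= A x)%E) ->
  (\int[mu]_x A x < +oo)%E ->
  AE (fun x => ((f x ^+ 2)%:E <= A x)%E) ->
  L2 f /\ n2 f <= fine (\int[mu]_x A x)%E.
Proof.
move=> mf mA A0 Ai fA.
have mf2 : measurable_fun [set: R] (fun x => f x ^+ 2) by exact: measurable_funX.
have le : (\int[mu]_x (f x ^+ 2)%:E <= \int[mu]_x A x)%E.
  apply: ae_ge0_le_integral => //.
  - by move=> x _; rewrite lee_fin sqr_ge0.
  - by apply/measurable_EFinP.
  - by move: fA; apply: AE1.
have L2f : L2 f.
  split=> //; apply: L1_ge0 => //; first by move=> x; exact: sqr_ge0.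
  exact: le_lt_trans Ai.
split => //; rewrite -lee_fin (fineK (eint_fin A0 Ai)).
by rewrite EFin_Rint//; exact: L2_sq.
Qed.

(** Fischer's argument for a geometric rate: with r = sqrt q, the series
    A = sum_n r^(-n) (f_{n+1} - f_n)^2 has a finite integral, hence is finite
    almost everywhere.  There |f_{n+1} - f_n| <= sqrt A sqrt(r)^n, which gives a
    pointwise limit g with (f_n - g)^2 <= K r^n A, and integrating this bound
    gives the convergence in L2. *)
Lemma L2_complete (f : nat -> R -> R) (C q : R) : 0 <= C -> 0 < q < 1 ->
  (forall n, L2 (f n)) ->
  (forall n, n2 (fun x => f n.+1 x - f n x) <= C * q ^+ n) ->
  exists2 g, L2 g & n2 (fun x => f n x - g x) @[n --> \oo] --> (0 : R).
Proof.
move=> C0 /andP[q0 q1] Lf fC.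
pose r := Num.sqrt q; pose t := Num.sqrt r.
have r0 : 0 < r by rewrite sqrtr_gt0.
have t0 : 0 < t by rewrite sqrtr_gt0.
have rq : r ^+ 2 = q by rewrite sqr_sqrtr// ltW.
have tr : t ^+ 2 = r by rewrite sqr_sqrtr// ltW.
have r1 : r < 1 by rewrite -(@ltr_pXn2r _ 2)// ?nnegrE ?(ltW r0)// expr1n rq.
have t1 : t < 1 by rewrite -(@ltr_pXn2r _ 2)// ?nnegrE ?(ltW t0)// expr1n tr.
have Ld n : L2 (fun x => f n.+1 x - f n x) by exact: L2B.
pose a n (x : R) : \bar R := (r ^- n * (f n.+1 x - f n x) ^+ 2)%:E.
have a0 n x : (0 <= a n x)%E.
  by rewrite lee_fin mulr_ge0 ?sqr_ge0// invr_ge0 exprn_ge0// ltW.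
have ma n : measurable_fun [set: R] (a n).
  apply/measurable_EFinP; apply: measurable_funM => //.
  by apply: measurable_funX; exact: L2_meas.
pose A x := (\sum_(n <oo) a n x)%E.
have A0 x : (0 <= A x)%E by apply: nneseries_ge0 => n _ _; exact: a0.
have mA : measurable_fun [set: R] A.
  exact: (@ge0_emeasurable_sum _ _ _ setT a xpredT).
have Ai : (\int[mu]_x A x < +oo)%E.
  rewrite integral_nneseries//.
  apply: (@le_lt_trans _ _ (\sum_(n <oo) (C * r ^+ n)%:E)%E).
    apply: lee_nneseries => n _; first by move=> _; apply: integral_ge0.
    rewrite /a -EFin_Rint; last by apply: L1Z; exact: L2_sq.
    rewrite RintZ; last exact: L2_sq.
    rewrite lee_fin mulrC ler_pdivrMr ?exprn_gt0// -mulrA -exprMn -expr2 rq.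
    exact: fC.
  have := @cvg_geometric_series R C r.
  rewrite ger0_norm ?(ltW r0)// => /(_ r1) H.
  have : (\sum_(0 <= k < n) (C * r ^+ k)%:E)%E @[n --> \oo] --> (C * (1 - r)^-1)%:E.
    move/cvgE: H.
    apply: cvg_trans; apply: near_eq_cvg; apply: nearW => n /=.
    by rewrite sumEFin.
  by move/cvg_lim => ->//; rewrite ltry.
have Afin : AE (fun x => A x < +oo)%E.
  have iA : mu.-integrable setT A.
    apply/integrableP; split => //.
    by rewrite (eint_eq (g := A))// => x; rewrite gee0_abs.
  by move: (integrable_ae measurableT iA); apply: AE1 => x /(_ I); rewrite ge0_fin_numE.
(* The limit superior is measurable everywhere and equals the limit wherever
   the latter exists. *)
pose g x := fine (limn_esup (fun n => (f n x)%:E)).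
have mg : measurable_fun [set: R] g.
  apply: measurableT_comp => //; apply: measurable_fun_limn_esup => n.
  by apply/measurable_EFinP; exact: L2_meas.
pose K := (1 - t) ^- 2.
have K0 : 0 <= K by rewrite invr_ge0 exprn_ge0// subr_ge0 ltW.
have bnd : AE (fun x => forall n, ((f n x - g x) ^+ 2)%:E <= (K * r ^+ n)%:E * A x)%E.
  move: Afin; apply: AE1 => x Ax.
  have AE : A x = (fine (A x))%:E by rewrite fineK// ge0_fin_numE.
  have hb n : `|f n.+1 x - f n x| <= Num.sqrt (fine (A x)) * t ^+ n.
    rewrite -ler_sqr ?nnegrE ?mulr_ge0 ?sqrtr_ge0 ?exprn_ge0 ?(ltW t0)//.
    rewrite exprMn sqr_sqrtr ?fine_ge0// real_normK ?num_real// -exprM mulnC exprM tr.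
    rewrite -ler_pdivrMr ?exprn_gt0// mulrC.
    rewrite -lee_fin -AE -/(a n x).
    have := @nneseries_lim_ge R (a ^~ x) xpredT 0 n.+1 (fun n _ _ => a0 n x).
    apply: le_trans; rewrite big_nat_recr//= leeDr//.
    by apply: sume_ge0.
  have [|l [fl ln] n] :=
    @cvg_geometric_increments (f ^~ x) (Num.sqrt (fine (A x))) t (sqrtr_ge0 _) _ hb.
    by rewrite (ltW t0) t1.
  have gl : g x = l.
    rewrite /g is_cvg_limn_esupE.
      by have /cvg_lim -> // := cvgE fl.
    by apply/cvg_ex; exists l%:E; exact: cvgE.
  rewrite gl AE -EFinM lee_fin -real_normK ?num_real//.
  apply: (@le_trans _ _ ((Num.sqrt (fine (A x)) * t ^+ n / (1 - t)) ^+ 2)).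
    by rewrite ler_sqr ?nnegrE ?(le_trans _ (ln n)).
  rewrite !exprMn sqr_sqrtr ?fine_ge0// -exprM mulnC exprM tr exprVn.
  by rewrite le_eqVlt; apply/orP; left; apply/eqP; rewrite /K; ring.
have res n : L2 (fun x => f n x - g x) /\
    n2 (fun x => f n x - g x) <= fine (\int[mu]_x A x)%E * K * r ^+ n.
  have Kr0 : 0 <= K * r ^+ n by rewrite mulr_ge0// exprn_ge0// ltW.
  have iE : (\int[mu]_x ((K * r ^+ n)%:E * A x) = (K * r ^+ n)%:E * \int[mu]_x A x)%E.
    by rewrite ge0_integralZl.
  have [] := @L2_ae_le (fun x => f n x - g x) (fun x => (K * r ^+ n)%:E * A x)%E.
  - by apply: measurable_funB => //; exact: L2_meas.
  - by apply: emeasurable_funM.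
  - by move=> x; rewrite mule_ge0// lee_fin.
  - rewrite iE -(@fineK _ (\int[mu]_x A x)%E) -?EFinM ?ltry//.
    by exact: (eint_fin A0 Ai).
  - by move: bnd; apply: AE1.
  move=> H1 H2; split => //; apply: (le_trans H2).
  by rewrite iE -(fineK (eint_fin A0 Ai)) -EFinM/= mulrC mulrA.
exists g.
  rewrite (_ : g = fun x => f 0%N x - (f 0%N x - g x)); last first.
    by apply/funext => x; ring.
  by apply: L2B => //; exact: (res 0%N).1.
apply: (@squeeze_cvgr _ _ _ _ (fun=> 0) (geometric (fine (\int[mu]_x A x)%E * K) r)).
- by apply: nearW => n; rewrite n2_ge0 (res n).2.
- exact: cvg_cst.
- by apply: cvg_geometric; rewrite ger0_norm ?ltW.
Qed.

End completeness.

(** * Limits under the integral sign, reflections and Fubini *)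

Section tools.
Context {R : realType}.
Local Notation mu := (@lebesgue_measure R).
Implicit Types f g h : R -> R.

Lemma Rint_dct (f_ : nat -> R -> R) f g :
  (forall n, measurable_fun [set: R] (f_ n)) -> measurable_fun [set: R] f ->
  AE (fun x => f_ n x @[n --> \oo] --> f x) -> L1 g ->
  (forall n x, `|f_ n x| <= g x) ->
  L1 f /\ \int[mu]_x f_ n x @[n --> \oo] --> \int[mu]_x f x.
Proof.
move=> mf_ mf cf Ig fg.
have [] := @dominated_convergence _ (measurableTypeR R) R mu setT measurableT
  (fun n x => (f_ n x)%:E) (EFin \o f) (EFin \o g).
- by move=> n; apply/measurable_EFinP; exact: mf_.
- by apply/measurable_EFinP; exact: mf.
- by move: cf; apply: AE1 => x cx _; exact: cvgE.
- exact: Ig.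
- by apply: AEW => x n _; rewrite lee_fin.
move=> If _ H; split; first exact: If.
by move: H; rewrite -(fineK (integrable_fin_num measurableT If)) => /fine_cvg.
Qed.

(** Used to pass from uniformly bounded truncated or weighted integrals to
    integrability of the limit. *)
Lemma Rint_fatou (f_ : nat -> R -> R) f (M : R) :
  (forall n, L1 (f_ n)) -> measurable_fun [set: R] f ->
  (forall n x, 0 <= f_ n x) ->
  (forall x, f_ n x @[n --> \oo] --> f x) ->
  (forall n, \int[mu]_x f_ n x <= M) ->
  L1 f /\ \int[mu]_x f x <= M.
Proof.
move=> If_ mf f0 cf fM.
have fge0 x : 0 <= f x.
  by apply: (cvgr_to_ge (cf x)); apply: nearW => n; exact: f0.
have le : (\int[mu]_x (f x)%:E <= M%:E)%E.
  rewrite (eint_eq (g := fun x => limn_einf (fun n => (f_ n x)%:E))); last first.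
    move=> x; have /cvg_limn_einf_sup[-> _] // := cvgE (cf x).
  apply: le_trans.
    apply: fatou => //.
      by move=> n; apply/measurable_EFinP; exact: L1_meas.
    by move=> n x _; rewrite lee_fin.
  rewrite limn_einf_lim; apply: lime_le; first exact: is_cvg_einfs.
  apply: nearW => n; apply: (@le_trans _ _ (\int[mu]_x (f_ n x)%:E)%E).
    by apply: ereal_inf_lbound; exists n => /=.
  by rewrite -EFin_Rint// lee_fin.
have If : L1 f by apply: L1_ge0 => //; exact: (le_lt_trans le (ltry _)).
by split => //; rewrite -lee_fin EFin_Rint.
Qed.

Lemma measurable_refl (c : R) : measurable_fun [set: R] (fun x : R => c - x).
Proof. by apply: measurable_funB. Qed.

(** Lebesgue measure is determined by its values on intervals, which a
    reflection x |-> c - x maps to intervals of the same length.  Translations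
    are obtained by composing two reflections. *)
Lemma mu_refl (c : R) (A : set R) : measurable A ->
  pushforward mu (fun x : measurableTypeR R => c - x : measurableTypeR R) A = mu A.
Proof.
move=> mA; apply/esym.
apply: lebesgue_measure_unique => //=; first exact: measurable_refl.
move=> mr _ [[a b]] _ <-.
rewrite /pushforward (_ : _ @^-1` _ = `[c - b, c - a[%classic); last first.
  apply/seteqP; split=> x /=; rewrite !in_itv/= => /andP[? ?]; apply/andP; split; lra.
rewrite !lebesgue_measure_itv/= !lte_fin (_ : (c - b < c - a) = (a < b)).
  by case: ifP => // _; rewrite -!EFinB; congr EFin; ring.
by apply/idP/idP => ?; lra.
Qed.

Lemma AE_refl (c : R) (P : R -> Prop) : AE P -> AE (fun x => P (c - x)).
Proof.
move=> [N [mN N0 PN]]; exists ((fun x => c - x) @^-1` N); split.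
- by rewrite -[X in measurable X]setTI; apply: measurable_refl.
- by have := mu_refl c mN; rewrite /pushforward => ->.
- by move=> x /= H; apply: PN.
Qed.

Lemma eint_refl (c : R) (f : R -> \bar R) : measurable_fun [set: R] f ->
  (forall x, (0 <= f x)%E) ->
  (\int[mu]_x f (c - x)%R = \int[mu]_x f x)%E.
Proof.
move=> mf f0.
rewrite -[LHS](@ge0_integral_pushforward _ _ (measurableTypeR R) (measurableTypeR R)
  R (fun x => c - x) (measurable_refl c) mu setT f)//.
apply: eq_measure_integral => [|mr A mA _]; [exact: measurable_refl|exact: mu_refl].
Qed.

Lemma L1_refl (c : R) f : L1 f -> L1 (fun x => f (c - x)).
Proof.
move=> If; have [mf fi] := integrableP _ _ _ If.
have mf' : measurable_fun [set: R] f by exact: L1_meas.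
apply/integrableP; split.
  apply/measurable_EFinP.
  by apply: (@measurableT_comp _ _ _ _ _ _ f) => //; exact: measurable_refl.
rewrite (@eint_refl c (fun x => `|(f x)%:E|%E))//.
by apply: measurableT_comp => //; apply/measurable_EFinP.
Qed.

Lemma Rint_refl (c : R) f : L1 f -> \int[mu]_x f (c - x) = \int[mu]_x f x.
Proof.
move=> If; congr fine; have mf := L1_meas If.
rewrite -[LHS](@integral_pushforward _ _ (measurableTypeR R) (measurableTypeR R)
  R (fun x => c - x) (measurable_refl c) mu setT (EFin \o f))//.
- apply: eq_measure_integral => [|mr A mA _]; [exact: measurable_refl|exact: mu_refl].
- exact/measurable_EFinP.
- exact: L1_refl.
Qed.

Lemma meas_refl (c : R) f : measurable_fun [set: R] f ->
  measurable_fun [set: R] (fun x => f (c - x)).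
Proof.
by move=> mf; apply: (@measurableT_comp _ _ _ _ _ _ f) => //; exact: measurable_refl.
Qed.

Lemma L2_refl (c : R) f : L2 f -> L2 (fun x => f (c - x)).
Proof.
by move=> [mf f2]; split; [exact: meas_refl|exact: (L1_refl c f2)].
Qed.

Lemma n2_refl (c : R) f : L2 f -> n2 (fun x => f (c - x)) = n2 f.
Proof. by move=> Lf; apply: (Rint_refl c (L2_sq Lf)). Qed.

Lemma meas_Rint_param (k : R * R -> R) : measurable_fun [set: R * R] k ->
  measurable_fun [set: R] (fun x => \int[mu]_y k (x, y)).
Proof.
move=> mk; apply: measurableT_comp => //.
have mk' : measurable_fun [set: R * R] (EFin \o k) by apply/measurable_EFinP.
rewrite (_ : (fun x => _) = (fun x => (\int[mu]_y ((EFin \o k)^\+ (x, y))) -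
   (\int[mu]_y ((EFin \o k)^\- (x, y))))%E); last first.
  apply/funext => x; have H := integralE mu setT (fun y : R => (k (x, y))%:E).
  etransitivity; first exact: H.
  by congr (_ - _)%E; apply: eint_eq => y; rewrite ?funeposE ?funenegE.
apply: emeasurable_funB.
- apply: (@measurable_fun_fubini_tonelli_F _ _ (measurableTypeR R) (measurableTypeR R) R mu) => //.
  exact: (measurable_funepos mk').
- apply: (@measurable_fun_fubini_tonelli_F _ _ (measurableTypeR R) (measurableTypeR R) R mu) => //.
  exact: (measurable_funeneg mk').
Qed.

Lemma meas_swap (k : R * R -> R) : measurable_fun [set: R * R] k ->
  measurable_fun [set: R * R] (fun z => k (z.2, z.1)).
Proof.
move=> mk; apply: (@measurableT_comp _ _ _ _ _ _ k) => //.
by apply: measurable_fun_pair.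
Qed.

Lemma Rint_Fubini (k : R * R -> R) : measurable_fun [set: R * R] k ->
  (\int[mu]_x \int[mu]_y (`|k (x, y)|)%:E < +oo)%E ->
  [/\ AE (fun x => L1 (fun y => k (x, y))), AE (fun y => L1 (fun x => k (x, y))),
     L1 (fun x => \int[mu]_y k (x, y)), L1 (fun y => \int[mu]_x k (x, y)) &
     \int[mu]_x (\int[mu]_y k (x, y)) = \int[mu]_y (\int[mu]_x k (x, y))].
Proof.
move=> mk ki.
have mk' : measurable_fun [set: R * R] (EFin \o k) by apply/measurable_EFinP.
have ik : (mu \x mu)%E.-integrable setT (EFin \o k).
  by apply/(@integrable12ltyP _ _ (measurableTypeR R) (measurableTypeR R) R mu mu).
have a1 : AE (fun x => L1 (fun y => k (x, y))).
  exact: (@ae_integrable1 _ _ (measurableTypeR R) (measurableTypeR R) R mu mu _ ik).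
have a2 : AE (fun y => L1 (fun x => k (x, y))).
  exact: (@ae_integrable2 _ _ (measurableTypeR R) (measurableTypeR R) R mu mu _ ik).
have m1 : measurable_fun [set: R] (fun x => \int[mu]_y k (x, y)) by exact: meas_Rint_param.
have m2 : measurable_fun [set: R] (fun y => \int[mu]_x k (x, y)).
  by have := meas_Rint_param (meas_swap mk).
have I1 := @integrable_fubini_F _ _ (measurableTypeR R) (measurableTypeR R) R mu mu _ ik.
have I2 : mu.-integrable setT (fun y => \int[mu]_x (EFin \o k) (x, y))%E.
  have mks := meas_swap mk.
  have iks : (mu \x mu)%E.-integrable setT (fun z => (k (z.2, z.1))%:E).
    apply/(@integrable21ltyP _ _ (measurableTypeR R) (measurableTypeR R) R mu mu) => //.
    exact/measurable_EFinP.
  exact: (@integrable_fubini_F _ _ (measurableTypeR R) (measurableTypeR R) R mu mu _ iks).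
have e1 : AE (fun x => (\int[mu]_y k (x, y))%:E = (\int[mu]_y (EFin \o k) (x, y))%E).
  by move: a1; apply: AE1 => x ix; rewrite EFin_Rint.
have e2 : AE (fun y => (\int[mu]_x k (x, y))%:E = (\int[mu]_x (EFin \o k) (x, y))%E).
  by move: a2; apply: AE1 => x ix; rewrite EFin_Rint.
have E1 : (\int[mu]_x (\int[mu]_y k (x, y))%:E = \int[mu]_x \int[mu]_y (EFin \o k) (x, y))%E.
  apply: ae_eq_integral => //; first exact/measurable_EFinP.
    exact: measurable_int I1.
  by move: e1; apply: AE1.
have E2 : (\int[mu]_y (\int[mu]_x k (x, y))%:E = \int[mu]_y \int[mu]_x (EFin \o k) (x, y))%E.
  apply: ae_eq_integral => //; first exact/measurable_EFinP.
    exact: measurable_int I2.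
  by move: e2; apply: AE1.
split => //.
- apply/integrableP; split; first exact/measurable_EFinP.
  have [mI1 fI1] := integrableP _ _ _ I1; move: fI1; congr (_ < _)%E.
  apply: ae_eq_integral => //; [exact: measurableT_comp| |].
    by apply: measurableT_comp => //; apply/measurable_EFinP.
  by move: e1; apply: AE1 => x ex _; congr (abse _); exact: esym ex.
- apply/integrableP; split; first exact/measurable_EFinP.
  have [mI2 fI2] := integrableP _ _ _ I2; move: fI2; congr (_ < _)%E.
  apply: ae_eq_integral => //; [exact: measurableT_comp| |].
    by apply: measurableT_comp => //; apply/measurable_EFinP.
  by move: e2; apply: AE1 => x ex _; congr (abse _); exact: esym ex.
- rewrite /Rintegral; congr fine; rewrite E1 E2.
  exact: (@Fubini _ _ (measurableTypeR R) (measurableTypeR R) R mu mu _ ik).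
Qed.

End tools.

(** * Intervals and truncation *)

Section intervals.
Context {R : realType}.
Local Notation mu := (@lebesgue_measure R).
Implicit Types f g h : R -> R.

Definition itv1 (c d : R) : R -> R := \1_(`]c, d[%classic).
Definition trunc (n : nat) f : R -> R :=
  fun x => f x * \1_(`[- n%:R, n%:R]%classic) x.

Lemma L1_indic (i : interval R) : (mu [set` i] < +oo)%E ->
  L1 (\1_[set` i] : R -> R).
Proof.
move=> fi; have mi : measurable ([set` i] : set R) by exact: measurable_itv.
apply: L1_ge0.
- exact: measurable_indic.
- by move=> x; rewrite indicE; case: (x \in _).
- by rewrite integral_indic ?setIT.
Qed.

Lemma Rint_indic (i : interval R) :
  \int[mu]_x (\1_[set` i] x : R) = fine (mu [set` i]).
Proof. by rewrite /Rintegral integral_indic ?setIT//; exact: measurable_itv. Qed.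

Lemma indic_sqr (A : set R) x : (\1_A x : R) ^+ 2 = \1_A x.
Proof. by rewrite indicE; case: (x \in A); rewrite ?expr1n ?expr0n. Qed.

Lemma measurable_indic_itv (i : interval R) :
  measurable_fun [set: R] (\1_[set` i] : R -> R).
Proof. by apply: measurable_indic; exact: measurable_itv. Qed.

Lemma L2_indic (i : interval R) : (mu [set` i] < +oo)%E ->
  L2 (\1_[set` i] : R -> R).
Proof.
move=> fi; split; first exact: measurable_indic_itv.
rewrite (_ : (fun x => _) = \1_[set` i]); first exact: L1_indic.
by apply/funext => x; rewrite indic_sqr.
Qed.

Lemma mu_oo (c d : R) : (mu `]c, d[%classic < +oo)%E.
Proof. by rewrite lebesgue_measure_itv/=; case: ifP => _; rewrite -?EFinB ltry. Qed.

Lemma mu_cc (c d : R) : (mu `[c, d]%classic < +oo)%E.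
Proof. by rewrite lebesgue_measure_itv/=; case: ifP => _; rewrite -?EFinB ltry. Qed.

Lemma L1_itv1 c d : L1 (itv1 c d). Proof. by apply: L1_indic; exact: mu_oo. Qed.
Lemma L2_itv1 c d : L2 (itv1 c d). Proof. by apply: L2_indic; exact: mu_oo. Qed.

Lemma Rint_itv1 c d : c < d -> \int[mu]_x itv1 c d x = d - c.
Proof. by move=> cd; rewrite Rint_indic lebesgue_measure_itv/= lte_fin cd. Qed.

Lemma n2_itv1 c d : c < d -> n2 (itv1 c d) = d - c.
Proof.
move=> cd; rewrite -Rint_itv1//; apply: eq_Rintegral => x _.
exact: indic_sqr.
Qed.

Lemma indic_le1 (A : set R) x : `|(\1_A x : R)| <= 1.
Proof. by rewrite indicE; case: (x \in A); rewrite ?normr1 ?normr0. Qed.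

Lemma L2_trunc n f : L2 f -> L2 (trunc n f).
Proof.
move=> Lf; apply: (L2_le _ Lf).
  by apply: measurable_funM; [exact: L2_meas|exact: measurable_indic_itv].
by move=> x; rewrite normrM ler_piMr// indic_le1.
Qed.

Lemma L1_trunc n f : L2 f -> L1 (trunc n f).
Proof. by move=> Lf; apply: L2_mul => //; apply: L2_indic; exact: mu_cc. Qed.

Lemma trunc_cvg_pt f x : trunc n f x @[n --> \oo] --> f x.
Proof.
apply: cvg_near_cst; near=> n; rewrite /trunc indicE mem_set ?mulr1//=.
rewrite in_itv/= -ler_norml; near: n; exact: nbhs_infty_ger.
Unshelve. all: by end_near. Qed.

Lemma trunc_cvg f : L2 f ->
  n2 (fun x => trunc n f x - f x) @[n --> \oo] --> (0 : R).
Proof.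
move=> Lf.
have [] := @Rint_dct R (fun n x => (trunc n f x - f x) ^+ 2) (fun=> 0)
   (fun x => f x ^+ 2).
- by move=> n; apply: measurable_funX; apply: measurable_funB; apply: L2_meas => //; exact: L2_trunc.
- exact: measurable_cst.
- apply: AEW => x; rewrite [X in _ --> X](_ : 0 = (f x - f x) ^+ 2); last by rewrite subrr expr0n.
  rewrite expr2; under eq_fun do rewrite expr2.
  by apply: cvgM; (apply: cvgB; [exact: trunc_cvg_pt|exact: cvg_cst]).
- exact: L2_sq.
- move=> n x; rewrite ger0_norm ?sqr_ge0// /trunc indicE.
  by case: (x \in _); rewrite ?mulr1 ?mulr0 ?subrr ?sub0r ?sqrrN// expr0n sqr_ge0.
move=> _; rewrite (_ : \int[mu]_x 0 = 0)//.
by rewrite /Rintegral integral0.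
Qed.

Lemma L2_locally_integrable f : L2 f -> locally_integrable setT f.
Proof.
move=> Lf; have mf := L2_meas Lf; split => //; first exact: openT.
move=> K _ cK; have mK : measurable K by exact: compact_measurable.
apply: (@le_lt_trans _ _ (\int[mu]_(x in K) ((f x ^+ 2)%:E + (1%:E)))%E).
  apply: ge0_le_integral => //.
  - by apply: measurableT_comp => //; apply: measurableT_comp => //; exact: measurable_funS mf.
  - apply/measurable_EFinP; apply: measurable_funD => //.
    by apply: measurable_funX; exact: measurable_funS mf.
  - move=> x _; rewrite -EFinD lee_fin.
    by have := sqr_ge0 (`|f x| - 1); rewrite -(real_normK (num_real (f x))); have := normr_ge0 (f x); nra.
rewrite ge0_integralD//.
- rewrite integral_cst// mul1e; apply: lte_add_pinfty; last exact: compact_finite_measure.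
  apply: le_lt_trans (L1_lty (L2_sq Lf) (fun x => sqr_ge0 _)).
  apply: ge0_subset_integral => //.
    by apply/measurable_EFinP; apply: measurable_funX.
  by move=> x _; rewrite lee_fin sqr_ge0.
- by move=> x _; rewrite lee_fin sqr_ge0.
- by apply/measurable_EFinP; apply: measurable_funX; exact: measurable_funS mf.
Qed.

(** By Lebesgue differentiation, f(x) is for almost every x the limit of
    the averages of f on balls around x, which all vanish.  This replaces the
    density of step functions in L2. *)
Lemma L2_itv_zero f : L2 f -> (forall c d, c < d -> ip f (itv1 c d) = 0) ->
  aeq f (fun=> 0).
Proof.
move=> Lf H.
have : AE (lebesgue_pt f).
  exact: (lebesgue_differentiation (L2_locally_integrable Lf)).
apply: AE1 => x lx; apply/eqP; rewrite -normr_le0 -lee_fin.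
apply: (cvge_to_ge lx); near=> r.
have r0 : 0 < r by near: r; exact: nbhs_right_gt.
have mB : measurable (ball x r) by exact: measurable_ball.
rewrite /davg /iavg (lebesgue_measure_ball _ (ltW r0)) inver mulrn_eq0/= gt_eqF//.
rewrite ball_itv.
have xr : x - r < x + r by lra.
pose e y := f y * itv1 (x - r) (x + r) y - f x * itv1 (x - r) (x + r) y.
have I1 : L1 (fun y => f y * itv1 (x - r) (x + r) y).
  by apply: L2_mul => //; exact: L2_itv1.
have I2 : L1 (fun y => f x * itv1 (x - r) (x + r) y).
  by apply: L1Z; exact: L1_itv1.
have Ie : L1 e by exact: L1B.
(* The deviation e = f - f(x) on the ball has integral - 2 r f(x), so |f(x)| is
   at most the average of |e|, which tends to 0. *)
have eE : \int[mu]_y e y = - (f x * (r *+ 2)).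
  rewrite /e RintB// RintZ; last exact: L1_itv1.
  have := H _ _ xr; rewrite /ip => ->; rewrite Rint_itv1// sub0r.
  by congr (- (_ * _)); rewrite mulr2n; ring.
have := Rint_norm_le Ie; rewrite eE normrN normrM (ger0_norm (_ : 0 <= r *+ 2)); last first.
  by rewrite mulrn_wge0// ltW.
rewrite -lee_fin EFin_Rint; last exact: L1_norm.
move=> le; rewrite integral_mkcond (eint_eq (g := fun y => (`|e y|)%:E)); last first.
  move=> y; rewrite patchE /e /itv1 indicE /=; case: ifPn => _.
    by rewrite !mulr1.
  by rewrite !mulr0 subrr normr0.
have r20 : 0 < r *+ 2 by rewrite mulrn_wgt0.
by rewrite lee_pdivlMl// -EFinM mulrC.
Unshelve. all: by end_near. Qed.

End intervals.

(** * The exponential weight and the Poisson kernel *)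

Section exponential_weight.
Context {R : realType}.
Local Notation mu := (@lebesgue_measure R).
Implicit Types f g h : R -> R.

(** Derivatives at all points, as a relation between functions, so that the
    derivative of a compound expression is found by composing lemmas and
    adjusted once with [der_eq]. *)
Definition der (f : R -> R) (f' : R -> R) := forall x, is_derive x (1 : R) f (f' x).

Lemma der_id : der id (fun=> 1). Proof. by move=> x; exact: is_derive_id. Qed.
Lemma der_cst (c : R) : der (fun=> c) (fun=> 0).
Proof. by move=> x; exact: is_derive_cst. Qed.
Lemma derD f f' g g' : der f f' -> der g g' ->
  der (fun x => f x + g x) (fun x => f' x + g' x).
Proof. by move=> df dg x; have := df x; have := dg x => ? ?; exact: is_deriveD. Qed.
Lemma derN f f' : der f f' -> der (fun x => - f x) (fun x => - f' x).
Proof. by move=> df x; have := df x => ?; exact: is_deriveN. Qed.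
Lemma derM f f' g g' : der f f' -> der g g' ->
  der (fun x => f x * g x) (fun x => f' x * g x + f x * g' x).
Proof.
move=> df dg x; have ? := df x; have ? := dg x.
have : is_derive x 1 (f * g) (f x *: g' x + g x *: f' x) by exact: is_deriveM.
by move=> H; apply: is_derive_eq; rewrite /GRing.scale/= addrC [g x * _]mulrC.
Qed.
Lemma der_comp f f' g g' : der f f' -> der g g' ->
  der (fun x => f (g x)) (fun x => f' (g x) * g' x).
Proof.
move=> df dg x; have ? := df (g x); have ? := dg x.
exact: (@is_derive1_comp _ f g).
Qed.
Lemma der_eq f f' g : der f f' -> f' =1 g -> der f g.
Proof. by move=> df /funext <-. Qed.
Lemma derZ (c : R) f f' : der f f' -> der (fun x => c * f x) (fun x => c * f' x).
Proof.
move=> df; apply: der_eq (derM (der_cst c) df) _ => x.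
by rewrite mul0r add0r.
Qed.
Lemma der_sin : der sin cos. Proof. by move=> x; exact: is_derive_sin. Qed.
Lemma der_cos : der cos (fun x => - sin x).
Proof. by move=> x; exact: is_derive_cos. Qed.
Lemma der_expR : der expR expR. Proof. by move=> x; exact: is_derive_expR. Qed.
Lemma der_cont f f' : der f f' -> continuous f.
Proof.
move=> df x; apply: differentiable_continuous; apply/derivable1_diffP.
by have ? := df x; exact: ex_derive.
Qed.

Lemma cont_meas f : continuous f -> measurable_fun [set: R] f.
Proof. exact: continuous_measurable_fun. Qed.

Lemma Rint_itv_indic (i : interval R) f :
  \int[mu]_(x in [set` i]) f x = \int[mu]_x (f x * \1_[set` i] x).
Proof.
rewrite Rintegral_mkcond; apply: eq_Rintegral => x _.
by rewrite patch_indic.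
Qed.

Lemma FTC_R F g (a b : R) : a <= b -> der F g -> continuous g ->
  \int[mu]_x (g x * \1_(`[a, b]%classic) x) = F b - F a.
Proof.
move=> ab dF cg; rewrite -Rint_itv_indic.
move: ab; rewrite le_eqVlt => /predU1P[<-|ab].
  by rewrite set_itv1 Rintegral_set1 subrr.
rewrite /Rintegral (@continuous_FTC2 _ g F)//.
- exact: continuous_subspaceT.
- have cF := der_cont dF; split.
  + by move=> x _; have ? := dF x; exact: ex_derive.
  + by apply: cvg_at_right_filter; exact: cF.
  + by apply: cvg_at_left_filter; exact: cF.
- by move=> x _; rewrite derive1E; have ? := dF x; exact: derive_val.
Qed.

Lemma itv1_cc (c d : R) : aeq (itv1 c d) (\1_(`[c, d]%classic) : R -> R).
Proof.
apply: AE2 (AE_neq c) (AE_neq d) => x xc xd.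
rewrite /itv1 !indicE !mem_setE !in_itv/= !le_eqVlt.
by rewrite [c == x]eq_sym (negbTE xc) (negbTE xd).
Qed.

Lemma FTC_itv1 F g (a b : R) : a <= b -> der F g -> continuous g ->
  \int[mu]_x (g x * itv1 a b x) = F b - F a.
Proof.
move=> ab dF cg; rewrite -(FTC_R ab dF cg); apply: Rint_ae.
- by apply: measurable_funM; [exact: cont_meas|exact: measurable_indic_itv].
- by apply: measurable_funM; [exact: cont_meas|exact: measurable_indic_itv].
- by move: (itv1_cc a b); apply: AE1 => x ->.
Qed.

(** The weight e^(-e|p|), which makes the energy of a transform integrable
    before any L2 bound is known. *)
Definition wexp (e p : R) := expR (- (e * `|p|)).
Definition cas (t : R) := cos t + sin t.
(** 2 pi times the Poisson kernel of the half-plane. *)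
Definition poissonk (e t : R) := 2 * e / (e ^+ 2 + t ^+ 2).

Lemma cont_cas : continuous (cas : R -> R).
Proof. by move=> x; apply: cvgD; [exact: continuous_cos|exact: continuous_sin]. Qed.

Lemma cas_le2 t : `|cas t| <= 2.
Proof.
rewrite (le_trans (ler_normD _ _))// (_ : 2 = 1 + 1 :> R)// lerD//.
  by rewrite ler_norml cos_le1 cos_geN1.
by rewrite ler_norml sin_le1 sin_geN1.
Qed.

Lemma casD (x y : R) : cas (x + y) = cos x * cas y + sin x * cas (- y).
Proof. by rewrite /cas cosD sinD cosN sinN; ring. Qed.

Lemma cas_mul (x y : R) : cas x * cas y = cos (x - y) + sin (x + y).
Proof. by rewrite /cas cosB sinD; ring. Qed.

Lemma wexp_gt0 e p : 0 < wexp e p. Proof. exact: expR_gt0. Qed.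

Lemma meas_wexp e : measurable_fun [set: R] (wexp e).
Proof.
apply: measurableT_comp => //; apply: measurableT_comp => //.
exact: measurable_funM.
Qed.

Lemma cvg_expRNn e : 0 < e -> expR (- (e * n%:R)) @[n --> \oo] --> (0 : R).
Proof.
move=> e0.
rewrite (_ : (fun n => _) = geometric 1 (expR (- e))); last first.
  by apply/funext => n /=; rewrite mul1r -expRM_natr mulNr.
by apply: cvg_geometric; rewrite ger0_norm ?expR_ge0// expR_lt1 oppr_lt0.
Qed.

Lemma cont_cosM (a : R) : continuous (fun p => cos (a * p)).
Proof. exact: (der_cont (der_comp der_cos (derZ a der_id))). Qed.

Lemma cont_sinM (a : R) : continuous (fun p => sin (a * p)).
Proof. exact: (der_cont (der_comp der_sin (derZ a der_id))). Qed.

Definition hcut (n : nat) : R -> R := \1_(`[0, n%:R]%classic).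
Definition half : R -> R := \1_(`[0, +oo[%classic).

Lemma half_cvg x : hcut n x @[n --> \oo] --> half x.
Proof.
apply: cvg_near_cst; near=> n; rewrite /hcut /half !indicE !mem_setE !in_itv/= andbT.
suff -> : x <= n%:R by rewrite andbT.
by apply: (le_trans (ler_norm x)); near: n; exact: nbhs_infty_ger.
Unshelve. all: by end_near. Qed.

Lemma hcut_wexp e n x : wexp e x * hcut n x = expR (- (e * x)) * hcut n x.
Proof.
rewrite /wexp /hcut indicE mem_setE in_itv/=.
by case: (leP 0 x) => x0; [rewrite ger0_norm|rewrite !mulr0].
Qed.

Lemma der_expN e : der (fun p => expR (- (e * p))) (fun p => - e * expR (- (e * p))).
Proof.
apply: der_eq (der_comp der_expR (derN (derZ e der_id))) _ => x.
by rewrite mulr1 mulrC.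
Qed.

Lemma L1_wexp_half e : 0 < e -> L1 (fun p => wexp e p * half p).
Proof.
move=> e0.
have [] // := @Rint_fatou R (fun n p => wexp e p * hcut n p)
   (fun p => wexp e p * half p) e^-1.
- move=> n; apply: L1_le (L1_indic (mu_cc 0 n%:R)) _.
    by apply: measurable_funM; [exact: meas_wexp|exact: measurable_indic_itv].
  move=> x; rewrite normrM (ger0_norm (ltW (wexp_gt0 _ _))).
  rewrite /hcut indicE; case: (_ \in _); last by rewrite !mulr0n normr0 mulr0.
  rewrite !mulr1n normr1 mulr1.
  by rewrite /wexp -expR0 ler_expR oppr_le0 mulr_ge0// ltW.
- by apply: measurable_funM; [exact: meas_wexp|exact: measurable_indic_itv].
- by move=> n x; apply: mulr_ge0; [exact: ltW (wexp_gt0 _ _)|rewrite /hcut indicE ler0n].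
- by move=> x; apply: cvgM; [exact: cvg_cst|exact: half_cvg].
move=> n; under eq_Rintegral do rewrite hcut_wexp.
rewrite (@FTC_R (fun p => - e^-1 * expR (- (e * p))))//.
- rewrite mulr0 oppr0 expR0 mulr1 opprK mulNr gerDr oppr_le0.
  by apply: mulr_ge0; rewrite ?expR_ge0// invr_ge0 ltW.
- apply: der_eq (derZ _ (der_expN e)) _ => x.
  by rewrite mulrA mulrNN mulVf ?mul1r// gt_eqF.
- exact: (der_cont (der_expN e)).
Qed.

Lemma half_split : AE (fun p => 1 = half p + half (0 - p)).
Proof.
exists [set 0]; split; [exact: measurable_set1|exact: lebesgue_measure_set1|].
move=> x /= H; apply: contrapT => /eqP x0; apply: H.
rewrite /half !indicE !mem_setE !in_itv/= !andbT sub0r.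
by case: (ltgtP x 0) x0 => // x0 _; rewrite ?oppr_ge0 ?oppr_lt0;
  [rewrite ltW ?add0r|rewrite leNgt x0 addr0].
Qed.

Lemma L1_wexp e : 0 < e -> L1 (wexp e).
Proof.
move=> e0; have H := L1_wexp_half e0.
apply: (L1_ae (L1D H (L1_refl 0 H))); first exact: meas_wexp.
move: half_split; apply: AE1 => x E.
by rewrite sub0r in E *; rewrite {2}/wexp normrN -mulrDr -E mulr1.
Qed.

Lemma Rint_wexp_sin e b : 0 < e -> \int[mu]_p (wexp e p * sin (b * p)) = 0.
Proof.
move=> e0.
have I : L1 (fun p => wexp e p * sin (b * p)).
  apply: (@L1_bounded_mul _ _ _ 1); first exact: L1_wexp.
    exact: (cont_meas (@cont_sinM _)).
  by move=> x; rewrite ler_norml sin_le1 sin_geN1.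
have := Rint_refl 0 I.
rewrite (_ : (fun x => _) = (fun p => (-1) * (wexp e p * sin (b * p)))); last first.
  by apply/funext => x; rewrite /wexp sub0r normrN mulrN sinN; ring.
by rewrite RintZ//; lra.
Qed.

Lemma cos_le1' (t : R) : `|cos t| <= 1.
Proof. by rewrite ler_norml cos_le1 cos_geN1. Qed.

Lemma sin_le1' (t : R) : `|sin t| <= 1.
Proof. by rewrite ler_norml sin_le1 sin_geN1. Qed.

(** Explicit primitive F on [0, n], with a boundary term of order e^(-e n). *)
Lemma Rint_wexp_half_cos e a : 0 < e ->
  \int[mu]_p (wexp e p * half p * cos (a * p)) = e / (e ^+ 2 + a ^+ 2).
Proof.
move=> e0.
have d0 : e ^+ 2 + a ^+ 2 != 0.
  by rewrite gt_eqF// ltr_pwDl ?exprn_gt0// sqr_ge0.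
pose F p := (e ^+ 2 + a ^+ 2)^-1 *
  (expR (- (e * p)) * (a * sin (a * p) + - (e * cos (a * p)))).
have dF : der F (fun p => expR (- (e * p)) * cos (a * p)).
  have d1 := der_comp der_sin (derZ a der_id).
  have d2 := der_comp der_cos (derZ a der_id).
  apply: der_eq (derZ _ (derM (der_expN e) (derD (derZ a d1) (derN (derZ e d2))))) _.
  by move=> p /=; field.
have cF : continuous (fun p => expR (- (e * p)) * cos (a * p)).
  move=> p; apply: cvgM; [exact: (der_cont (der_expN e))|exact: cont_cosM].
have mh n : measurable_fun [set: R] (fun p => wexp e p * hcut n p * cos (a * p)).
  apply: measurable_funM; last exact: (cont_meas (@cont_cosM _)).
  by apply: measurable_funM; [exact: meas_wexp|exact: measurable_indic_itv].
have [] := @Rint_dct R (fun n p => wexp e p * hcut n p * cos (a * p))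
   (fun p => wexp e p * half p * cos (a * p)) (wexp e) mh.
- apply: measurable_funM; last exact: (cont_meas (@cont_cosM _)).
  by apply: measurable_funM; [exact: meas_wexp|exact: measurable_indic_itv].
- apply: AEW => x; apply: cvgM; last exact: cvg_cst.
  by apply: cvgM; [exact: cvg_cst|exact: half_cvg].
- exact: L1_wexp.
- move=> n x; rewrite !normrM (ger0_norm (ltW (wexp_gt0 _ _))) -mulrA.
  rewrite ler_piMr ?(ltW (wexp_gt0 _ _))//.
  by rewrite mulr_ile1// ?cos_le1'// indic_le1.
move=> _ lim.
suff lim2 : \int[mu]_x (wexp e x * hcut n x * cos (a * x)) @[n --> \oo] -->
    e / (e ^+ 2 + a ^+ 2) by exact: (cvg_unique _ lim lim2).
have FE n : \int[mu]_x (wexp e x * hcut n x * cos (a * x)) = F n%:R - F 0.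
  rewrite -(FTC_R _ dF)//; apply: eq_Rintegral => x _.
  by rewrite hcut_wexp /hcut; ring.
rewrite (_ : (fun n => _) = (fun n => F n%:R - F 0)); last by apply/funext.
have -> : e / (e ^+ 2 + a ^+ 2) = 0 - F 0.
  by rewrite /F !mulr0 oppr0 expR0 sin0 cos0; field.
apply: cvgB; last exact: cvg_cst.
pose B := (e ^+ 2 + a ^+ 2)^-1 * (`|a| + e).
apply/norm_cvg0P.
apply: (@squeeze_cvgr _ _ _ _ (fun=> 0) (fun n => B * expR (- (e * n%:R)))).
- apply: nearW => n; rewrite normr_ge0 /= /F normrM.
  rewrite (ger0_norm (_ : 0 <= (e ^+ 2 + a ^+ 2)^-1)); last first.
    by rewrite invr_ge0 addr_ge0 ?sqr_ge0.
  rewrite -mulrA ler_wpM2l ?invr_ge0 ?addr_ge0 ?sqr_ge0//.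
  rewrite normrM (ger0_norm (expR_ge0 _)) mulrC ler_wpM2r ?expR_ge0//.
  apply: (le_trans (ler_normD _ _)); rewrite normrN !normrM lerD//.
    by rewrite ler_piMr// sin_le1'.
  by rewrite (ger0_norm (ltW e0)) ler_piMr ?(ltW e0)// cos_le1'.
- exact: cvg_cst.
- rewrite [X in _ --> X](_ : 0 = B * 0); last by rewrite mulr0.
  by apply: cvgM; [exact: cvg_cst|exact: cvg_expRNn].
Qed.

Lemma Rint_wexp_cos e a : 0 < e -> \int[mu]_p (wexp e p * cos (a * p)) = poissonk e a.
Proof.
move=> e0.
have I : L1 (fun p => wexp e p * half p * cos (a * p)).
  apply: (@L1_bounded_mul _ _ _ 1 (L1_wexp_half e0)).
    exact: (cont_meas (@cont_cosM _)).
  by move=> x; exact: cos_le1'.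
have I' := L1_refl 0 I.
transitivity (\int[mu]_p (wexp e p * half p * cos (a * p) +
   wexp e (0 - p) * half (0 - p) * cos (a * (0 - p)))).
  apply: Rint_ae.
  - by apply: measurable_funM; [exact: meas_wexp|exact: (cont_meas (@cont_cosM _))].
  - by apply: L1_meas; exact: L1D.
  - move: half_split; apply: AE1 => x E.
    rewrite sub0r in E *; rewrite {3}/wexp normrN mulrN cosN -/(wexp e x).
    by rewrite -mulrDl -mulrDr -E mulr1.
rewrite (RintD I I').
rewrite (Rint_refl 0 I) Rint_wexp_half_cos// /poissonk; ring.
Qed.

(** By [cas_mul] the product of the two kernels is cos (p (x - y)) +
    sin (p (x + y)), and the odd second term integrates to 0. *)
Lemma Rint_wexp_cas e x y : 0 < e ->
  \int[mu]_p (wexp e p * (cas (p * x) * cas (p * y))) = poissonk e (x - y).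
Proof.
move=> e0.
rewrite (_ : (fun p => _) = fun p => wexp e p * cos ((x - y) * p) +
  wexp e p * sin ((x + y) * p)); last first.
  apply/funext => p; rewrite cas_mul mulrDr; congr (_ * cos _ + _ * sin _); ring.
rewrite RintD; first by rewrite Rint_wexp_cos// Rint_wexp_sin// addr0.
- apply: (@L1_bounded_mul _ _ _ 1 (L1_wexp e0)); last by move=> p; exact: cos_le1'.
  exact: (cont_meas (@cont_cosM _)).
- apply: (@L1_bounded_mul _ _ _ 1 (L1_wexp e0)); last by move=> p; exact: sin_le1'.
  exact: (cont_meas (@cont_sinM _)).
Qed.

Lemma poissonk_ge0 e t : 0 < e -> 0 <= poissonk e t.
Proof.
by move=> e0; rewrite divr_ge0 ?mulr_ge0 ?(ltW e0)// addr_ge0 ?sqr_ge0.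
Qed.

Lemma der_poissonk e : 0 < e -> der (fun t => 2 * atan (e^-1 * t)) (poissonk e).
Proof.
move=> e0.
have da : der atan (fun x : R => (1 + x ^+ 2)^-1) by move=> x; exact: is_derive1_atan.
apply: der_eq (derZ 2 (der_comp da (derZ e^-1 der_id))) _ => t /=.
have d0 : e ^+ 2 + t ^+ 2 != 0.
  by rewrite gt_eqF// ltr_pwDl ?exprn_gt0// sqr_ge0.
rewrite /poissonk; field.
by rewrite d0 gt_eqF.
Qed.

Lemma cont_poissonk e : 0 < e -> continuous (poissonk e).
Proof.
move=> e0 t; apply: cvgM; first exact: cvg_cst.
apply: cvgV.
  by rewrite gt_eqF// ltr_pwDl ?exprn_gt0// sqr_ge0.
apply: cvgD; first exact: cvg_cst.
by rewrite expr2; under eq_fun do rewrite expr2; apply: cvgM; exact: cvg_id.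
Qed.

Lemma poissonk_le e t : 0 < e -> `|poissonk e t| <= 2 * e^-1.
Proof.
move=> e0; rewrite ger0_norm ?poissonk_ge0// /poissonk.
rewrite ler_pdivrMr; last by rewrite ltr_pwDl ?exprn_gt0// sqr_ge0.
rewrite -mulrA ler_pM2l// mulrDr expr2 mulKf ?gt_eqF// lerDl.
by rewrite mulr_ge0 ?sqr_ge0// invr_ge0 ltW.
Qed.

Lemma atan_lt2 (t : R) : `|atan t| <= pi / 2.
Proof. by rewrite ler_norml (ltW (atan_gtNpi2 _)) (ltW (atan_ltpi2 _)). Qed.

(** The primitive 2 atan (t / e) increases by at most 2 pi over any interval. *)
Lemma poissonk_mass e : 0 < e -> L1 (poissonk e) /\ \int[mu]_t poissonk e t <= 2 * pi.
Proof.
move=> e0; apply: (@Rint_fatou R (fun n t => poissonk e t * \1_(`[- n%:R, n%:R]%classic) t)).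
- move=> n; rewrite [X in L1 X](_ : _ = fun t => \1_(`[- n%:R, n%:R]%classic) t * poissonk e t); last first.
    by apply/funext => t; rewrite mulrC.
  apply: (@L1_bounded_mul _ _ _ (2 * e^-1) (L1_indic (mu_cc _ _))).
    exact: (cont_meas (cont_poissonk _)).
  by move=> t; exact: poissonk_le.
- exact: (cont_meas (cont_poissonk _)).
- by move=> n t; apply: mulr_ge0; [exact: poissonk_ge0|rewrite indicE ler0n].
- move=> t; have := @trunc_cvg_pt R (poissonk e) t; exact.
- move=> n; rewrite (FTC_R _ (der_poissonk e0)); last first.
  + exact: cont_poissonk.
  + by rewrite ge0_cp// ?ler0n.
  rewrite mulrN atanN mulrN opprK -mulrDr -mulr2n ler_pM2l//.
  have := atan_lt2 (e^-1 * n%:R); rewrite ler_norml => /andP[_ H].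
  by rewrite mulr2n; lra.
Qed.

End exponential_weight.

(** * The Hartley transform of integrable functions *)

Section hartley.
Context {R : realType}.
Local Notation mu := (@lebesgue_measure R).
Implicit Types f g h : R -> R.

(** The normalization under which the Hartley transform is unitary. *)
Definition c0 : R := (Num.sqrt (2 * pi))^-1.

Lemma twopi_gt0 : 0 < 2 * pi :> R. Proof. by rewrite mulr_gt0// pi_gt0. Qed.
Lemma c0_gt0 : 0 < c0. Proof. by rewrite invr_gt0 sqrtr_gt0 twopi_gt0. Qed.
Lemma c0_sqr : c0 ^+ 2 * (2 * pi) = 1.
Proof. by rewrite /c0 exprVn sqr_sqrtr ?(ltW twopi_gt0)// mulVf// gt_eqF ?twopi_gt0. Qed.

Definition Hart f (p : R) : R := c0 * \int[mu]_x (f x * cas (p * x)).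

Lemma cont_casM (a : R) : continuous (fun x => cas (a * x)).
Proof. by move=> x; apply: cvgD; [exact: cont_cosM|exact: cont_sinM]. Qed.

Lemma meas_casM (a : R) : measurable_fun [set: R] (fun x => cas (a * x)).
Proof. exact: cont_meas (@cont_casM a). Qed.

Lemma meas_cas2 : measurable_fun [set: R * R] (fun z : R * R => cas (z.1 * z.2)).
Proof.
apply: (@measurableT_comp _ _ _ _ _ _ (cas : R -> R)).
  exact: cont_meas cont_cas.
by apply: measurable_funM.
Qed.

Lemma meas_fst f : measurable_fun [set: R] f ->
  measurable_fun [set: R * R] (fun z : R * R => f z.1).
Proof. by move=> mf; apply: (@measurableT_comp _ _ _ _ _ _ f). Qed.

Lemma meas_snd f : measurable_fun [set: R] f ->
  measurable_fun [set: R * R] (fun z : R * R => f z.2).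
Proof. by move=> mf; apply: (@measurableT_comp _ _ _ _ _ _ f). Qed.

Lemma L1_cas f (a : R) : L1 f -> L1 (fun x => f x * cas (a * x)).
Proof.
move=> If; apply: (@L1_bounded_mul _ f (fun x => cas (a * x)) 2 If).
  exact: meas_casM.
by move=> x; exact: cas_le2.
Qed.

Lemma meas_Hart f : measurable_fun [set: R] f -> measurable_fun [set: R] (Hart f).
Proof.
move=> mf; apply: measurable_funM => //.
apply: (@meas_Rint_param R (fun z => f z.2 * cas (z.1 * z.2))).
by apply: measurable_funM; [exact: meas_snd|exact: meas_cas2].
Qed.

Lemma Hart_bound f p : L1 f -> `|Hart f p| <= c0 * (2 * \int[mu]_x `|f x|).
Proof.
move=> If; rewrite normrM (ger0_norm (ltW c0_gt0)) ler_wpM2l ?(ltW c0_gt0)//.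
apply: (le_trans (Rint_norm_le (L1_cas p If))).
rewrite -RintZ; last exact: L1_norm.
apply: Rint_le; first exact/L1_norm/L1_cas.
  exact/L1Z/L1_norm.
by move=> x; rewrite normrM mulrC ler_wpM2r// cas_le2.
Qed.

Lemma Rint_Fubini_mul f g (k : R * R -> R) (M : R) : L1 f -> L1 g ->
  measurable_fun [set: R * R] k -> (forall z, `|k z| <= M) ->
  \int[mu]_x (f x * \int[mu]_y (g y * k (x, y))) =
  \int[mu]_y (g y * \int[mu]_x (f x * k (x, y))).
Proof.
move=> If Ig mk kM.
have mk1 x : measurable_fun [set: R] (fun y => k (x, y)).
  exact: (@measurableT_comp _ _ _ _ _ _ k _ (fun y => (x, y)) mk (measurable_pair1 x)).
have mk2 y : measurable_fun [set: R] (fun x => k (x, y)).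
  exact: (@measurableT_comp _ _ _ _ _ _ k _ (fun x => (x, y)) mk (measurable_pair2 y)).
have Igk x : L1 (fun y => g y * k (x, y)).
  by apply: (L1_bounded_mul Ig (mk1 x)) => y; exact: kM.
have Ifk y : L1 (fun x => f x * k (x, y)).
  by apply: (L1_bounded_mul If (mk2 y)) => x; exact: kM.
have mfgk : measurable_fun [set: R * R] (fun z => f z.1 * g z.2 * k z).
  apply: measurable_funM => //; apply: measurable_funM.
    exact: meas_fst (L1_meas If).
  exact: meas_snd (L1_meas Ig).
have [] := @Rint_Fubini R (fun z => f z.1 * g z.2 * k z) mfgk.
  apply: (@le_lt_trans _ _ (\int[mu]_x (`|f x| * (M * \int[mu]_y `|g y|))%:E)%E).
    apply: ge0_le_integral => //.
    - move=> x _; apply: integral_ge0 => y _.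
      by rewrite lee_fin.
    - apply: (@measurable_fun_fubini_tonelli_F _ _ (measurableTypeR R) (measurableTypeR R) R mu (fun z => (`|f z.1 * g z.2 * k z|)%:E)) => //.
      by apply/measurable_EFinP; apply: measurableT_comp.
    - apply/measurable_EFinP; apply: measurable_funM => //.
      exact: L1_meas (L1_norm If).
    - move=> x _.
      rewrite -EFin_Rint; last first.
        apply: L1_norm; rewrite (_ : (fun x0 => _) = fun y => f x * (g y * k (x, y))).
          exact: L1Z.
        by apply/funext => y; rewrite mulrA.
      rewrite lee_fin (_ : (fun y => _) = fun y => `|f x| * `|g y * k (x, y)|); last first.
        by apply/funext => y; rewrite -mulrA normrM.
      rewrite RintZ; last exact: L1_norm.
      rewrite ler_wpM2l// -RintZ; last exact: L1_norm.
      apply: Rint_le; [exact: L1_norm|exact/L1Z/L1_norm|] => y.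
      by rewrite normrM mulrC ler_wpM2r.
  rewrite -EFin_Rint ?ltry//.
  rewrite (_ : (fun x => _) = fun x => (M * \int[mu]_y `|g y|) * `|f x|).
    exact/L1Z/L1_norm.
  by apply/funext => x; rewrite mulrC.
move=> _ _ _ _ E.
transitivity (\int[mu]_x \int[mu]_y (f x * g y * k (x, y))).
  apply: eq_Rintegral => x _; rewrite -RintZ//.
  by apply: eq_Rintegral => y _; rewrite mulrA.
rewrite E; apply: eq_Rintegral => y _; rewrite -RintZ//.
by apply: eq_Rintegral => x _; ring.
Qed.

Lemma Hart_sym f g : L1 f -> L1 g ->
  \int[mu]_p (Hart f p * g p) = \int[mu]_x (f x * Hart g x).
Proof.
move=> If Ig.
have E := @Rint_Fubini_mul g f (fun z => cas (z.1 * z.2)) 2 Ig If meas_cas2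
  (fun z => cas_le2 _).
transitivity (c0 * \int[mu]_x (g x * \int[mu]_y (f y * cas (x * y)))).
  rewrite -RintZ.
    by apply: eq_Rintegral => p _; rewrite /Hart; ring.
  apply: (L1_bounded_mul Ig (M := 2 * \int[mu]_x `|f x|)).
    apply: (@meas_Rint_param R (fun z => f z.2 * cas (z.1 * z.2))).
    by apply: measurable_funM; [exact: meas_snd (L1_meas If)|exact: meas_cas2].
  move=> p; have := Hart_bound p If.
  by rewrite /Hart normrM (ger0_norm (ltW c0_gt0)) ler_pM2l// c0_gt0.
rewrite E -RintZ.
  apply: eq_Rintegral => x _; rewrite /Hart; rewrite mulrCA; congr (_ * (_ * _)).
  by apply: eq_Rintegral => p _; rewrite [x * p]mulrC.
apply: (L1_bounded_mul If (M := 2 * \int[mu]_x `|g x|)).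
  apply: (@meas_Rint_param R (fun z => g z.2 * cas (z.2 * z.1))).
  apply: measurable_funM; first exact: meas_snd (L1_meas Ig).
  have := meas_swap meas_cas2; exact.
move=> x; have := Hart_bound x Ig.
rewrite /Hart normrM (ger0_norm (ltW c0_gt0)) ler_pM2l ?c0_gt0//.
rewrite (_ : (fun x0 => g x0 * cas (x * x0)) = (fun x0 => g x0 * cas (x0 * x)))//.
by apply/funext => p; rewrite [x * p]mulrC.
Qed.

Lemma L1_Hart_wexp e f : 0 < e -> L1 f -> L1 (fun p => wexp e p * Hart f p).
Proof.
move=> e0 If; apply: (L1_bounded_mul (L1_wexp e0) (meas_Hart (L1_meas If))).
by move=> p; exact: Hart_bound.
Qed.

(** By symmetry of the transform, the weighted energy is the pairing of f
    with the transform of e^(-e|p|) Hart f, and, by symmetry once more, the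
    latter is f integrated against the transform of a weighted [cas]. *)
Lemma Hart_wexp_energy e f : 0 < e -> L1 f ->
  \int[mu]_p (wexp e p * Hart f p ^+ 2) =
  c0 ^+ 2 * \int[mu]_x (f x * \int[mu]_y (f y * poissonk e (x - y))).
Proof.
move=> e0 If.
transitivity (\int[mu]_p (Hart f p * (wexp e p * Hart f p))).
  by apply: eq_Rintegral => p _; ring.
rewrite Hart_sym//; last exact: L1_Hart_wexp.
have Iwc x : L1 (fun p => wexp e p * cas (p * x)).
  rewrite (_ : (fun p => _) = (fun p => wexp e p * cas (x * p))).
    exact: L1_cas (L1_wexp e0).
  by apply/funext => p; rewrite mulrC [p * x]mulrC [RHS]mulrC.
have HE x : Hart (fun p => wexp e p * Hart f p) x =
    c0 ^+ 2 * \int[mu]_y (f y * poissonk e (x - y)).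
  rewrite /Hart -/(Hart f _).
  transitivity (c0 * \int[mu]_p (Hart f p * (wexp e p * cas (p * x)))).
    congr (_ * _); apply: eq_Rintegral => p _; rewrite [x * p]mulrC -/(Hart f p); ring.
  rewrite Hart_sym// expr2 -mulrA; congr (_ * _).
  rewrite -RintZ.
    apply: eq_Rintegral => y _; rewrite /Hart mulrCA; congr (_ * (_ * _)).
    rewrite -Rint_wexp_cas//; apply: eq_Rintegral => p _.
    by rewrite [y * p]mulrC mulrA.
  apply: (@L1_bounded_mul _ f (fun y => poissonk e (x - y)) (2 * e^-1) If).
    exact: (meas_refl x (cont_meas (cont_poissonk e0))).
  by move=> y; exact: poissonk_le.
under eq_Rintegral do rewrite HE.
rewrite -RintZ.
  by apply: eq_Rintegral => x _; ring.
apply: (@L1_bounded_mul _ f _ (2 * e^-1 * \int[mu]_y `|f y|) If).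
  apply: (@meas_Rint_param R (fun z => f z.2 * poissonk e (z.1 - z.2))).
  apply: measurable_funM; first exact: meas_snd (L1_meas If).
  apply: (@measurableT_comp _ _ _ _ _ _ (poissonk e)).
    exact: cont_meas (cont_poissonk e0).
  by apply: measurable_funB.
move=> x.
have I1 : L1 (fun y => f y * poissonk e (x - y)).
  apply: (@L1_bounded_mul _ f (fun y => poissonk e (x - y)) (2 * e^-1) If).
    exact: (meas_refl x (cont_meas (cont_poissonk e0))).
  by move=> y; exact: poissonk_le.
apply: (le_trans (Rint_norm_le I1)); rewrite -RintZ; last exact: L1_norm.
apply: Rint_le; [exact: L1_norm|exact/L1Z/L1_norm|] => y.
by rewrite normrM mulrC ler_wpM2r// poissonk_le.
Qed.

End hartley.

(** * Energy of the Hartley transform *)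

Section hartley_energy.
Context {R : realType}.
Local Notation mu := (@lebesgue_measure R).
Implicit Types f g h : R -> R.

Lemma itv1_ge0 (c d x : R) : 0 <= itv1 c d x.
Proof. by rewrite /itv1 indicE ler0n. Qed.

Lemma poissonk_sym (e t : R) : poissonk e (- t) = poissonk e t.
Proof. by rewrite /poissonk sqrrN. Qed.

(** Schur's test: f(x) f(y) <= (f(x)^2 + f(y)^2) / 2 reduces the quadratic
    form to the mass of the kernel. *)
Lemma poissonk_form_le e f : 0 < e -> L1 f -> L2 f ->
  \int[mu]_x (f x * \int[mu]_y (f y * poissonk e (x - y))) <= 2 * pi * n2 f.
Proof.
move=> e0 If Lf.
have [Ik _] := poissonk_mass e0.
have mk1 x : measurable_fun [set: R] (fun y => poissonk e (x - y)).
  exact: (meas_refl x (cont_meas (cont_poissonk e0))).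
have kb g x : L1 g -> L1 (fun y => g y * poissonk e (x - y)).
  move=> Ig; apply: (@L1_bounded_mul _ g (fun y => poissonk e (x - y)) (2 * e^-1) Ig) => //.
  by move=> y; exact: poissonk_le.
have I2 := L2_sq Lf.
have mk : measurable_fun [set: R * R] (fun z : R * R => poissonk e (z.1 - z.2)).
  apply: (@measurableT_comp _ _ _ _ _ _ (poissonk e)).
    exact: cont_meas (cont_poissonk e0).
  by apply: measurable_funB.
set K := \int[mu]_t poissonk e t.
have KE x : \int[mu]_y poissonk e (x - y) = K by exact: Rint_refl.
have KE' y : \int[mu]_x poissonk e (x - y) = K.
  rewrite -(KE y); apply: eq_Rintegral => x _.
  by rewrite -poissonk_sym opprB.
have mf2k : measurable_fun [set: R * R] (fun z => f z.2 ^+ 2 * poissonk e (z.1 - z.2)).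
  apply: measurable_funM => //; exact: (meas_snd (L1_meas I2)).
have [IF E2] : L1 (fun x => \int[mu]_y (f y ^+ 2 * poissonk e (x - y))) /\
    \int[mu]_x \int[mu]_y (f y ^+ 2 * poissonk e (x - y)) = K * n2 f.
  have [] := @Rint_Fubini R (fun z => f z.2 ^+ 2 * poissonk e (z.1 - z.2)) mf2k.
  rewrite (@fubini_tonelli _ _ (measurableTypeR R) (measurableTypeR R) R mu mu
    (fun z => `|f z.2 ^+ 2 * poissonk e (z.1 - z.2)|%:E)) => //.
    rewrite (eint_eq (g := fun y => (f y ^+ 2 * K)%:E)).
      rewrite -EFin_Rint ?ltry//.
      rewrite (_ : (fun y => _) = fun y => K * f y ^+ 2); first exact: L1Z.
      by apply/funext => y; rewrite mulrC.
    move=> y /=; rewrite (eint_eq (g := fun x => (f y ^+ 2 * poissonk e (y - x))%:E)).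
      rewrite -EFin_Rint; last by apply: L1Z; exact: L1_refl.
      by rewrite RintZ ?KE//; exact: L1_refl.
    move=> x; rewrite ger0_norm.
      by rewrite -poissonk_sym opprB.
    by rewrite mulr_ge0 ?sqr_ge0// poissonk_ge0.
  by apply/measurable_EFinP; apply: measurableT_comp.
move=> _ _ IF _ EF; split; first exact: IF.
  rewrite EF /n2; clear EF IF; rewrite -RintZ//; apply: eq_Rintegral => y _.
  rewrite /= RintZ ?KE' 1?mulrC//.
  rewrite (_ : (fun x => _) = (fun x => poissonk e (y - x))); first exact: L1_refl.
  by apply/funext => x; rewrite -poissonk_sym opprB.
have I1 : L1 (fun x => f x * \int[mu]_y (f y * poissonk e (x - y))).
  apply: (@L1_bounded_mul _ f _ (2 * e^-1 * \int[mu]_y `|f y|) If).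
    apply: (@meas_Rint_param R (fun z => f z.2 * poissonk e (z.1 - z.2))).
    apply: measurable_funM => //; exact: meas_snd (L1_meas If).
  move=> x; apply: (le_trans (Rint_norm_le (kb f x If))); rewrite -RintZ; last exact: L1_norm.
  apply: Rint_le; [exact: L1_norm (kb _ _ If)|exact/L1Z/L1_norm|] => y.
  by rewrite normrM mulrC ler_wpM2r// poissonk_le.
apply: (@le_trans _ _ (K * n2 f)); last first.
  by apply: ler_wpM2r; [exact: n2_ge0|exact: (poissonk_mass e0).2].
rewrite (_ : K * n2 f = \int[mu]_x (2^-1 * K * f x ^+ 2 +
   2^-1 * \int[mu]_y (f y ^+ 2 * poissonk e (x - y)))); last first.
  rewrite RintD; [|exact: L1Z|exact: L1Z].
  by rewrite RintZ// RintZ// E2 /n2; field.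
apply: Rint_le => //; first by apply: L1D; exact: L1Z.
move=> x.
have I3 : L1 (fun y => f x ^+ 2 * poissonk e (x - y)) by apply: L1Z; exact: L1_refl.
have I4 : L1 (fun y => 2 * f x * (f y * poissonk e (x - y))) by apply: L1Z; exact: kb.
have : 0 <= \int[mu]_y ((f x ^+ 2 * poissonk e (x - y) -
    2 * f x * (f y * poissonk e (x - y))) + f y ^+ 2 * poissonk e (x - y)).
  apply: Rintegral_ge0 => y _.
  rewrite (_ : _ + _ = (f x - f y) ^+ 2 * poissonk e (x - y)); last by ring.
  by rewrite mulr_ge0 ?sqr_ge0// poissonk_ge0.
rewrite RintD; [|exact: L1B|exact: kb].
rewrite RintB// RintZ; last exact: L1_refl.
by rewrite RintZ ?KE; [lra|exact: kb].
Qed.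

(** The weighted energies are at most n2 f, by [Hart_wexp_energy] and
    [poissonk_form_le]; Fatou's lemma removes the weight. *)
Lemma Hart_contr f : L1 f -> L2 f -> L2 (Hart f) /\ n2 (Hart f) <= n2 f.
Proof.
move=> If Lf; have mH := meas_Hart (L1_meas If).
pose e n : R := n.+1%:R^-1.
have e0 n : 0 < e n by rewrite invr_gt0.
have mH2 : measurable_fun [set: R] (fun p => Hart f p ^+ 2) by exact: measurable_funX.
have [] := @Rint_fatou R (fun n p => wexp (e n) p * Hart f p ^+ 2)
   (fun p => Hart f p ^+ 2) (n2 f).
- move=> n; apply: (L1_bounded_mul (L1_wexp (e0 n)) mH2
    (M := (c0 * (2 * \int[mu]_x `|f x|)) ^+ 2)) => p.
  rewrite normrX ler_sqr ?nnegrE//; first exact: Hart_bound.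
  exact: le_trans (Hart_bound p If).
- exact: mH2.
- by move=> n p; apply: mulr_ge0; [exact: ltW (wexp_gt0 _ _)|exact: sqr_ge0].
- move=> p; rewrite -[X in _ --> X]mul1r; apply: cvgM; last exact: cvg_cst.
  rewrite /wexp -expR0.
  have : continuous_at (0 : R) expR by exact: continuous_expR.
  move=> ce; apply: (continuous_cvg _ ce).
  rewrite -oppr0; apply: cvgN; rewrite -(mul0r `|p|).
  apply: cvgM; last exact: cvg_cst.
  exact: cvg_harmonic.
- move=> n; rewrite Hart_wexp_energy//.
  apply: (@le_trans _ _ (c0 ^+ 2 * (2 * pi * n2 f))).
    by rewrite ler_wpM2l ?sqr_ge0// poissonk_form_le.
  by rewrite mulrA c0_sqr mul1r.
by move=> H1 H2; split.
Qed.

Lemma cvg_atan_big (s : R) : 0 < s -> atan (n.+1%:R * s) @[n --> \oo] --> (pi / 2 : R).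
Proof.
move=> s0.
apply: (@cvg_comp _ _ _ (fun n => n.+1%:R * s) _ _ (pinfty_nbhs R)); last exact: cvgy_atan.
apply/cvgryPge => A; near=> n.
rewrite -ler_pdivrMr// (le_trans (ler_norm _))//.
have h : `|A / s| <= n%:R by near: n; exact: nbhs_infty_ger.
by rewrite (le_trans h)// ler_nat.
Unshelve. all: by end_near. Qed.

(** For an interval, the Poisson integral [A n] of the indicator is a difference of
    arctangents that tends to 2 pi inside the interval, so the weighted
    energies tend to d - c; they are bounded by the full energy. *)
Lemma Hart_itv1 (c d : R) : c < d -> n2 (Hart (itv1 c d)) = d - c.
Proof.
move=> cd; have IJ := @L1_itv1 R c d; have LJ := @L2_itv1 R c d.
have [LH le] := Hart_contr IJ LJ.
apply/eqP; rewrite eq_le -[X in _ <= X]n2_itv1// le /=.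
pose e n : R := n.+1%:R^-1.
have e0 n : 0 < e n by rewrite invr_gt0.
pose A n x := \int[mu]_y (itv1 c d y * poissonk (e n) (x - y)).
have AE n x : A n x = 2 * atan (n.+1%:R * (d - x)) - 2 * atan (n.+1%:R * (c - x)).
  have dk : der (fun y => 2 * atan ((e n)^-1 * (y - x))) (fun y => poissonk (e n) (x - y)).
    have db := derD (@der_id R) (der_cst (- x)).
    apply: der_eq (der_comp (der_poissonk (e0 n)) db) _ => y /=.
    by rewrite addr0 mulr1 -poissonk_sym opprB.
  rewrite -[n.+1%:R]invrK -/(e n).
  rewrite -(FTC_itv1 (ltW cd) dk); last first.
    move=> y; apply: (@continuous_comp _ _ _ (fun y => x - y) (poissonk (e n))).
      by apply: cvgB; [exact: cvg_cst|exact: cvg_id].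
    exact: cont_poissonk.
  by apply: eq_Rintegral => y _; rewrite mulrC.
have lim : \int[mu]_x (itv1 c d x * A n x) @[n --> \oo] -->
    \int[mu]_x (2 * pi * itv1 c d x).
  have mA n : measurable_fun [set: R] (A n).
    apply: (@meas_Rint_param R (fun z => itv1 c d z.2 * poissonk (e n) (z.1 - z.2))).
    apply: measurable_funM; first exact: meas_snd (L1_meas IJ).
    apply: (@measurableT_comp _ _ _ _ _ _ (poissonk (e n))).
      exact: cont_meas (cont_poissonk (e0 n)).
    by apply: measurable_funB.
  have mJ := L1_meas IJ.
  have [] // := @Rint_dct R (fun n x => itv1 c d x * A n x)
    (fun x => 2 * pi * itv1 c d x) (fun x => 2 * pi * itv1 c d x).
  - by move=> n; apply: measurable_funM.
  - by apply: measurable_funM.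
  - apply: AEW => x; rewrite /itv1 indicE mem_setE in_itv/=.
    have [/andP[cx xd]|_] := boolP (c < x < d); last first.
      rewrite !mulr0n mulr0; apply: cvg_near_cst; apply: nearW => n.
      by rewrite mul0r.
    rewrite !mulr1n mulr1; under eq_fun do rewrite mul1r AE.
    rewrite (_ : 2 * pi = 2 * (pi / 2) - 2 * (- (pi / 2)) :> R); last by field.
    apply: cvgB; (apply: cvgM; first exact: cvg_cst).
      by apply: cvg_atan_big; lra.
    rewrite (_ : (fun n => _) = (fun n => - atan (n.+1%:R * (x - c)))); last first.
      by apply/funext => n; rewrite -atanN -mulrN opprB.
    by apply: cvgN; apply: cvg_atan_big; lra.
  - exact: L1Z.
  - move=> n x; rewrite normrM mulrC.
    rewrite (_ : `|itv1 c d x| = itv1 c d x); last exact: ger0_norm (itv1_ge0 _ _ _).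
    apply: ler_wpM2r; first exact: itv1_ge0.
    rewrite AE -mulrBr normrM ger0_norm// ler_pM2l//.
    apply: (le_trans (ler_normB _ _)).
    rewrite (_ : pi = pi / 2 + pi / 2 :> R); last by field.
    by apply: lerD; exact: atan_lt2.
have lim2 : c0 ^+ 2 * \int[mu]_x (itv1 c d x * A n x) @[n --> \oo] --> (d - c : R).
  rewrite (_ : d - c = c0 ^+ 2 * \int[mu]_x (2 * pi * itv1 c d x)); last first.
    by rewrite RintZ// Rint_itv1// mulrA c0_sqr mul1r.
  by apply: cvgM; [exact: cvg_cst|exact: lim].
rewrite -(cvg_lim _ lim2)//; apply: limr_le; first by apply/cvg_ex; exists (d - c).
apply: nearW => n; rewrite -Hart_wexp_energy//; apply: Rint_le.
- apply: (L1_le _ (L2_sq LH)).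
    apply: measurable_funM; first exact: meas_wexp.
    by apply: measurable_funX; exact: L2_meas LH.
  move=> p; rewrite normrM (ger0_norm (ltW (wexp_gt0 _ _))) ger0_norm ?sqr_ge0//.
  by rewrite ler_piMl ?sqr_ge0// /wexp -expR0 ler_expR oppr_le0 mulr_ge0// ltW.
- exact: L2_sq.
- move=> p; rewrite ler_piMl ?sqr_ge0// /wexp -expR0 ler_expR oppr_le0 mulr_ge0//.
  exact: ltW.
Qed.

End hartley_energy.

(** * The Hartley transform on L2 *)

Section L2limits.
Context {R : realType}.
Local Notation mu := (@lebesgue_measure R).
Implicit Types f g h : R -> R.
Implicit Types fn gn : nat -> R -> R.

Definition lim2 fn f := n2 (fun x => fn n x - f x) @[n --> \oo] --> (0 : R).

Lemma lim2_le fn f (a : nat -> R) (C : R) : a n @[n --> \oo] --> (0 : R) ->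
  (forall n, n2 (fun x => fn n x - f x) <= C * a n) -> lim2 fn f.
Proof.
move=> a0 fa; apply: (@squeeze_cvgr _ _ _ _ (fun=> 0) (fun n => C * a n)).
- by apply: nearW => n; rewrite n2_ge0 fa.
- exact: cvg_cst.
- by rewrite -(mulr0 C); apply: cvgM; [exact: cvg_cst|].
Qed.

Lemma lim2_le2 fn f (a b : nat -> R) : a n @[n --> \oo] --> (0 : R) ->
  b n @[n --> \oo] --> (0 : R) ->
  (forall n, n2 (fun x => fn n x - f x) <= 2 * a n + 2 * b n) -> lim2 fn f.
Proof.
move=> a0 b0 fab; apply: (@lim2_le fn f (fun n => a n + b n) 2).
  by rewrite -[X in _ --> X](addr0 0); apply: cvgD.
by move=> n; rewrite mulrDr.
Qed.

Lemma lim2_cst f : lim2 (fun=> f) f.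
Proof.
rewrite /lim2 (_ : n2 _ = 0); first exact: cvg_cst.
rewrite (_ : (fun x => _) = fun=> 0); last by apply/funext => x; rewrite subrr.
exact: n2_0.
Qed.

Lemma lim2_unique fn f g : (forall n, L2 (fn n)) -> L2 f -> L2 g ->
  lim2 fn f -> lim2 fn g -> aeq f g.
Proof.
move=> Lf_ Lf Lg ff fg; apply: n2_le0_aeq => // e e0.
have : (2 * n2 (fun x => fn n x - f x) + 2 * n2 (fun x => fn n x - g x))
    @[n --> \oo] --> (0 : R).
  rewrite (_ : 0 = 2 * 0 + 2 * 0 :> R); last by rewrite mulr0 addr0.
  by apply: cvgD; (apply: cvgM; [exact: cvg_cst|]).
move=> H; apply/ler_addgt0Pr => d d0; rewrite -lerBlDr.
have h0 : n2 (fun x => f x - g x) <= 0.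
  apply: (cvgr_to_ge H); apply: nearW => n.
  by rewrite (n2_sym (fn n) f); exact: n2_tri.
by lra.
Qed.

Lemma lim2D fn f gn g : (forall n, L2 (fn n)) -> L2 f -> (forall n, L2 (gn n)) ->
  L2 g -> lim2 fn f -> lim2 gn g ->
  lim2 (fun n x => fn n x + gn n x) (fun x => f x + g x).
Proof.
move=> Lf_ Lf Lg_ Lg ff gg; apply: (lim2_le2 ff gg) => n.
rewrite (_ : (fun x => _) = fun x => (fn n x - f x) + (gn n x - g x)).
  by apply: n2D_le; exact: L2B.
by apply/funext => x; ring.
Qed.

Lemma lim2Z (k : R) fn f : (forall n, L2 (fn n)) -> L2 f -> lim2 fn f ->
  lim2 (fun n x => k * fn n x) (fun x => k * f x).
Proof.
move=> Lf_ Lf ff; apply: (lim2_le (C := k ^+ 2) ff) => n.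
rewrite -n2Z; last exact: L2B.
by rewrite (_ : (fun x => _) = fun x => k * (fn n x - f x))//; apply/funext => x; ring.
Qed.

Lemma lim2B fn f gn g : (forall n, L2 (fn n)) -> L2 f -> (forall n, L2 (gn n)) ->
  L2 g -> lim2 fn f -> lim2 gn g ->
  lim2 (fun n x => fn n x - gn n x) (fun x => f x - g x).
Proof.
move=> Lf_ Lf Lg_ Lg ff gg; apply: (lim2_le2 ff gg) => n.
rewrite (_ : (fun x => _) = fun x => (fn n x - f x) + (-1) * (gn n x - g x)); last first.
  by apply/funext => x; ring.
apply: (le_trans (n2D_le _ _)); [exact: L2B|apply: L2Z; exact: L2B|].
by rewrite n2Z; [rewrite sqrrN expr1n mul1r|exact: L2B].
Qed.

Lemma cvg_sqr0 (u : nat -> R) : (u n) ^+ 2 @[n --> \oo] --> (0 : R) ->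
  u n @[n --> \oo] --> (0 : R).
Proof.
move=> H; apply/cvgr0Pnorm_lt => e e0.
have e2 : 0 < e ^+ 2 by rewrite exprn_gt0.
move/cvgr0Pnorm_lt: H => /(_ _ e2) [N _ NP].
exists N => // n /= /NP /=.
by rewrite normrX ltr_sqr ?nnegrE// ltW.
Qed.

(** Cauchy-Schwarz bounds the square of the difference by
    n2 g * n2 (fn n - f). *)
Lemma lim2_ip fn f g : (forall n, L2 (fn n)) -> L2 f -> L2 g -> lim2 fn f ->
  ip (fn n) g @[n --> \oo] --> ip f g.
Proof.
move=> Lf_ Lf Lg ff.
have : ip (fn n) g - ip f g @[n --> \oo] --> (0 : R).
  apply: cvg_sqr0.
  apply: (@squeeze_cvgr _ _ _ _ (fun=> 0) (fun n => n2 g * n2 (fun x => fn n x - f x))).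
  - apply: nearW => n; rewrite sqr_ge0 -ipBl// mulrC.
    by apply: cauchy_schwarz => //; exact: L2B.
  - exact: cvg_cst.
  - by rewrite -(mulr0 (n2 g)); apply: cvgM; [exact: cvg_cst|].
move=> H; rewrite -[X in _ --> X](add0r (ip f g)).
rewrite (_ : (fun n => _) = fun n => (ip (fn n) g - ip f g) + ip f g).
  by apply: cvgD; [|exact: cvg_cst].
by apply/funext => n; rewrite subrK.
Qed.

Lemma lim2_n2 fn f : (forall n, L2 (fn n)) -> L2 f -> lim2 fn f ->
  n2 (fn n) @[n --> \oo] --> n2 f.
Proof.
move=> Lf_ Lf ff; have H := lim2_ip Lf_ Lf Lf ff.
have L : n2 (fun x => fn n x - f x) + 2 * ip (fn n) f - n2 f @[n --> \oo] -->
    0 + 2 * ip f f - n2 f.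
  apply: cvgB; last exact: cvg_cst.
  by apply: cvgD => //; apply: cvgM; first exact: cvg_cst.
have E : 0 + 2 * ip f f - n2 f = n2 f.
  rewrite (_ : ip f f = n2 f); first by lra.
  by apply: eq_Rintegral => x _; rewrite expr2.
rewrite E in L; apply: cvg_trans L; apply: near_eq_cvg; apply: nearW => n.
by rewrite n2B//; lra.
Qed.

Lemma HartB f g : L1 f -> L1 g ->
  Hart (fun x => f x - g x) = fun p => Hart f p - Hart g p.
Proof.
move=> If Ig; apply/funext => p; rewrite /Hart -mulrBr -RintB; [|exact: L1_cas|exact: L1_cas].
by congr (_ * _); apply: eq_Rintegral => x _; rewrite mulrBl.
Qed.

Lemma HartZ (k : R) f : L1 f -> Hart (fun x => k * f x) = fun p => k * Hart f p.
Proof.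
move=> If; apply/funext => p; rewrite /Hart mulrCA -(RintZ k (L1_cas p If)).
by congr (_ * _); apply: eq_Rintegral => x _; rewrite mulrA.
Qed.

Definition L12 f := L1 f /\ L2 f.

Lemma L12B f g : L12 f -> L12 g -> L12 (fun x => f x - g x).
Proof. by move=> [If Lf] [Ig Lg]; split; [exact: L1B If Ig|exact: L2B Lf Lg]. Qed.

Lemma L12_trunc n f : L2 f -> L12 (trunc n f).
Proof. by move=> Lf; split; [exact: L1_trunc|exact: L2_trunc]. Qed.

Lemma L12_itv1 (c d : R) : L12 (itv1 c d).
Proof. by split; [exact: L1_itv1|exact: L2_itv1]. Qed.

Lemma L2_Hart f : L12 f -> L2 (Hart f).
Proof. by move=> [If Lf]; exact: (Hart_contr If Lf).1. Qed.

Lemma n2_HartB f g : L12 f -> L12 g ->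
  n2 (fun p => Hart f p - Hart g p) <= n2 (fun x => f x - g x).
Proof.
move=> Hf Hg; have [If Lf] := Hf; have [Ig Lg] := Hg; rewrite -HartB//.
by have [I L] := L12B Hf Hg; exact: (Hart_contr I L).2.
Qed.

Definition U_spec f g := L2 g /\ lim2 (fun n => Hart (trunc n f)) g.

(** The transforms of the truncations form a Cauchy sequence, because the
    transform contracts L2 distances.  [L2_complete] needs a geometric rate, so
    it is applied along a subsequence t. *)
Lemma U_exists f : L2 f -> exists g, U_spec f g.
Proof.
move=> Lf.
have tc : lim2 (fun n => trunc n f) f by exact: trunc_cvg.
have Lt n : L12 (trunc n f) by exact: L12_trunc.
have q01 : 0 < (2^-1 : R) < 1 by apply/andP; split; lra.
have tail k : exists N, forall n, (N <= n)%N ->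
    n2 (fun x => trunc n f x - f x) <= 2^-1 ^+ k.
  have e0 : 0 < (2^-1 : R) ^+ k by rewrite exprn_gt0// invr_gt0.
  have [N _ NP] := (cvgr_lt _ tc) _ e0.
  by exists N => n Nn; apply: ltW; exact: NP.
pose s k := sval (cid (tail k)).
have sP k n : (s k <= n)%N -> n2 (fun x => trunc n f x - f x) <= 2^-1 ^+ k.
  exact: (svalP (cid (tail k))).
pose t := fix t k := if k is k'.+1 then maxn (t k') (s k) else s 0%N.
have ts k : (s k <= t k)%N by case: k => //= k; rewrite leq_maxr.
have tm k : (t k <= t k.+1)%N by rewrite /= leq_maxl.
have close k n : (t k <= n)%N ->
    n2 (fun p => Hart (trunc n f) p - Hart (trunc (t k) f) p) <= 4 * 2^-1 ^+ k.
  move=> tn; apply: (le_trans (n2_HartB (Lt _) (Lt _))).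
  have [? ?] := Lt n; have [? ?] := Lt (t k).
  apply: (le_trans (@n2_tri _ _ f _ _ _ _)) => //.
  have h1 := sP k n (leq_trans (ts k) tn).
  have h2 := sP k (t k) (ts k).
  rewrite (n2_sym f); lra.
have [g Lg gl] := @L2_complete R (fun k => Hart (trunc (t k) f)) 4 2^-1
   (ler0n R 4) q01 (fun k => L2_Hart (Lt (t k))) (fun k => close k _ (tm k)).
exists g; split; first exact: Lg.
apply/cvgrPdist_le => e e0.
have e4 : 0 < e / 4 by lra.
have [N1 _ N1P] := (cvgr_lt _ gl) _ e4.
have h0 : 4 * 2^-1 ^+ k @[k --> \oo] --> (0 : R).
  by apply: cvg_geometric; rewrite ger0_norm; lra.
have [N2 _ N2P] := (cvgr_lt _ h0) _ e4.
pose k := maxn N1 N2.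
exists (t k); first exact: I.
move=> n tn.
rewrite sub0r normrN (ger0_norm (n2_ge0 _)).
apply: (le_trans (@n2_tri _ _ (Hart (trunc (t k) f)) _ (L2_Hart (Lt _)) (L2_Hart (Lt _)) Lg)).
have h1 := close k n tn.
have h2 := N1P k (leq_maxl _ _); have h3 := N2P k (leq_maxr _ _).
rewrite /= in h2 h3; lra.
Qed.

Lemma U_choice : {T : (R -> R) -> (R -> R) | forall f, L2 f -> U_spec f (T f)}.
Proof.
pose T f : R -> R := match pselect (exists g, U_spec f g) with
  | left P => sval (cid P) | right _ => fun=> 0 end.
exists T => f /U_exists ef; rewrite /T; case: pselect => // P.
exact: (svalP (cid P)).
Qed.

(** The unitary Hartley transform of L2; its values are fixed up to almost
    everywhere equality by [U_spec]. *)
Definition U : (R -> R) -> (R -> R) := sval U_choice.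

Lemma U_specP f : L2 f -> U_spec f (U f). Proof. exact: (svalP U_choice). Qed.

Lemma L2_U f : L2 f -> L2 (U f). Proof. by move=> /U_specP[]. Qed.

Lemma U_contr f : L2 f -> n2 (U f) <= n2 f.
Proof.
move=> Lf; have [LU lU] := U_specP Lf.
have Lt n : L12 (trunc n f) by exact: L12_trunc.
have h1 := lim2_n2 (fun n => L2_Hart (Lt n)) LU lU.
have h2 := lim2_n2 (fun n => (Lt n).2) Lf (trunc_cvg Lf).
apply: (ler_cvg_to h1 h2); apply: nearW => n.
by have [I L] := Lt n; exact: (Hart_contr I L).2.
Qed.

Lemma U_lim fn f : (forall n, L12 (fn n)) -> L2 f -> lim2 fn f ->
  lim2 (fun n => Hart (fn n)) (U f).
Proof.
move=> Lf_ Lf ff; have [LU lU] := U_specP Lf.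
have Lt n : L12 (trunc n f) by exact: L12_trunc.
have ft : n2 (fun x => fn n x - trunc n f x) @[n --> \oo] --> (0 : R).
  have tc := trunc_cvg Lf.
  have : lim2 (fun n x => fn n x - trunc n f x) (fun x => f x - f x).
    by apply: lim2B => //; move=> n; [exact: (Lf_ n).2|exact: (Lt n).2].
  rewrite (_ : (fun x => f x - f x) = fun=> 0); last by apply/funext => x; rewrite subrr.
  by rewrite /lim2; under eq_fun do under eq_fun do rewrite subr0.
apply: (lim2_le2 ft lU) => n.
apply: (le_trans (@n2_tri _ _ (Hart (trunc n f)) _ (L2_Hart (Lf_ n)) (L2_Hart (Lt n)) LU)).
by rewrite lerD2r ler_pM2l//; exact: n2_HartB.
Qed.

Lemma U_Hart f : L12 f -> aeq (U f) (Hart f).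
Proof.
move=> [If Lf].
apply: (@lim2_unique (fun=> Hart f)); rewrite ?L2_U//.
- by move=> _; exact: L2_Hart.
- exact: L2_U.
- exact: L2_Hart.
- by apply: (@U_lim (fun=> f)) => //; exact: lim2_cst.
- exact: lim2_cst.
Qed.

Lemma UB f g : L2 f -> L2 g -> aeq (U (fun x => f x - g x)) (fun p => U f p - U g p).
Proof.
move=> Lf Lg.
have Lt n : L12 (trunc n f) by exact: L12_trunc.
have Lt' n : L12 (trunc n g) by exact: L12_trunc.
apply: (@lim2_unique (fun n => Hart (fun x => trunc n f x - trunc n g x))).
- by move=> n; apply: L2_Hart; exact: L12B.
- by apply: L2_U; exact: L2B.
- by apply: L2B; exact: L2_U.
- apply: U_lim; [by move=> n; exact: L12B|exact: L2B|].
  apply: lim2B => //; try (by move=> n; exact: L2_trunc); exact: trunc_cvg.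
- rewrite (_ : (fun n => _) = fun n x => Hart (trunc n f) x - Hart (trunc n g) x); last first.
    by apply/funext => n; rewrite HartB//; [exact: (Lt n).1|exact: (Lt' n).1].
  apply: lim2B; rewrite ?(U_specP _).1//; try (by move=> n; exact: L2_Hart); try exact: L2_U.
    exact: (U_specP Lf).2.
  exact: (U_specP Lg).2.
Qed.

Lemma n2_UB f g : L2 f -> L2 g ->
  n2 (fun p => U f p - U g p) <= n2 (fun x => f x - g x).
Proof.
move=> Lf Lg; rewrite -(n2_ae _ _ (UB Lf Lg)).
- by apply: U_contr; exact: L2B.
- by apply: L2_meas; apply: L2_U; exact: L2B.
- by apply: L2_meas; apply: L2B; exact: L2_U.
Qed.

Lemma U_ae f g : L2 f -> L2 g -> aeq f g -> aeq (U f) (U g).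
Proof.
move=> Lf Lg fg; apply: n2_le0_aeq; [exact: L2_U|exact: L2_U|] => e e0.
apply: (le_trans (n2_UB Lf Lg)).
rewrite (@n2_ae _ _ (fun=> 0)).
- by rewrite n2_0 ltW.
- by apply: L2_meas; exact: L2B.
- exact: measurable_cst.
- by move: fg; apply: AE1 => x ->; rewrite subrr.
Qed.

Lemma UZ (k : R) f : L2 f -> aeq (U (fun x => k * f x)) (fun p => k * U f p).
Proof.
move=> Lf.
have Lt n : L12 (trunc n f) by exact: L12_trunc.
have Lkt n : L12 (fun x => k * trunc n f x).
  by have [? ?] := Lt n; split; [exact: L1Z|exact: L2Z].
apply: (@lim2_unique (fun n => Hart (fun x => k * trunc n f x))).
- by move=> n; exact: L2_Hart.
- by apply: L2_U; exact: L2Z.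
- by apply: L2Z; exact: L2_U.
- apply: U_lim => //; first exact: L2Z.
  by apply: lim2Z => //; [move=> n; exact: L2_trunc|exact: trunc_cvg].
- rewrite (_ : (fun n => _) = fun n x => k * Hart (trunc n f) x); last first.
    by apply/funext => n; rewrite HartZ//; exact: (Lt n).1.
  by apply: lim2Z; [move=> n; exact: L2_Hart|exact: L2_U|exact: (U_specP Lf).2].
Qed.

Lemma U_sym f g : L2 f -> L2 g -> ip (U f) g = ip f (U g).
Proof.
move=> Lf Lg.
have Lt n : L12 (trunc n f) by exact: L12_trunc.
have Lt' n : L12 (trunc n g) by exact: L12_trunc.
have E n m : ip (Hart (trunc n f)) (trunc m g) = ip (trunc n f) (Hart (trunc m g)).
  by apply: Hart_sym; [exact: (Lt n).1|exact: (Lt' m).1].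
have E2 n : ip (Hart (trunc n f)) g = ip (trunc n f) (U g).
  have h1 := lim2_ip (fun m => (Lt' m).2) Lg (L2_Hart (Lt n)) (trunc_cvg Lg).
  have h2 := lim2_ip (fun m => L2_Hart (Lt' m)) (L2_U Lg) (Lt n).2 (U_specP Lg).2.
  have h3 : ip (trunc m g) (Hart (trunc n f)) @[m --> \oo] --> ip (U g) (trunc n f).
    apply: cvg_trans h2; apply: near_eq_cvg; apply: nearW => m.
    by rewrite ipC -E ipC.
  by rewrite ipC [RHS]ipC; exact: (cvg_unique _ h1 h3).
have h1 := lim2_ip (fun n => L2_Hart (Lt n)) (L2_U Lf) Lg (U_specP Lf).2.
have h2 := lim2_ip (fun n => (Lt n).2) Lf (L2_U Lg) (trunc_cvg Lf).
have h3 : ip (Hart (trunc n f)) g @[n --> \oo] --> ip f (U g).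
  by apply: cvg_trans h2; apply: near_eq_cvg; apply: nearW => n; rewrite E2.
exact: (cvg_unique _ h1 h3).
Qed.

(** With J the indicator and UJ its transform,
    n2 (U (UJ) - J) = n2 (U (UJ)) - 2 ip (U (UJ)) J + n2 J.  Symmetry
    turns the middle term into - 2 n2 (UJ), and n2 (UJ) = n2 J; contractivity
    then leaves something nonpositive. *)
Lemma U_invol_itv (c d : R) : c < d -> aeq (U (U (itv1 c d))) (itv1 c d).
Proof.
move=> cd; have LJ : L2 (itv1 c d) by exact: L2_itv1.
have h2 : n2 (U (itv1 c d)) = n2 (itv1 c d).
  rewrite (n2_ae _ _ (U_Hart (L12_itv1 c d))) ?Hart_itv1 ?n2_itv1//.
  - exact: L2_meas (L2_U LJ).
  - by apply: L2_meas; apply: L2_Hart; exact: L12_itv1.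
have LUJ := L2_U LJ; have LUUJ := L2_U LUJ.
have h1 := U_contr LUJ.
have h3 : ip (U (U (itv1 c d))) (itv1 c d) = n2 (U (itv1 c d)).
  by rewrite U_sym//; apply: eq_Rintegral => x _; rewrite expr2.
apply: n2_le0_aeq => // e e0; rewrite n2B// h3 -h2.
have arith (u v : R) : u <= v -> u - 2 * v + v <= e by lra.
exact: arith h1.
Qed.

(** By symmetry, ip (U (U f)) J = ip f (U (U J)) = ip f J for each indicator J
    of an interval, and these indicators separate L2 functions. *)
Lemma U_invol f : L2 f -> aeq (U (U f)) f.
Proof.
move=> Lf; have LU := L2_U Lf; have LUU := L2_U LU.
have LD : L2 (fun x => U (U f) x - f x) by exact: L2B.
have : aeq (fun x => U (U f) x - f x) (fun=> 0).
  apply: L2_itv_zero => // c d cd.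
  have LJ := @L2_itv1 R c d.
  rewrite ipBl// U_sym// U_sym//; last exact: L2_U.
  apply/eqP; rewrite subr_eq0; apply/eqP; apply: ip_ae; try exact: L2_meas.
  - by apply: L2_meas; do 2 apply: L2_U.
  - exact: aeq_refl.
  - exact: U_invol_itv.
exact: aeq_sub0.
Qed.

Lemma U_iso f : L2 f -> n2 (U f) = n2 f.
Proof.
move=> Lf; apply/eqP; rewrite eq_le U_contr//=.
rewrite -(n2_ae _ _ (U_invol Lf)); [exact: U_contr (L2_U Lf)| |exact: L2_meas].
by apply: L2_meas; do 2 apply: L2_U.
Qed.

End L2limits.

(** * Multipliers and convolution *)

Section multiplier.
Context {R : realType}.
Local Notation mu := (@lebesgue_measure R).
Implicit Types f g h phi alpha beta : R -> R.

Lemma L2_le_ae f g (M : R) : measurable_fun [set: R] f -> L2 g -> 0 <= M ->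
  AE (fun x => f x ^+ 2 <= M * g x ^+ 2) -> L2 f /\ n2 f <= M * n2 g.
Proof.
move=> mf Lg M0 fg.
have IM : L1 (fun x => M * g x ^+ 2) by apply: L1Z; exact: L2_sq.
have [] := @L2_ae_le R f (fun x => (M * g x ^+ 2)%:E) mf.
- by apply/measurable_EFinP; exact: L1_meas IM.
- by move=> x; rewrite lee_fin mulr_ge0 ?sqr_ge0.
- by apply: L1_lty IM _ => x; rewrite mulr_ge0 ?sqr_ge0.
- by move: fg; apply: AE1 => x; rewrite lee_fin.
move=> Lf le; split => //; apply: (le_trans le).
by rewrite -[fine _]/(\int[mu]_x (M * g x ^+ 2)) RintZ//; exact: L2_sq.
Qed.

(** The action on Hartley transforms of the Fourier multiplier alpha + i beta,
    for alpha even and beta odd. *)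
Definition mult alpha beta phi (p : R) := alpha p * phi p - beta p * phi (- p).

Lemma Rint_opp f : L1 f -> \int[mu]_x f (- x) = \int[mu]_x f x.
Proof.
by move=> If; rewrite -(Rint_refl 0 If); apply: eq_Rintegral => x _; rewrite sub0r.
Qed.

Lemma meas_opp f : measurable_fun [set: R] f -> measurable_fun [set: R] (fun x => f (- x)).
Proof.
move=> mf; rewrite (_ : (fun x => _) = fun x => f (0 - x)); first exact: meas_refl.
by apply/funext => x; rewrite sub0r.
Qed.

Lemma L1_opp f : L1 f -> L1 (fun x => f (- x)).
Proof.
move=> mf; rewrite (_ : (fun x => _) = fun x => f (0 - x)); first exact: L1_refl.
by apply/funext => x; rewrite sub0r.
Qed.

Lemma L2_opp f : L2 f -> L2 (fun x => f (- x)).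
Proof.
move=> mf; rewrite (_ : (fun x => _) = fun x => f (0 - x)); first exact: L2_refl.
by apply/funext => x; rewrite sub0r.
Qed.

Lemma AE_opp (P : R -> Prop) : AE P -> AE (fun x => P (- x)).
Proof. by move=> /(AE_refl 0); apply: AE1 => x; rewrite sub0r. Qed.

(** The cross terms of the square form an odd function and integrate to 0;
    after p |-> -p in the second square, |alpha + i beta|^2 phi^2 remains. *)
Lemma mult_energy alpha beta phi (M : R) :
  measurable_fun [set: R] alpha -> measurable_fun [set: R] beta ->
  (forall p, alpha (- p) = alpha p) -> (forall p, beta (- p) = - beta p) ->
  0 <= M -> AE (fun p => alpha p ^+ 2 + beta p ^+ 2 <= M) -> L2 phi ->
  L2 (mult alpha beta phi) /\ n2 (mult alpha beta phi) <= M * n2 phi.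
Proof.
move=> ma mb ea ob M0 abM Lp.
have Lp' := L2_opp Lp.
have mp := L2_meas Lp; have mp' := L2_meas Lp'.
have La : L2 (fun p => alpha p * phi p).
  apply: (L2_le_ae (measurable_funM ma mp) Lp M0 _).1.
  move: abM; apply: AE1 => p H; rewrite exprMn; apply: ler_wpM2r; first exact: sqr_ge0.
  by apply: le_trans H; rewrite lerDl sqr_ge0.
have Lb : L2 (fun p => beta p * phi (- p)).
  apply: (L2_le_ae (measurable_funM mb mp') Lp' M0 _).1.
  move: abM; apply: AE1 => p H; rewrite exprMn; apply: ler_wpM2r; first exact: sqr_ge0.
  by apply: le_trans H; rewrite lerDr sqr_ge0.
split; first exact: L2B.
rewrite /mult n2B//.
have -> : ip (fun p => alpha p * phi p) (fun p => beta p * phi (- p)) = 0.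
  have I := L2_mul La Lb.
  have H := Rint_opp I.
  have E : \int[mu]_p (alpha (- p) * phi (- p) * (beta (- p) * phi (- - p))) =
      -1 * \int[mu]_p (alpha p * phi p * (beta p * phi (- p))).
    by rewrite -RintZ//; apply: eq_Rintegral => p _; rewrite ea ob opprK; ring.
  by rewrite /ip; move: H; rewrite E; lra.
have Ib : L1 (fun p => beta p ^+ 2 * phi p ^+ 2).
  have := L1_opp (L2_sq Lb); congr L1; apply/funext => p.
  by rewrite ob opprK exprMn sqrrN.
have -> : n2 (fun p => beta p * phi (- p)) = \int[mu]_p (beta p ^+ 2 * phi p ^+ 2).
  rewrite -(Rint_opp Ib); apply: eq_Rintegral => p _.
  by rewrite ob sqrrN exprMn.
rewrite mulr0 subr0 /n2 -RintD//; last exact: L2_sq.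
rewrite -RintZ; last exact: L2_sq.
have I1 : L1 (fun p => (alpha p * phi p) ^+ 2 + beta p ^+ 2 * phi p ^+ 2).
  by apply: L1D => //; exact: L2_sq.
have IM : L1 (fun p => M * phi p ^+ 2) by apply: L1Z; exact: L2_sq.
rewrite -lee_fin !EFin_Rint//; apply: ae_ge0_le_integral => //.
- by move=> p _; rewrite lee_fin addr_ge0 ?sqr_ge0// mulr_ge0 ?sqr_ge0.
- by apply/measurable_EFinP; exact: L1_meas I1.
- by move=> p _; rewrite lee_fin mulr_ge0 ?sqr_ge0.
- by apply/measurable_EFinP; exact: L1_meas IM.
- move: abM; apply: AE1 => p H _; rewrite lee_fin exprMn -mulrDl.
  by rewrite ler_wpM2r// sqr_ge0.
Qed.

Lemma multB alpha beta f g p : mult alpha beta (fun x => f x - g x) p =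
  mult alpha beta f p - mult alpha beta g p.
Proof. by rewrite /mult; ring. Qed.

End multiplier.

Section convolution.
Context {R : realType}.
Local Notation mu := (@lebesgue_measure R).
Implicit Types f g h G : R -> R.

Definition convol G f (x : R) := \int[mu]_y (G (x - y) * f y).
(** Real part, and below minus the imaginary part, of the Fourier transform
    without the factor (2 pi)^(-1/2). *)
Definition FC G (p : R) := \int[mu]_x (G x * cos (p * x)).
Definition FS G (p : R) := \int[mu]_x (G x * sin (p * x)).

Lemma L1_shift f (c : R) : L1 f -> L1 (fun x => f (x - c)).
Proof.
move=> If; have := L1_refl c (L1_opp If); congr L1; apply/funext => x.
by rewrite opprB.
Qed.

Lemma Rint_shift f (c : R) : L1 f -> \int[mu]_x f (x - c) = \int[mu]_x f x.
Proof.
move=> If; rewrite -(Rint_opp If) -(Rint_refl c (L1_opp If)).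
by apply: eq_Rintegral => x _; rewrite opprB.
Qed.

Lemma meas_sub2 G : measurable_fun [set: R] G ->
  measurable_fun [set: R * R] (fun z : R * R => G (z.1 - z.2)).
Proof.
move=> mG; apply: (@measurableT_comp _ _ _ _ _ _ G) => //.
by apply: measurable_funB.
Qed.

Lemma meas_conv G f : measurable_fun [set: R] G -> measurable_fun [set: R] f ->
  measurable_fun [set: R] (convol G f).
Proof.
move=> mG mf; apply: (@meas_Rint_param R (fun z => G (z.1 - z.2) * f z.2)).
by apply: measurable_funM; [exact: meas_sub2|exact: meas_snd].
Qed.

Lemma convol_L1 G f : L1 G -> L1 f ->
  [/\ (\int[mu]_x \int[mu]_y `|G (x - y) * f y|%:E < +oo)%E,
     AE (fun x => L1 (fun y => G (x - y) * f y)), L1 (convol G f) &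
     (forall x, 0 <= G x) -> \int[mu]_x convol G f x = (\int[mu]_x G x) * \int[mu]_x f x].
Proof.
move=> IG If.
have mG := L1_meas IG; have mf := L1_meas If.
have mk : measurable_fun [set: R * R] (fun z : R * R => G (z.1 - z.2) * f z.2).
  by apply: measurable_funM; [exact: meas_sub2|exact: meas_snd].
have fin : (\int[mu]_x \int[mu]_y `|G (x - y) * f y|%:E < +oo)%E.
  rewrite (@fubini_tonelli _ _ (measurableTypeR R) (measurableTypeR R) R mu mu
    (fun z => `|G (z.1 - z.2) * f z.2|%:E)) => //; last first.
    by apply/measurable_EFinP; apply: measurableT_comp.
  rewrite (eint_eq (g := fun y => (`|f y| * \int[mu]_x `|G x|)%:E)).
    rewrite -EFin_Rint ?ltry//.
    rewrite (_ : (fun y => _) = fun y => (\int[mu]_x `|G x|) * `|f y|); first exact/L1Z/L1_norm.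
    by apply/funext => y; rewrite mulrC.
  move=> y /=; rewrite (eint_eq (g := fun x => (`|f y| * `|G (x - y)|)%:E)).
    have I := L1_shift y (L1_norm IG).
    by rewrite -EFin_Rint; [rewrite RintZ// (Rint_shift y (L1_norm IG))|exact: L1Z].
  by move=> x; rewrite normrM mulrC.
have [a1 _ Ic _ E] := Rint_Fubini mk fin.
split => // G0; rewrite /convol E; clear E a1 Ic fin.
rewrite -RintZ//; apply: eq_Rintegral => y _ /=.
rewrite -(Rint_shift y IG) mulrC -RintZ; last exact: L1_shift.
by apply: eq_Rintegral => x _; rewrite mulrC.
Qed.

(** Cauchy-Schwarz with |G| |f| = sqrt|G| (sqrt|G| |f|) bounds the square of
    the convolution by the L1 norm of G times |G| * f^2, which is integrable. *)
Lemma convol_L2 G f : L1 G -> L2 f ->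
  [/\ AE (fun x => L1 (fun y => G (x - y) * f y)), L2 (convol G f) &
    n2 (convol G f) <= (\int[mu]_x `|G x|) ^+ 2 * n2 f].
Proof.
move=> IG Lf; have mG := L1_meas IG; have mf := L2_meas Lf.
set K := \int[mu]_x `|G x|.
have [_ aB IB EB] := convol_L1 (L1_norm IG) (L2_sq Lf).
have {}EB := EB (fun x => normr_ge0 _).
pose B := convol (fun x => `|G x|) (fun y => f y ^+ 2).
have mG' x : measurable_fun [set: R] (fun y => G (x - y)) by exact: meas_refl.
have IG' x : L1 (fun y => `|G (x - y)|) by exact: (L1_refl x (L1_norm IG)).
have KE x : \int[mu]_y `|G (x - y)| = K by exact: (Rint_refl x (L1_norm IG)).
have key : AE (fun x => L1 (fun y => G (x - y) * f y) /\ convol G f x ^+ 2 <= K * B x).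
  move: aB; apply: AE1 => x Ix.
  pose a y := Num.sqrt `|G (x - y)|.
  have ma : measurable_fun [set: R] a.
    apply: (@measurableT_comp _ _ _ _ _ _ (Num.sqrt : R -> R)).
      by apply: cont_meas; exact: sqrt_continuous.
    by apply: measurableT_comp.
  have a2 y : a y ^+ 2 = `|G (x - y)| by rewrite sqr_sqrtr.
  have La : L2 a by split => //; rewrite (_ : (fun y => _) = fun y => `|G (x - y)|)//; apply/funext.
  have Lb : L2 (fun y => a y * `|f y|).
    split; first by apply: measurable_funM => //; apply: measurableT_comp.
    rewrite (_ : (fun y => _) = fun y => `|G (x - y)| * f y ^+ 2)//.
    by apply/funext => y; rewrite exprMn a2 real_normK ?num_real.
  have Iab := L2_mul La Lb.
  have abE y : a y * (a y * `|f y|) = `|G (x - y) * f y|.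
    by rewrite mulrA -expr2 a2 normrM.
  have Igf : L1 (fun y => G (x - y) * f y).
    apply: (L1_le _ Iab); first exact: measurable_funM.
    by move=> y; rewrite abE.
  split => //.
  have := cauchy_schwarz La Lb.
  rewrite (_ : n2 a = K); last by rewrite -(KE x); apply: eq_Rintegral => y _; rewrite a2.
  rewrite (_ : n2 _ = B x); last first.
    by apply: eq_Rintegral => y _; rewrite exprMn a2 real_normK ?num_real.
  apply: le_trans; rewrite -real_normK ?num_real// ler_sqr ?nnegrE//; last first.
    by apply: Rintegral_ge0 => y _; rewrite abE.
  apply: (le_trans (Rint_norm_le Igf)); rewrite /ip.
  by under [X in _ <= X]eq_Rintegral do rewrite abE.
have K0 : 0 <= K by apply: Rintegral_ge0.
have B0 x : 0 <= B x by apply: Rintegral_ge0 => y _; rewrite mulr_ge0// sqr_ge0.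
have IKB : L1 (fun x => K * B x) by exact: L1Z.
have [] := @L2_ae_le R (convol G f) (fun x => (K * B x)%:E).
- exact: meas_conv.
- by apply/measurable_EFinP; exact: L1_meas IKB.
- by move=> x; rewrite lee_fin mulr_ge0.
- by apply: L1_lty IKB _ => x; rewrite mulr_ge0.
- by move: key; apply: AE1 => x [_]; rewrite lee_fin.
move=> Lc le; split => //; first by move: key; apply: AE1 => x [].
apply: (le_trans le); rewrite -[fine _]/(\int[mu]_x (K * B x)) RintZ// EB.
by rewrite -/K mulrA expr2.
Qed.

Lemma L1_cos G (p : R) : L1 G -> L1 (fun x => G x * cos (p * x)).
Proof.
move=> IG; apply: (@L1_bounded_mul _ G (fun x => cos (p * x)) 1 IG).
  exact: (cont_meas (@cont_cosM _ _)).
by move=> x; exact: cos_le1'.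
Qed.

Lemma L1_sin G (p : R) : L1 G -> L1 (fun x => G x * sin (p * x)).
Proof.
move=> IG; apply: (@L1_bounded_mul _ G (fun x => sin (p * x)) 1 IG).
  exact: (cont_meas (@cont_sinM _ _)).
by move=> x; exact: sin_le1'.
Qed.

Lemma FC_even G p : FC G (- p) = FC G p.
Proof. by apply: eq_Rintegral => x _; rewrite mulNr cosN. Qed.

Lemma FS_odd G p : L1 G -> FS G (- p) = - FS G p.
Proof.
move=> IG; rewrite /FS -[RHS]mulN1r -RintZ; last exact: L1_sin.
by apply: eq_Rintegral => x _; rewrite mulNr sinN; ring.
Qed.

Lemma meas_FC G : measurable_fun [set: R] G -> measurable_fun [set: R] (FC G).
Proof.
move=> mG; apply: (@meas_Rint_param R (fun z => G z.2 * cos (z.1 * z.2))).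
apply: measurable_funM; first exact: meas_snd.
apply: (@measurableT_comp _ _ _ _ _ _ (cos : R -> R)).
  by apply: cont_meas; exact: continuous_cos.
by apply: measurable_funM.
Qed.

Lemma meas_FS G : measurable_fun [set: R] G -> measurable_fun [set: R] (FS G).
Proof.
move=> mG; apply: (@meas_Rint_param R (fun z => G z.2 * sin (z.1 * z.2))).
apply: measurable_funM; first exact: meas_snd.
apply: (@measurableT_comp _ _ _ _ _ _ (sin : R -> R)).
  by apply: cont_meas; exact: continuous_sin.
by apply: measurable_funM.
Qed.

Lemma FC_bound G p : L1 G -> `|FC G p| <= \int[mu]_x `|G x|.
Proof.
move=> IG; apply: (le_trans (Rint_norm_le (L1_cos p IG))).
apply: Rint_le; [exact/L1_norm/L1_cos|exact: L1_norm|] => x.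
by rewrite normrM ler_piMr// cos_le1'.
Qed.

Lemma FS_bound G p : L1 G -> `|FS G p| <= \int[mu]_x `|G x|.
Proof.
move=> IG; apply: (le_trans (Rint_norm_le (L1_sin p IG))).
apply: Rint_le; [exact/L1_norm/L1_sin|exact: L1_norm|] => x.
by rewrite normrM ler_piMr// sin_le1'.
Qed.

(** Multiplication by sqrt(2 pi) times the Fourier transform of G. *)
Definition multG G : (R -> R) -> R -> R := mult (FC G) (fun p => - FS G p).

Lemma Fubini_bounded_mul (k c : R * R -> R) (M : R) :
  measurable_fun [set: R * R] k -> measurable_fun [set: R * R] c ->
  (forall z, `|c z| <= M) ->
  (\int[mu]_x \int[mu]_y (`|k (x, y)|)%:E < +oo)%E ->
  (\int[mu]_x \int[mu]_y (`|k (x, y) * c (x, y)|)%:E < +oo)%E.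
Proof.
move=> mk mc cM ki.
have mk' : measurable_fun [set: R * R] (EFin \o k) by apply/measurable_EFinP.
have mkc : measurable_fun [set: R * R] (EFin \o (fun z => k z * c z)).
  by apply/measurable_EFinP; exact: measurable_funM.
have ik : (mu \x mu)%E.-integrable setT (EFin \o k).
  by apply/(@integrable12ltyP _ _ (measurableTypeR R) (measurableTypeR R) R mu mu).
apply/(@integrable12ltyP _ _ (measurableTypeR R) (measurableTypeR R) R mu mu _ mkc).
have ig := integrableZl measurableT M (integrable_abse ik).
apply: (le_integrable measurableT _ _ ig); first exact: mkc.
move=> z _ /=; rewrite lee_fin normrM [leRHS]ger0_norm.
  by rewrite mulrC ler_wpM2r.
by rewrite mulr_ge0// (le_trans _ (cM z)).
Qed.

Lemma Hart_convol G f : L1 G -> L1 f -> Hart (convol G f) = multG G (Hart f).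
Proof.
move=> IG If; apply/funext => p.
have mG := L1_meas IG; have mf := L1_meas If.
have [fin a1 _ _] := convol_L1 IG If.
have mk0 : measurable_fun [set: R * R] (fun z : R * R => G (z.1 - z.2) * f z.2).
  by apply: measurable_funM; [exact: meas_sub2|exact: meas_snd].
have mc : measurable_fun [set: R * R] (fun z : R * R => cas (p * z.1)).
  exact: (meas_fst (@meas_casM R p)).
have mk : measurable_fun [set: R * R] (fun z : R * R => G (z.1 - z.2) * f z.2 * cas (p * z.1)).
  exact: measurable_funM.
have fin' := Fubini_bounded_mul mk0 mc (fun z => cas_le2 _) fin.
have E : \int[mu]_x (\int[mu]_y (G (x - y) * f y * cas (p * x))) =
         \int[mu]_y (\int[mu]_x (G (x - y) * f y * cas (p * x))).
  by have [] := Rint_Fubini mk fin'.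
clear fin fin'.
rewrite /Hart.
have -> : \int[mu]_x (convol G f x * cas (p * x)) =
          \int[mu]_x (\int[mu]_y (G (x - y) * f y * cas (p * x))).
  apply: Rint_ae.
  - by apply: measurable_funM; [exact: meas_conv|exact: meas_casM].
  - exact: (meas_Rint_param mk).
  - move: a1; apply: AE1 => x Ix; rewrite mulrC -RintZ//.
    by apply: eq_Rintegral => y _; rewrite mulrC.
rewrite E; clear E.
have Ec y : \int[mu]_x (G (x - y) * f y * cas (p * x)) =
    FC G p * (f y * cas (p * y)) + FS G p * (f y * cas (- p * y)).
  have Ic : L1 (fun x => G x * cas (p * (x + y))).
    apply: (@L1_bounded_mul _ G (fun x => cas (p * (x + y))) 2 IG).
      apply: (@measurableT_comp _ _ _ _ _ _ (fun x => cas (p * x))); first exact: meas_casM.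
      by apply: measurable_funD.
    by move=> x; exact: cas_le2.
  transitivity (f y * \int[mu]_x (G x * cas (p * (x + y)))).
    rewrite -(Rint_shift y Ic) -RintZ; last exact: (L1_shift y Ic).
    by apply: eq_Rintegral => x _; rewrite subrK; ring.
  transitivity (f y * \int[mu]_x (cas (p * y) * (G x * cos (p * x)) +
      cas (- p * y) * (G x * sin (p * x)))).
    congr (_ * _); apply: eq_Rintegral => x _.
    by rewrite [p * (x + y)]mulrDr casD mulNr; ring.
  rewrite RintD; [|exact/L1Z/L1_cos|exact/L1Z/L1_sin].
  rewrite RintZ; last exact: L1_cos.
  rewrite RintZ; last exact: L1_sin.
  by rewrite -/(FC G p) -/(FS G p); ring.
under eq_Rintegral do rewrite Ec.
rewrite RintD; [|exact/L1Z/L1_cas|exact/L1Z/L1_cas].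
rewrite RintZ; last exact: L1_cas.
rewrite RintZ; last exact: L1_cas.
by rewrite /multG /mult /Hart; ring.
Qed.

Lemma multG_energy G f : L1 G -> L2 f ->
  L2 (multG G f) /\ n2 (multG G f) <= 2 * (\int[mu]_x `|G x|) ^+ 2 * n2 f.
Proof.
move=> IG Lf; have mG := L1_meas IG.
apply: mult_energy => //.
- exact: meas_FC.
- by apply: measurableT_comp => //; exact: meas_FS.
- exact: FC_even.
- by move=> p; rewrite FS_odd.
- by rewrite mulr_ge0// sqr_ge0.
- apply: AEW => p; rewrite sqrrN.
  have h1 := FC_bound p IG; have h2 := FS_bound p IG.
  have hK : 0 <= \int[mu]_x `|G x| := le_trans (normr_ge0 _) h1.
  rewrite -(real_normK (num_real (FC G p))) -(real_normK (num_real (FS G p))).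
  rewrite mulr_natl mulr2n.
  by apply: lerD; rewrite ler_sqr ?nnegrE.
Qed.

(** Both sides are L2-continuous in f, and they agree on truncations. *)
Lemma U_convol G f : L1 G -> L2 f -> aeq (U (convol G f)) (multG G (U f)).
Proof.
move=> IG Lf; have mG := L1_meas IG.
have Lt n : L12 (trunc n f) by exact: L12_trunc.
have Lc g : L2 g -> L2 (convol G g) by move=> Lg; have [] := convol_L2 IG Lg.
have L12c n : L12 (convol G (trunc n f)).
  split; last exact: Lc (Lt n).2.
  by have [] := convol_L1 IG (Lt n).1.
have lc : lim2 (fun n => convol G (trunc n f)) (convol G f).
  apply: (lim2_le (C := (\int[mu]_x `|G x|) ^+ 2) (trunc_cvg Lf)) => n.
  have Ld : L2 (fun x => trunc n f x - f x) by apply: L2B => //; exact: L2_trunc.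
  have [a1 _ _] := convol_L2 IG (L2_trunc n Lf).
  have [a2 _ _] := convol_L2 IG Lf.
  have [_ Lcd le] := convol_L2 IG Ld.
  apply: le_trans le; rewrite le_eqVlt; apply/orP; left; apply/eqP; apply: n2_ae.
  - by apply: L2_meas; apply: L2B; [exact: Lc (L2_trunc n Lf)|exact: Lc Lf].
  - exact: L2_meas.
  - apply: AE2 a1 a2 => x I1 I2; rewrite /convol -RintB//.
    by apply: eq_Rintegral => y _; rewrite mulrBr.
apply: (lim2_unique (fn := fun n => Hart (convol G (trunc n f)))).
- by move=> n; exact: L2_Hart.
- exact: L2_U (Lc _ Lf).
- exact: (multG_energy IG (L2_U Lf)).1.
- by apply: U_lim => //; exact: Lc.
- apply: (lim2_le (C := 2 * (\int[mu]_x `|G x|) ^+ 2) (U_specP Lf).2) => n.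
  have Ld : L2 (fun x => Hart (trunc n f) x - U f x).
    by apply: L2B; [exact: L2_Hart|exact: L2_U].
  have := (multG_energy IG Ld).2; apply: le_trans.
  rewrite Hart_convol//; last exact: (Lt n).1.
  rewrite (_ : (fun x => _) = multG G (fun x => Hart (trunc n f) x - U f x))//.
  by apply/funext => x; rewrite /multG multB.
Qed.

End convolution.

(** * Flat functions and bump functions *)

Section bump.
Context {R : realType}.
Implicit Types f g : R -> R.

(** The powers of 1/x make this family of flat functions closed under
    differentiation, up to linear combinations; see [der_flat]. *)
Definition flat (n : nat) (x : R) : R :=
  if 0 < x then x^-1 ^+ n * expR (- x^-1) else 0.

Lemma flat_ge0 n x : 0 <= flat n x.
Proof.
rewrite /flat; case: ifPn => // x0.
by rewrite mulr_ge0 ?expR_ge0// exprn_ge0// invr_ge0 ltW.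
Qed.

(** One term of the exponential series at 1/x gives e^(-1/x) <= (n+2)! x^(n+2)
    for x > 0.  A quadratic bound suffices for the derivative at 0. *)
Lemma flat_le n x : `|flat n x| <= (n.+2)`!%:R * x ^+ 2.
Proof.
rewrite ger0_norm ?flat_ge0// /flat; case: ifPn => x0; last first.
  by rewrite mulr_ge0 ?sqr_ge0.
have y0 : 0 < x^-1 by rewrite invr_gt0.
have h := @expR_ge1Dxn R x^-1 n.+1 (ltW y0).
have h2 : x^-1 ^+ n.+2 <= n.+2`!%:R * expR (x^-1).
  rewrite -ler_pdivrMl ?ltr0n ?fact_gt0// mulrC.
  by apply: le_trans h; rewrite lerDr.
rewrite -ler_pdivrMr ?exprn_gt0// expRN.
rewrite mulrAC -exprVn -exprD addn2.
by rewrite ler_pdivrMr// expR_gt0.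
Qed.

Lemma is_derive_sqr_bound f (K : R) : f 0 = 0 -> (forall h, `|f h| <= K * h ^+ 2) ->
  is_derive (0 : R) (1 : R) f 0.
Proof.
move=> f0 fK.
have lim : (fun h : R => h^-1 *: ((f \o shift 0) (h *: 1) - f 0)) @ 0^' --> (0 : R).
  apply/cvgr0Pnorm_le => e e0.
  have K0 : 0 <= K.
    by have := fK 1; rewrite expr1n mulr1; apply: le_trans.
  have d0 : 0 < e / (K + 1) by rewrite divr_gt0// ltr_wpDl.
  exists (e / (K + 1)) => //= h; rewrite /ball/= sub0r normrN => hd h0.
  rewrite f0 subr0 addr0 /GRing.scale/= mulr1 normrM normfV.
  rewrite ler_pdivrMl ?normr_gt0//.
  apply: (le_trans (fK h)).
  rewrite -(real_normK (num_real h)) expr2 mulrA mulrC ler_wpM2l//.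
  move: hd; rewrite ltr_pdivlMr ?ltr_wpDl// => /ltW; apply: le_trans.
  by rewrite mulrC ler_wpM2l// lerDl.
by apply: DeriveDef; [apply/cvg_ex; exists 0|exact/cvg_lim].
Qed.

Lemma der_flat n : der (flat n) (fun x => - n%:R * flat n.+1 x + flat n.+2 x).
Proof.
move=> x; have [x0|x0|x0] := ltgtP x 0.
- have E m : flat m x = 0 by rewrite /flat ifF//; apply/negbTE; rewrite -leNgt ltW.
  rewrite !E mulr0 addr0.
  apply: (@near_eq_is_derive _ _ _ (fun=> 0)).
    near=> y; rewrite /flat ifF//; apply/negbTE; rewrite -leNgt ltW//.
    by near: y; exact: lt_nbhsl.
- have E m : flat m x = x^-1 ^+ m * expR (- x^-1) by rewrite /flat x0.
  rewrite !E.
  have xn0 : x != 0 by rewrite gt_eqF.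
  have dV : is_derive x 1 (fun y : R => y^-1) (- x^-1 ^+ 2).
    have := @is_deriveV R id x 1 1 xn0 (is_derive_id _ _).
    by rewrite /GRing.scale/= mulr1 exprVn.
  have dE : is_derive x 1 (fun y : R => expR (- y^-1)) (expR (- x^-1) * x^-1 ^+ 2).
    have dN : is_derive x 1 (fun y : R => - y^-1) (- - x^-1 ^+ 2) by exact: is_deriveN.
    have := @is_derive1_comp R expR (fun y => - y^-1) x _ _ (is_derive_expR _) dN.
    by rewrite opprK.
  have dX : is_derive x 1 (fun y : R => y^-1 ^+ n) (- n%:R * x^-1 ^+ n.+1).
    case: n => [|n].
      rewrite mulr0n oppr0 mul0r; exact: (@der_cst R _ x).
    have := is_deriveX n.+1 dV; rewrite exprfctE.
    by congr is_derive; rewrite /GRing.scale/= !exprS; ring.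
  have H : is_derive x 1 (fun y : R => y^-1 ^+ n * expR (- y^-1))
      (- n%:R * (x^-1 ^+ n.+1 * expR (- x^-1)) + x^-1 ^+ n.+2 * expR (- x^-1)).
    have := is_deriveM dX dE.
    by congr is_derive; rewrite /GRing.scale/= !exprS; ring.
  apply: (near_eq_is_derive _ H).
  near=> y; rewrite /flat ifT//.
  by near: y; exact: lt_nbhsr.
- have E m : flat m 0 = 0 by rewrite /flat ltxx.
  rewrite x0 !E mulr0 addr0.
  apply: (@is_derive_sqr_bound _ ((n.+2)`!%:R)).
    by rewrite /flat ltxx.
  by move=> h; exact: flat_le.
Unshelve. all: by end_near. Qed.

End bump.

Section testfun.
Context {R : realType}.
Local Notation mu := (@lebesgue_measure R).
Implicit Types f g h eta psi : R -> R.

Lemma der_derive1 f f' : der f f' -> derive1 f = f'.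
Proof.
by move=> df; apply/funext => x; rewrite derive1E; have ? := df x; exact: derive_val.
Qed.

(** A class of functions that contains the bump below and is closed under
    differentiation: this gives smoothness without a formula for the n-th
    derivative. *)
Inductive bump_span (c : R) : (R -> R) -> Prop :=
| bump_prod m n : bump_span c (fun x => flat m (c + x) * flat n (c - x))
| bump_add f g : bump_span c f -> bump_span c g -> bump_span c (fun x => f x + g x)
| bump_scale (k : R) f : bump_span c f -> bump_span c (fun x => k * f x).

Lemma bump_span_der c f : bump_span c f ->
  exists2 f', der f f' & bump_span c f'.
Proof.
elim=> [m n|{}f g _ [f' df Bf] _ [g' dg Bg]|k {}f _ [f' df Bf]].
- have d1 : der (fun x => c + x) (fun=> 1).
    by apply: der_eq (derD (der_cst c) (@der_id R)) _ => x; rewrite add0r.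
  have d2 : der (fun x => c - x) (fun=> -1).
    by apply: der_eq (derD (der_cst c) (derN (@der_id R))) _ => x; rewrite add0r.
  have d := derM (der_comp (@der_flat R m) d1) (der_comp (@der_flat R n) d2).
  exists (fun x => (- m%:R * (flat m.+1 (c + x) * flat n (c - x)) +
                    flat m.+2 (c + x) * flat n (c - x)) +
                   (n%:R * (flat m (c + x) * flat n.+1 (c - x)) +
                    -1 * (flat m (c + x) * flat n.+2 (c - x)))).
    by apply: der_eq d _ => x /=; ring.
  apply: bump_add; apply: bump_add; try exact: bump_prod; apply: bump_scale; exact: bump_prod.
- by exists (fun x => f' x + g' x); [exact: derD|exact: bump_add].
- by exists (fun x => k * f' x); [exact: derZ|exact: bump_scale].
Qed.

Lemma bump_span_derive1n c f n : bump_span c f -> bump_span c (derive1n n f).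
Proof.
move=> Bf; elim: n => [//|n IH]; rewrite derive1nS.
by have [f' df Bf'] := bump_span_der IH; rewrite (der_derive1 df).
Qed.

Definition bumpf (c x : R) : R := flat 0 (c + x) * flat 0 (c - x).

Lemma flat_le0 n (x : R) : x <= 0 -> flat n x = 0.
Proof. by move=> x0; rewrite /flat ltNge x0. Qed.

Lemma bump_test (c : R) : test_function (bumpf c).
Proof.
split.
  move=> n x; have [f' df _] := bump_span_der (bump_span_derive1n n (bump_prod c 0 0)).
  by have ? := df x; exact: ex_derive.
exists c => x; rewrite /bumpf => cx.
have [x0|x0] := leP 0 x.
  by rewrite (@flat_le0 _ (c - x)) ?mulr0//; move: cx; rewrite ger0_norm//; lra.
by rewrite (@flat_le0 _ (c + x)) ?mul0r//; move: cx; rewrite ltr0_norm//; lra.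
Qed.

Lemma bump_ge0 (c x : R) : 0 <= bumpf c x.
Proof. by rewrite mulr_ge0 ?flat_ge0. Qed.

Lemma bump_gt0 (c x : R) : `|x| < c -> 0 < bumpf c x.
Proof.
rewrite ltr_norml => /andP[x1 x2]; rewrite /bumpf /flat.
have -> : 0 < c + x by lra.
have -> : 0 < c - x by lra.
by rewrite !expr0 !mul1r mulr_gt0 ?expR_gt0.
Qed.

Lemma bump_eq0 (c x : R) : c <= `|x| -> bumpf c x = 0.
Proof.
move=> cx; rewrite /bumpf; have [x0|x0] := leP 0 x.
  by rewrite (@flat_le0 _ (c - x)) ?mulr0//; move: cx; rewrite ger0_norm//; lra.
by rewrite (@flat_le0 _ (c + x)) ?mul0r//; move: cx; rewrite ltr0_norm//; lra.
Qed.

Lemma tf_der eta n : test_function eta -> der (derive1n n eta) (derive1n n.+1 eta).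
Proof.
move=> [dn _] x; rewrite derive1nS derive1E; apply: DeriveDef => //.
Qed.

Lemma tf_supp eta : test_function eta ->
  exists2 M, 0 <= M & forall n x, M < `|x| -> derive1n n eta x = 0.
Proof.
move=> te; have [_ [M MP]] := te.
exists `|M| => // n x Mx.
elim: n x Mx => [|n IH] x Mx; first by rewrite derive1n0 MP// (le_lt_trans (ler_norm M)).
have ? := tf_der n te x.
have : is_derive x 1 (derive1n n eta) 0.
  apply: (near_eq_is_derive _ (@der_cst R 0 x)).
  have : \forall y \near x, `|M| < `|y|.
    have cn : `|y| @[y --> x] --> `|x| by apply: cvg_norm.
    exact: (cvgr_gt _ cn).
  by apply: filterS => y /IH ->.
by move=> ?; rewrite derive1nS derive1E; exact: derive_val.
Qed.

Lemma tf_derive1 eta : test_function eta -> test_function (derive1 eta).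
Proof.
move=> te; have E n : derive1n n (derive1 eta) = derive1n n.+1 eta.
  by elim: n => [//|n IH]; rewrite derive1nS IH [in RHS]derive1nS.
split; first by move=> n x; rewrite E; have [] := te.
have [M _ MP] := tf_supp te; exists M => x Mx.
by have := MP 1%N x Mx; rewrite derive1n1.
Qed.

Lemma tf_derive1n eta n : test_function eta -> test_function (derive1n n eta).
Proof.
by move=> te; elim: n => [//|n IH]; rewrite derive1nS; exact: tf_derive1.
Qed.

Lemma tf_cont eta : test_function eta -> continuous eta.
Proof. by move=> te; exact: (der_cont (tf_der 0 te)). Qed.

Lemma cs_indic f (M : R) : (forall x, M < `|x| -> f x = 0) ->
  f = fun x => f x * \1_(`[- M, M]%classic) x.
Proof.
move=> fM; apply/funext => x; rewrite indicE mem_setE in_itv/= -ler_norml.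
by have [xM|Mx] := leP `|x| M; rewrite ?mulr1// fM// mul0r.
Qed.

Lemma cs_L1 f (M : R) : continuous f -> (forall x, M < `|x| -> f x = 0) -> L1 f.
Proof.
move=> cf fM; rewrite (cs_indic fM).
have : mu.-integrable `[- M, M]%classic (EFin \o f).
  apply: continuous_compact_integrable; first exact: segment_compact.
  exact: continuous_subspaceT.
have mi : measurable (`[- M, M]%classic : set (measurableTypeR R)) by exact: measurable_itv.
move=> H; rewrite /L1 (_ : EFin \o _ = (EFin \o f) \_ `[- M, M]%classic).
  exact: ((@integrable_mkcond _ (measurableTypeR R) R mu _ (EFin \o f) mi).1 H).
by apply/funext => x; rewrite /= epatch_indic /= EFinM.
Qed.

Lemma cs_L12 f (M : R) : continuous f -> (forall x, M < `|x| -> f x = 0) -> L12 f.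
Proof.
move=> cf fM; split; first exact: cs_L1 cf fM.
split; first exact: cont_meas.
apply: (@cs_L1 _ M); last by move=> x /fM ->; rewrite expr0n.
rewrite (_ : (fun x => _) = fun x => f x * f x); last by apply/funext => x; rewrite expr2.
by move=> x; apply: cvgM; exact: cf.
Qed.

Lemma tf_L12 eta : test_function eta -> L12 eta.
Proof.
move=> te; have [M _ MP] := tf_supp te.
apply: (@cs_L12 _ M); first exact: tf_cont.
by move=> x /(MP 0%N); rewrite derive1n0.
Qed.

Lemma by_parts eta psi psi' : test_function eta -> der psi psi' -> continuous psi' ->
  \int[mu]_x (derive1 eta x * psi x) = - \int[mu]_x (eta x * psi' x).
Proof.
move=> te dpsi cpsi'; have [M M0 MP] := tf_supp te.
have te' := tf_derive1 te.
have cpsi := der_cont dpsi.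
have c1 : continuous (fun x => derive1 eta x * psi x).
  by move=> x; apply: cvgM; [exact: tf_cont|exact: cpsi].
have c2 : continuous (fun x => eta x * psi' x).
  by move=> x; apply: cvgM; [exact: tf_cont|exact: cpsi'].
have z1 x : M < `|x| -> derive1 eta x * psi x = 0.
  by move=> Mx; have := MP 1%N x Mx; rewrite derive1n1 => ->; rewrite mul0r.
have z2 x : M < `|x| -> eta x * psi' x = 0.
  by move=> Mx; have := MP 0%N x Mx; rewrite derive1n0 => ->; rewrite mul0r.
have I1 := cs_L1 c1 z1; have I2 := cs_L1 c2 z2.
apply/eqP; rewrite -addr_eq0 -RintD//; apply/eqP.
have dF : der (fun x => eta x * psi x) (fun x => derive1 eta x * psi x + eta x * psi' x).
  by apply: derM => //; have := tf_der 0 te; rewrite derive1n1.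
have M1M : - (M + 1) <= M + 1 by lra.
have cs : continuous (fun x => derive1 eta x * psi x + eta x * psi' x).
  by move=> x; apply: cvgD; [exact: c1|exact: c2].
have := FTC_R M1M dF cs.
have eM (x : R) : M < `|x| -> eta x = 0 by move=> Mx; have := MP 0%N x Mx; rewrite derive1n0.
rewrite !eM ?mul0r ?subr0; last 2 first.
- by rewrite normrN ger0_norm; lra.
- by rewrite ger0_norm; lra.
move=> <-; congr (Rintegral _ _ _).
apply: cs_indic => x Mx; rewrite z1 ?z2 ?addr0//; lra.
Qed.

(** The derivative on the Hartley side: the multiplier i p. *)
Definition D (phi : R -> R) (p : R) : R := - (p * phi (- p)).

Lemma Hart_derive1 eta : test_function eta -> Hart (derive1 eta) = D (Hart eta).
Proof.
move=> te; apply/funext => p.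
have dc : der (fun x => cas (p * x)) (fun x => p * cas (- p * x)).
  have d1 := der_comp (@der_cos R) (derZ p (@der_id R)).
  have d2 := der_comp (@der_sin R) (derZ p (@der_id R)).
  apply: der_eq (derD d1 d2) _ => x /=.
  by rewrite /cas [- p * x]mulNr cosN sinN; ring.
rewrite /Hart /D (by_parts te dc).
  have I := L1_cas (- p) (tf_L12 te).1.
  rewrite (_ : \int[mu]_x _ = p * \int[mu]_x (eta x * cas (- p * x))); first by ring.
  by rewrite -RintZ//; apply: eq_Rintegral => x _; ring.
by move=> x; apply: cvgM; [exact: cvg_cst|exact: cont_casM].
Qed.

Lemma Hart_derive1n eta n : test_function eta ->
  Hart (derive1n n eta) = iter n D (Hart eta).
Proof.
move=> te; elim: n => [//|n IH].
by rewrite derive1nS Hart_derive1 ?IH//; exact: tf_derive1n.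
Qed.

Lemma FC_derive1 eta p : test_function eta -> FC (derive1 eta) p = p * FS eta p.
Proof.
move=> te.
have d1 := der_comp (@der_cos R) (derZ p (@der_id R)).
rewrite /FC (by_parts te d1).
  rewrite -RintZ; last exact: L1_sin (tf_L12 te).1.
  rewrite -mulN1r -RintZ.
    by apply: eq_Rintegral => x _ /=; ring.
  rewrite (_ : (fun x => _) = fun x => - p * (eta x * sin (p * x))).
    by apply: L1Z; exact: L1_sin (tf_L12 te).1.
  by apply/funext => x /=; ring.
move=> x; apply: cvgM; last exact: cvg_cst.
by apply: cvgN; exact: cont_sinM.
Qed.

Lemma FS_derive1 eta p : test_function eta -> FS (derive1 eta) p = - (p * FC eta p).
Proof.
move=> te.
have d1 := der_comp (@der_sin R) (derZ p (@der_id R)).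
rewrite /FS (by_parts te d1).
  rewrite -RintZ; last exact: L1_cos (tf_L12 te).1.
  by congr (- _); apply: eq_Rintegral => x _ /=; ring.
move=> x; apply: cvgM; last exact: cvg_cst.
exact: cont_cosM.
Qed.

Lemma AE_itv_false (c d : R) : c < d -> AE (fun x => ~ (c < x < d)) -> False.
Proof.
move=> cd [N [mN N0 sN]].
have : (mu `]c, d[%classic <= mu N)%E.
  apply: le_measure; rewrite ?inE//.
  by move=> x /=; rewrite in_itv/= => xcd; apply: sN => /=; apply.
rewrite N0 lebesgue_measure_itv/= lte_fin cd -EFinB lee_fin; lra.
Qed.

(** If |p| c < 1 then cos (p x) > 0 on the support of the bump, so the
    transform of a narrow bump does not vanish at p. *)
Lemma FC_bump_gt0 (c p : R) : 0 < c -> `|p| * c < 1 -> 0 < FC (bumpf c) p.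
Proof.
move=> c0 pc.
have te := bump_test c.
have I := L1_cos p (tf_L12 te).1.
have cpos x : `|x| < c -> 0 < cos (p * x).
  move=> xc; apply: cos_gt0_pihalf; rewrite -ltr_norml normrM.
  have : `|p| * `|x| <= `|p| * c by rewrite ler_wpM2l// ltW.
  have := @pi_ge2 R; lra.
have ge0 x : 0 <= bumpf c x * cos (p * x).
  have [xc|xc] := ltP `|x| c; last by rewrite bump_eq0// mul0r.
  by rewrite mulr_ge0 ?bump_ge0// ltW// cpos.
rewrite lt_def; apply/andP; split; last exact: Rintegral_ge0.
apply/eqP => z.
have : (\int[mu]_x `|(bumpf c x * cos (p * x))%:E| = 0)%E.
  rewrite (eint_eq (g := fun x => (bumpf c x * cos (p * x))%:E)); last first.
    by move=> x; rewrite gee0_abs// lee_fin.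
  by rewrite -EFin_Rint// -/(FC _ _) z.
move/(ae_eq_integral_abs mu measurableT (measurable_int _ I)) => H.
apply: (@AE_itv_false (- c) c); first by lra.
move: H; apply: AE1 => x /(_ Logic.I) [] H; rewrite -ltr_norml => xc.
by have := mulr_gt0 (bump_gt0 xc) (cpos x xc); rewrite H ltxx.
Qed.

End testfun.

(** * Weak derivatives on the Hartley side *)

Section weakder.
Context {R : realType}.
Local Notation mu := (@lebesgue_measure R).
Implicit Types f g h eta u w d phi : R -> R.

Lemma D_adj f g : L1 (fun p => f p * D g p) ->
  L1 (fun p => D f p * g p) /\ ip f (D g) = - ip (D f) g.
Proof.
move=> I.
have I' : L1 (fun p => D f p * g p).
  have := L1Z (-1) (L1_opp I); congr L1; apply/funext => p.
  by rewrite /D opprK; ring.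
split => //; rewrite /ip -(Rint_opp I) -mulN1r -RintZ//.
by apply: eq_Rintegral => p _; rewrite /D opprK; ring.
Qed.

(** [D] is antisymmetric, by p |-> -p.  Integrability of one product gives
    that of the others. *)
Lemma iterD_adj k f g : L1 (fun p => f p * iter k D g p) ->
  L1 (fun p => iter k D f p * g p) /\ ip f (iter k D g) = (-1) ^+ k * ip (iter k D f) g.
Proof.
elim: k f => [|k IH] f I; first by rewrite expr0 mul1r.
have [I1 E1] := D_adj I.
have [I2 E2] := IH _ I1.
rewrite iterSr; split => //; rewrite [LHS]E1 E2 exprS; ring.
Qed.

Lemma ip_U f g : L2 f -> L2 g -> ip (U f) (U g) = ip f g.
Proof.
move=> Lf Lg; rewrite -(U_sym (L2_U Lf) Lg).
have LU := L2_U Lf; have LUU := L2_U LU.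
apply: ip_ae; try exact: L2_meas.
- exact: U_invol.
- exact: aeq_refl.
Qed.

(** [weak_derivative] with the Borel measure in place of its completion. *)
Definition weak_der (k : nat) u w := forall phi, test_function phi ->
  \int[mu]_x (u x * derive1n k phi x) = (-1) ^+ k * \int[mu]_x (w x * phi x).

Lemma U_test phi : test_function phi -> aeq (U phi) (Hart phi).
Proof. by move=> tp; exact: U_Hart (tf_L12 tp). Qed.

Lemma ip_U_test f phi : L2 f -> test_function phi -> ip f phi = ip (U f) (Hart phi).
Proof.
move=> Lf tp; have Lp := tf_L12 tp; rewrite -(ip_U Lf Lp.2).
have LU := L2_U Lf; have LUp := L2_U Lp.2; have LH := L2_Hart Lp.
apply: ip_ae; try exact: L2_meas.
- exact: aeq_refl.
- exact: U_test.
Qed.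

(** Testing against phi becomes, by unitarity, pairing [U u] with
    D^k (Hart phi), and [D] can be moved to the other side. *)
Lemma weak_der_of_Hartley k u w : L2 u -> L2 w -> aeq (U w) (iter k D (U u)) -> weak_der k u w.
Proof.
move=> Lu Lw uw phi tp; have tk := tf_derive1n k tp.
have LUu := L2_U Lu; have LUw := L2_U Lw.
have LHk := L2_Hart (tf_L12 tk); have LH := L2_Hart (tf_L12 tp).
rewrite -[LHS]/(ip u (derive1n k phi)) (ip_U_test Lu tk).
rewrite -[X in _ * X]/(ip w phi) (ip_U_test Lw tp).
rewrite Hart_derive1n// in LHk *.
have [I ->] := iterD_adj (L2_mul LUu LHk); congr (_ * _).
apply: Rint_ae.
- exact: L1_meas I.
- exact: L1_meas (L2_mul LUw LH).
- by move: uw; apply: AE1 => p ->.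
Qed.

Lemma derive1n_refl phi (y : R) n : test_function phi ->
  derive1n n (fun x => phi (y - x)) = fun x => (-1) ^+ n * derive1n n phi (y - x).
Proof.
move=> tp; elim: n => [|n IH]; first by apply/funext => x; rewrite mul1r.
rewrite derive1nS IH.
have d2 : der (fun x => y - x) (fun=> -1).
  by apply: der_eq (derD (der_cst y) (derN (@der_id R))) _ => x; rewrite add0r.
have d := derZ ((-1) ^+ n) (der_comp (tf_der n tp) d2).
by rewrite (der_derive1 d); apply/funext => x; rewrite exprS; ring.
Qed.

Lemma tf_refl phi (y : R) : test_function phi -> test_function (fun x => phi (y - x)).
Proof.
move=> tp; split.
  move=> n x; rewrite (derive1n_refl y n tp).
  have d2 : der (fun x => y - x) (fun=> -1).
    by apply: der_eq (derD (der_cst y) (derN (@der_id R))) _ => z; rewrite add0r.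
  by have ? := derZ ((-1) ^+ n) (der_comp (tf_der n tp) d2) x; exact: ex_derive.
have [M M0 MP] := tf_supp tp; exists (M + `|y|) => x Mx.
have := MP 0%N (y - x); rewrite derive1n0; apply.
have := ler_distD y 0 x; rewrite !sub0r !normrN distrC; lra.
Qed.

(** The weak derivative is tested against x |-> eta (y - x). *)
Lemma weak_der_conv k eta u w : test_function eta -> L2 u -> L2 w -> weak_der k u w ->
  convol (derive1n k eta) u = convol eta w.
Proof.
move=> te Lu Lw uw; apply/funext => y.
have := uw _ (tf_refl y te); rewrite (derive1n_refl y k te) => H.
have s2 : (-1) ^+ k * (-1) ^+ k = 1 :> R by rewrite -exprMn mulrNN mulr1 expr1n.
have Lk : L2 (fun x : R => (derive1n k eta (y - x) : R)).
  exact: (L2_refl y (tf_L12 (tf_derive1n k te)).2).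
have E1 : convol (derive1n k eta) u y =
    (-1) ^+ k * \int[mu]_x (u x * ((-1) ^+ k * derive1n k eta (y - x))).
  rewrite -RintZ; last first.
    rewrite (_ : (fun x => _) = fun x => (-1) ^+ k * (u x * derive1n k eta (y - x))).
      by apply: L1Z; exact: L2_mul.
    by apply/funext => x; ring.
  apply: eq_Rintegral => x _.
  transitivity ((-1) ^+ k * (-1) ^+ k * (derive1n k eta (y - x) * u x)).
    by rewrite s2 mul1r.
  by rewrite -mulrA; congr (_ * _); rewrite [RHS]mulrCA; congr (_ * _); rewrite mulrC.
rewrite E1 H mulrA s2 mul1r.
by apply: eq_Rintegral => x _; rewrite mulrC.
Qed.

Lemma FS_bump_sq (c p : R) : 0 < c -> `|p| * c < 1 ->
  0 < FC (bumpf c) p ^+ 2 + FS (bumpf c) p ^+ 2.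
Proof.
move=> c0 pc; have := FC_bump_gt0 c0 pc => C0.
by rewrite ltr_pwDl ?exprn_gt0// sqr_ge0.
Qed.

Lemma FCS_derive1n n eta (p : R) : test_function eta ->
  FC (derive1n n.+1 eta) p = p * FS (derive1n n eta) p /\
  FS (derive1n n.+1 eta) p = - (p * FC (derive1n n eta) p).
Proof.
by move=> te; rewrite derive1nS; split; [apply: FC_derive1|apply: FS_derive1];
  exact: tf_derive1n.
Qed.

Lemma fourth_iterate (C S : nat -> R) (p : R) :
  (forall n, C n.+1 = p * S n) -> (forall n, S n.+1 = - (p * C n)) ->
  C 4 = p ^+ 4 * C 0%N /\ S 4 = p ^+ 4 * S 0%N.
Proof.
move=> hC hS; split.
  by rewrite hC hS hC hS; ring.
by rewrite hS hC hS hC; ring.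
Qed.

Lemma FCS_derive1n4 eta (p : R) : test_function eta ->
  FC (derive1n 4 eta) p = p ^+ 4 * FC eta p /\
  FS (derive1n 4 eta) p = p ^+ 4 * FS eta p.
Proof.
move=> te.
exact: (@fourth_iterate (fun n => FC (derive1n n eta) p) (fun n => FS (derive1n n eta) p) p
  (fun n => (FCS_derive1n n p te).1) (fun n => (FCS_derive1n n p te).2)).
Qed.

Lemma U_0 : aeq (U (fun=> 0 : R)) (fun=> 0).
Proof.
have L0 := @L2_0 R; apply: n2_eq0; first exact: L2_U.
apply/eqP; rewrite eq_le n2_ge0 andbT; apply: (le_trans (U_contr L0)).
by rewrite n2_0.
Qed.

Lemma U_eq0 f : L2 f -> aeq (U f) (fun=> 0) -> aeq f (fun=> 0).
Proof.
move=> Lf U0; apply: n2_eq0 => //; rewrite -U_iso//.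
rewrite (n2_ae _ _ U0).
- exact: n2_0.
- by apply: L2_meas; exact: L2_U.
- exact: measurable_cst.
Qed.

(** For each test function eta, theta = eta'''' - b eta' - a eta satisfies
    theta * d = 0.  On the Hartley side this is a linear relation between
    U d p and U d (-p), whose coefficients are, up to sign and
    normalization, the real and imaginary parts of (p^4 - a - i b p) eta^(p).
    Together with the relation at -p it forms a linear system whose determinant
    is a positive multiple of |p^4 - a - i b p|^2 |eta^(p)|^2, which is positive
    when p <> 0 and eta is a bump supported in |x| <= c with |p| c < 1. *)
Lemma weak_der_unique (a b : R) d d1 d4 : b != 0 -> L2 d -> L2 d1 -> L2 d4 ->
  weak_der 1 d d1 -> weak_der 4 d d4 -> AE (fun x => d4 x - b * d1 x - a * d x = 0) ->
  aeq d (fun=> 0).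
Proof.
move=> b0 Ld Ld1 Ld4 w1 w4 eq0; apply: U_eq0 => //.
have key eta : test_function eta -> AE (fun p =>
    (p ^+ 4 - a) * FC eta p * U d p - b * p * FS eta p * U d p +
    ((p ^+ 4 - a) * FS eta p + b * p * FC eta p) * U d (- p) = 0).
  move=> te.
  pose th x := derive1n 4 eta x - b * derive1n 1 eta x - a * eta x.
  have L4 := tf_L12 (tf_derive1n 4 te); have L1' := tf_L12 (tf_derive1n 1 te).
  have L0 := tf_L12 te.
  have Lth : L12 th.
    apply: L12B; first apply: L12B => //.
    - by split; [exact: L1Z L1'.1|exact: L2Z L1'.2].
    - by split; [exact: L1Z L0.1|exact: L2Z L0.2].
  have cth : convol th d = fun=> 0.
    apply/funext => y.
    have i4 : L1 (fun x => derive1n 4 eta (y - x) * d x).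
      exact: L2_mul (L2_refl y L4.2) Ld.
    have i1 : L1 (fun x => b * (derive1n 1 eta (y - x) * d x)).
      exact: L1Z (L2_mul (L2_refl y L1'.2) Ld).
    have i0 : L1 (fun x => a * (eta (y - x) * d x)).
      exact: L1Z (L2_mul (L2_refl y L0.2) Ld).
    have j4 : L1 (fun x => eta (y - x) * d4 x).
      exact: L2_mul (L2_refl y L0.2) Ld4.
    have j1 : L1 (fun x => b * (eta (y - x) * d1 x)).
      exact: L1Z (L2_mul (L2_refl y L0.2) Ld1).
    transitivity (convol (derive1n 4 eta) d y - b * convol (derive1n 1 eta) d y - a * convol eta d y).
      rewrite /convol -RintZ; last exact: L2_mul (L2_refl y L1'.2) Ld.
      rewrite -RintB// -RintZ; last exact: L2_mul (L2_refl y L0.2) Ld.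
      rewrite -RintB//; last exact: L1B.
      by apply: eq_Rintegral => x _; rewrite /th; ring.
    rewrite (weak_der_conv te Ld Ld4 w4) (weak_der_conv te Ld Ld1 w1).
    rewrite /convol -RintZ; last exact: L2_mul (L2_refl y L0.2) Ld1.
    rewrite -RintB// -RintZ; last exact: L2_mul (L2_refl y L0.2) Ld.
    rewrite -RintB//; last exact: L1B.
    rewrite (Rint_ae (g := fun=> 0)); first by rewrite /Rintegral integral0.
    - by apply: L1_meas; apply: L1B => //; exact: L1B.
    - exact: measurable_cst.
    - move: eq0; apply: AE1 => x E.
      by rewrite (_ : _ - _ = eta (y - x) * (d4 x - b * d1 x - a * d x)); [rewrite E mulr0|ring].
  have := U_convol Lth.1 Ld; rewrite cth => H.
  have CS p : FC th p = (p ^+ 4 - a) * FC eta p - b * p * FS eta p /\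
              FS th p = (p ^+ 4 - a) * FS eta p + b * p * FC eta p.
    have B1 := L1_cos p (tf_L12 (tf_derive1n 4 te)).1.
    have B2 := L1_cos p (tf_L12 (tf_derive1n 1 te)).1.
    have B3 := L1_cos p (tf_L12 te).1.
    have S1 := L1_sin p (tf_L12 (tf_derive1n 4 te)).1.
    have S2 := L1_sin p (tf_L12 (tf_derive1n 1 te)).1.
    have S3 := L1_sin p (tf_L12 te).1.
    have EC : FC th p = FC (derive1n 4 eta) p - b * FC (derive1n 1 eta) p - a * FC eta p.
      rewrite /FC -RintZ// -RintB//; last exact: L1Z.
      rewrite -RintZ// -RintB//; last exact: L1Z.
        by apply: eq_Rintegral => x _; rewrite /th; ring.
      by apply: L1B => //; exact: L1Z.
    have ES : FS th p = FS (derive1n 4 eta) p - b * FS (derive1n 1 eta) p - a * FS eta p.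
      rewrite /FS -RintZ// -RintB//; last exact: L1Z.
      rewrite -RintZ// -RintB//; last exact: L1Z.
        by apply: eq_Rintegral => x _; rewrite /th; ring.
      by apply: L1B => //; exact: L1Z.
    have [F1 G1] := FCS_derive1n 0 p te; have [F4 G4] := FCS_derive1n4 p te.
    rewrite derive1n0 in F1 G1; rewrite EC ES {EC ES} F4 G4 {F4 G4} F1 G1.
    by split; ring.
  apply: AE2 H U_0 => p; rewrite /multG /mult => -> E.
  have [HC HS] := CS p; move: E; rewrite HC HS => E.
  by rewrite -[RHS]E; ring.
(* Countably many bumps serve all p, so the exceptional sets stay negligible. *)
pose c n : R := n.+1%:R^-1.
have c0 n : 0 < c n by rewrite invr_gt0.
have K := AE_all (fun n => key _ (bump_test (c n))).
have K' := AE_opp K.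
apply: AE3 K K' (AE_neq 0) => p Kp Kp' p0.
pose n := Num.truncn `|p|.
have pn : `|p| * c n < 1.
  by rewrite ltr_pdivrMr ?ltr0n// mul1r truncnS_gt.
have := Kp n; have := Kp' n; have := FS_bump_sq (c0 n) pn.
set C := FC _ _; set S := FS _ _ => CS.
rewrite FC_even FS_odd; last exact: (tf_L12 (bump_test _)).1.
rewrite -/C -/S opprK.
have -> : (- p) ^+ 4 = p ^+ 4 by ring.
set A := p ^+ 4 - a; set u := U d p; set v := U d (- p) => E2 E1.
have Q : 0 < A ^+ 2 + (b * p) ^+ 2.
  by rewrite ltr_wpDl ?sqr_ge0// exprn_even_gt0//= mulf_neq0.
have : (A ^+ 2 + (b * p) ^+ 2) * (C ^+ 2 + S ^+ 2) * u = 0.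
  transitivity ((A * C - b * p * S) * (A * C * u - b * p * S * u + (A * S + b * p * C) * v) -
     (A * S + b * p * C) * (A * C * v - b * - p * - S * v + (A * - S + b * - p * C) * u)).
    by ring.
  by rewrite E1 E2 !mulr0 subr0.
move/eqP; rewrite mulf_eq0 mulf_eq0 (gt_eqF Q) (gt_eqF CS) /= => /eqP.
exact.
Qed.

End weakder.

(** * The solution operator of the linear equation *)

Section solution_operator.
Context {R : realType}.
Local Notation mu := (@lebesgue_measure R).
Implicit Types f g h u w phi psi : R -> R.

Lemma meas_inv : measurable_fun [set: R] (fun x : R => x^-1).
Proof.
pose e n : R := n.+1%:R^-1.
have e0 n : 0 < e n by rewrite invr_gt0.
have d0 n (x : R) : x ^+ 2 + e n != 0 by rewrite gt_eqF// ltr_wpDl ?sqr_ge0.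
apply: (@measurable_fun_cvg _ (measurableTypeR R) R setT (fun n x => x / (x ^+ 2 + e n))).
  move=> n; apply: cont_meas => x; apply: cvgM; first exact: cvg_id.
  apply: cvgV; first exact: d0.
  apply: cvgD; last exact: cvg_cst.
  by rewrite expr2; under eq_fun do rewrite expr2; apply: cvgM; exact: cvg_id.
move=> x _; have [->|x0] := eqVneq x 0.
  rewrite invr0; apply: cvg_near_cst; apply: nearW => n; by rewrite mul0r.
have -> : x^-1 = x / (x ^+ 2 + 0) by rewrite addr0 expr2 invfM mulrA mulfV ?mul1r.
apply: cvgM; first exact: cvg_cst.
apply: cvgV; first by rewrite addr0 expf_eq0.
by apply: cvgD; [exact: cvg_cst|exact: cvg_harmonic].
Qed.

Lemma aeq_D f g : aeq f g -> aeq (D f) (D g).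
Proof. by move=> /AE_opp; apply: AE1 => p; rewrite /D => ->. Qed.

Lemma aeq_iterD k f g : aeq f g -> aeq (iter k D f) (iter k D g).
Proof. by move=> fg; elim: k => [//|k IH] /=; exact: aeq_D. Qed.

Lemma meas_iterD k f : measurable_fun [set: R] f -> measurable_fun [set: R] (iter k D f).
Proof.
move=> mf; elim: k => [//|k IH] /=.
apply: measurableT_comp => //; apply: measurable_funM => //; exact: meas_opp.
Qed.

Lemma iterD_sqr_le k psi p :
  iter k D psi p ^+ 2 <= p ^+ (2 * k) * (psi p ^+ 2 + psi (- p) ^+ 2).
Proof.
elim: k p => [|k IH] p; first by rewrite expr0 mul1r lerDl sqr_ge0.
rewrite /= /D sqrrN exprMn.
apply: (@le_trans _ _ (p ^+ 2 * ((- p) ^+ (2 * k) * (psi (- p) ^+ 2 + psi (- - p) ^+ 2)))).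
  by rewrite ler_wpM2l ?sqr_ge0.
rewrite opprK [psi (- p) ^+ 2 + _]addrC exprM sqrrN -exprM mulrA -exprD.
by rewrite -mulnS.
Qed.

Lemma exprn_le_1D8 (p : R) k : (k <= 4)%N -> p ^+ (2 * k) <= 1 + p ^+ 8.
Proof.
move=> k4; rewrite exprM (_ : p ^+ 8 = (p ^+ 2) ^+ 4); last by rewrite -exprM.
have := sqr_ge0 p; set q := p ^+ 2 => q0.
have [q1|q1] := leP q 1.
  by rewrite (le_trans (exprn_ile1 _ q0 q1))// lerDl exprn_ge0.
apply: (@le_trans _ _ (q ^+ 4)); last by rewrite lerDr.
by rewrite ler_eXn2l.
Qed.

(** [D] multiplies by |p| up to reflection, and p^(2k) <= 1 + p^8 for k <= 4. *)
Lemma L2_iterD k psi : (k <= 4)%N -> L2 psi -> L2 (fun p => p ^+ 4 * psi p) ->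
  L2 (iter k D psi).
Proof.
move=> k4 Lp L4.
have mk := meas_iterD k (L2_meas Lp); split => //.
apply: (@L1_le _ _ (fun p => (psi p ^+ 2 + (p ^+ 4 * psi p) ^+ 2) +
                       (psi (- p) ^+ 2 + ((- p) ^+ 4 * psi (- p)) ^+ 2))).
- exact: measurable_funX.
- have I : L1 (fun p => psi p ^+ 2 + (p ^+ 4 * psi p) ^+ 2).
    by apply: L1D; exact: L2_sq.
  apply: L1D => //; have := L1_opp I; exact.
- move=> p; rewrite ger0_norm ?sqr_ge0//.
  apply: (le_trans (iterD_sqr_le k psi p)).
  apply: (@le_trans _ _ ((1 + p ^+ 8) * (psi p ^+ 2 + psi (- p) ^+ 2))).
    by rewrite ler_wpM2r ?addr_ge0 ?sqr_ge0// exprn_le_1D8.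
  rewrite le_eqVlt; apply/orP; left; apply/eqP.
  by ring.
Qed.

Context (G : R -> R) (a b M : R).
Context (IG : L1 G) (b0 : b != 0) (M0 : 0 <= M).

(** With symA - i symB = p^4 - a - i b p, the functions malpha and mbeta are the
    real and imaginary parts of the multiplier sqrt(2 pi) G^ / (p^4 - a - i b p),
    and msq is its squared modulus. *)
Definition symA (p : R) := p ^+ 4 - a.
Definition symB (p : R) := b * p.
Definition symQ (p : R) := symA p ^+ 2 + symB p ^+ 2.
Definition malpha (p : R) := (FC G p * symA p + FS G p * symB p) / symQ p.
Definition mbeta (p : R) := (FC G p * symB p - FS G p * symA p) / symQ p.
Definition msq (p : R) := (FC G p ^+ 2 + FS G p ^+ 2) / symQ p.

Context (bnd0 : AE (fun p => msq p <= M))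
  (bnd4 : AE (fun p => p ^+ 8 * msq p <= M)).

Lemma symQ_gt0 p : p != 0 -> 0 < symQ p.
Proof.
by move=> p0; rewrite ltr_wpDl ?sqr_ge0// exprn_even_gt0//= mulf_neq0.
Qed.

Lemma malpha_even p : malpha (- p) = malpha p.
Proof.
have A4 : symA (- p) = symA p by rewrite /symA; ring.
have BN : symB (- p) = - symB p by rewrite /symB; ring.
by rewrite /malpha /symQ FC_even FS_odd// A4 BN sqrrN mulrNN.
Qed.

Lemma mbeta_odd p : mbeta (- p) = - mbeta p.
Proof.
have A4 : symA (- p) = symA p by rewrite /symA; ring.
have BN : symB (- p) = - symB p by rewrite /symB; ring.
rewrite /mbeta /symQ FC_even FS_odd// A4 BN sqrrN -[RHS]mulNr; congr (_ / _); ring.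
Qed.

Lemma meas_symA : measurable_fun [set: R] symA.
Proof. by apply: measurable_funB => //; exact: measurable_funX. Qed.

Lemma meas_symB : measurable_fun [set: R] symB.
Proof. by apply: measurable_funM. Qed.

Lemma meas_symQV : measurable_fun [set: R] (fun p => (symQ p)^-1).
Proof.
apply: (@measurableT_comp _ _ _ _ _ _ (fun x : R => x^-1)).
  exact: meas_inv.
apply: measurable_funD; apply: measurable_funX; [exact: meas_symA|exact: meas_symB].
Qed.

Lemma meas_malpha : measurable_fun [set: R] malpha.
Proof.
have mG := L1_meas IG.
apply: measurable_funM; last exact: meas_symQV.
apply: measurable_funD; apply: measurable_funM.
- exact: meas_FC.
- exact: meas_symA.
- exact: meas_FS.
- exact: meas_symB.
Qed.

Lemma meas_mbeta : measurable_fun [set: R] mbeta.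
Proof.
have mG := L1_meas IG.
apply: measurable_funM; last exact: meas_symQV.
apply: measurable_funB; apply: measurable_funM.
- exact: meas_FC.
- exact: meas_symB.
- exact: meas_FS.
- exact: meas_symA.
Qed.

Lemma m_sqr p : malpha p ^+ 2 + mbeta p ^+ 2 = msq p.
Proof.
rewrite /malpha /mbeta /msq !exprMn.
have [->|q0] := eqVneq (symQ p) 0; first by rewrite invr0 expr0n /= !mulr0 addr0.
rewrite /symQ in q0 *; field; exact: q0.
Qed.

Definition Mult := mult malpha mbeta.

Lemma Mult_energy f : L2 f -> L2 (Mult f) /\ n2 (Mult f) <= M * n2 f.
Proof.
apply: mult_energy => //.
- exact: meas_malpha.
- exact: meas_mbeta.
- exact: malpha_even.
- exact: mbeta_odd.
- by move: bnd0; apply: AE1 => p; rewrite m_sqr.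
Qed.

Lemma L2_Mult4 f : L2 f -> L2 (fun p => p ^+ 4 * Mult f p).
Proof.
move=> Lf; have m4 : measurable_fun [set: R] (fun p : R => p ^+ 4) by exact: measurable_funX.
have [] := @mult_energy R (fun p => p ^+ 4 * malpha p) (fun p => p ^+ 4 * mbeta p) f M.
- by apply: measurable_funM => //; exact: meas_malpha.
- by apply: measurable_funM => //; exact: meas_mbeta.
- by move=> p; rewrite malpha_even; ring.
- by move=> p; rewrite mbeta_odd; ring.
- exact: M0.
- move: bnd4; apply: AE1 => p; rewrite -m_sqr; apply: le_trans.
  by rewrite le_eqVlt; apply/orP; left; apply/eqP; ring.
- exact: Lf.
move=> + _; congr L2; apply/funext => p.
by rewrite /Mult /mult; ring.
Qed.

Definition Sol f := U (Mult (U f)).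

Lemma L2_Sol f : L2 f -> L2 (Sol f).
Proof. by move=> Lf; apply: L2_U; exact: (Mult_energy (L2_U Lf)).1. Qed.

Lemma U_Sol f : L2 f -> aeq (U (Sol f)) (Mult (U f)).
Proof. by move=> Lf; apply: U_invol; exact: (Mult_energy (L2_U Lf)).1. Qed.

Lemma Sol_contr f g : L2 f -> L2 g ->
  n2 (fun x => Sol f x - Sol g x) <= M * n2 (fun x => f x - g x).
Proof.
move=> Lf Lg; have LUf := L2_U Lf; have LUg := L2_U Lg.
apply: (le_trans (n2_UB (Mult_energy LUf).1 (Mult_energy LUg).1)).
rewrite (_ : (fun p => _) = Mult (fun p => U f p - U g p)); last first.
  by apply/funext => p; rewrite /Mult multB.
apply: (le_trans (Mult_energy (L2B LUf LUg)).2).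
by rewrite ler_wpM2l// n2_UB.
Qed.

(** The k-th derivative is defined on the Hartley side, where it is in
    L2 because both the multiplier and its product with p^4 are bounded. *)
Lemma Sol_deriv k f : (k <= 4)%N -> L2 f ->
  exists w, [/\ L2 w, weak_der k (Sol f) w & aeq (U w) (iter k D (Mult (U f)))].
Proof.
move=> k4 Lf; have LM := (Mult_energy (L2_U Lf)).1.
have L4 := L2_Mult4 (L2_U Lf).
have Lk := L2_iterD k4 LM L4.
exists (U (iter k D (Mult (U f)))).
have Lw := L2_U Lk.
have Uw := U_invol Lk.
split => //; apply: weak_der_of_Hartley => //; first exact: L2_Sol.
by apply: aeq_trans Uw _; apply: aeq_iterD; apply: aeq_sym; exact: U_Sol.
Qed.

(** The equation is checked on the Hartley side, where it says that the symbol
    times the multiplier is sqrt(2 pi) times the transform of G, for p <> 0. *)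
Lemma Sol_solves f : L2 f -> exists u1 u4, [/\ L2 u1, L2 u4, weak_der 1 (Sol f) u1,
  weak_der 4 (Sol f) u4 &
  AE (fun x => u4 x - b * u1 x - a * Sol f x = convol G f x)].
Proof.
move=> Lf.
have [u1 [L1u W1 E1]] := @Sol_deriv 1 f isT Lf.
have [u4 [L4u W4 E4]] := @Sol_deriv 4 f isT Lf.
exists u1, u4; split => //.
have LT := L2_Sol Lf.
have [_ Lc _] := convol_L2 IG Lf.
have Lb := L2Z b L1u; have La := L2Z a LT.
have L2' := L2B L4u Lb.
have L3 := L2B L2' La.
have L5 := L2B L3 Lc.
have : aeq (fun x => u4 x - b * u1 x - a * Sol f x - convol G f x) (fun=> 0).
  apply: U_eq0 => //.
  have e1 := UB L3 Lc; have e2 := UB L2' La; have e3 := UB L4u Lb.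
  have e4 := UZ b L1u; have e5 := UZ a LT; have e6 := U_convol IG Lf.
  have e7 := U_Sol Lf.
  have e123 : AE (fun p => U (fun x => u4 x - b * u1 x - a * Sol f x - convol G f x) p =
     U u4 p - U (fun x => b * u1 x) p - U (fun x => a * Sol f x) p - U (convol G f) p).
    by apply: AE3 e1 e2 e3 => p -> -> ->.
  have e45 : AE (fun p => U (fun x => u4 x - b * u1 x - a * Sol f x - convol G f x) p =
     U u4 p - b * U u1 p - a * U (Sol f) p - U (convol G f) p).
    by apply: AE3 e123 e4 e5 => p -> -> ->.
  have e67 : AE (fun p => U (fun x => u4 x - b * u1 x - a * Sol f x - convol G f x) p =
     U u4 p - b * U u1 p - a * Mult (U f) p - multG G (U f) p).
    by apply: AE3 e45 e6 e7 => p -> -> ->.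
  have e8 : AE (fun p => U (fun x => u4 x - b * u1 x - a * Sol f x - convol G f x) p =
     iter 4 D (Mult (U f)) p - b * iter 1 D (Mult (U f)) p - a * Mult (U f) p - multG G (U f) p).
    by apply: AE3 e67 E4 E1 => p -> -> ->.
  apply: AE2 e8 (AE_neq 0) => p -> p0.
  have Q0 := symQ_gt0 p0; have Qn : symQ p != 0 by rewrite gt_eqF.
  have A4 : symA (- p) = symA p by rewrite /symA; ring.
  rewrite /= /D /Mult /multG /mult !opprK !malpha_even !mbeta_odd.
  set u := U f p; set v := U f (- p).
  rewrite /malpha /mbeta.
  rewrite /symQ /symA /symB in Qn *; field; exact: Qn.
exact: aeq_sub0.
Qed.

Lemma wdB k u w u' w' : L2 u -> L2 w -> L2 u' -> L2 w' -> weak_der k u w -> weak_der k u' w' ->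
  weak_der k (fun x => u x - u' x) (fun x => w x - w' x).
Proof.
move=> Lu Lw Lu' Lw' h h' phi tp.
have Lk := (tf_L12 (tf_derive1n k tp)).2; have L0 := (tf_L12 tp).2.
rewrite -[LHS]/(ip (fun x => u x - u' x) (derive1n k phi)).
rewrite -[X in _ * X]/(ip (fun x => w x - w' x) phi).
by rewrite !ipBl// mulrBr; congr (_ - _); [exact: h|exact: h'].
Qed.

Lemma Sol_unique f u u1 u4 : L2 f -> L2 u -> L2 u1 -> L2 u4 -> weak_der 1 u u1 -> weak_der 4 u u4 ->
  AE (fun x => u4 x - b * u1 x - a * u x = convol G f x) -> aeq u (Sol f).
Proof.
move=> Lf Lu Lu1 Lu4 W1 W4 E.
have [v1 [v4 [Lv1 Lv4 V1 V4 EV]]] := Sol_solves Lf.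
have LT := L2_Sol Lf.
have : aeq (fun x => u x - Sol f x) (fun=> 0).
  apply: (@weak_der_unique R a b _ (fun x => u1 x - v1 x) (fun x => u4 x - v4 x)) => //.
  - exact: L2B.
  - exact: L2B.
  - exact: L2B.
  - exact: wdB.
  - exact: wdB.
  - apply: AE2 E EV => x e1 e2.
    transitivity ((u4 x - b * u1 x - a * u x) - (v4 x - b * v1 x - a * Sol f x)); first by ring.
    by rewrite e1 e2 subrr.
exact: aeq_sub0.
Qed.

(** The 2 x 2 system that expresses (alpha + i beta) f^ = 0 at p and -p has
    determinant [msq]. *)
Lemma Sol_zero f : L2 f -> aeq (Sol f) (fun=> 0) ->
  AE (fun p => FC G p ^+ 2 + FS G p ^+ 2 != 0 -> U f p = 0).
Proof.
move=> Lf T0; have LT := L2_Sol Lf.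
have z : aeq (Mult (U f)) (fun=> 0).
  apply: aeq_trans (aeq_sym (U_Sol Lf)) _.
  by apply: aeq_trans (U_ae LT (@L2_0 R) T0) (@U_0 R).
apply: AE3 z (AE_opp z) (AE_neq 0) => p e1 e2 p0 cs0.
have Q0 := symQ_gt0 p0.
move: e1 e2; rewrite /Mult /mult opprK malpha_even mbeta_odd.
set al := malpha p; set be := mbeta p; set u := U f p; set v := U f (- p) => e1 e2.
have : (al ^+ 2 + be ^+ 2) * u = 0.
  transitivity (al * (al * u - be * v) - - be * (al * v - - be * u)); first by ring.
  by rewrite e1 e2; ring.
rewrite m_sqr /msq => /eqP; rewrite !mulf_eq0 invr_eq0 (negbTE cs0) (gt_eqF Q0) /=.
by move=> /eqP.
Qed.

End solution_operator.

(** * Lebesgue measurable functions and their Borel versions *)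

Section transfer.
Context {R : realType}.
Local Notation mu := (@lebesgue_measure R).
Local Notation lebR := (@completed_lebesgue_measure R).
Local Notation T := (lebT R).
Implicit Types f g h : R -> R.

Lemma Borel_leb (A : set (measurableTypeR R)) : measurable A -> measurable (A : set T).
Proof. exact: sub_caratheodory. Qed.

(** A set of the completion is a Borel set up to a subset of a Borel null set. *)
Lemma leb_version (E : set R) : measurable (E : set T) ->
  exists2 B : set (measurableTypeR R), measurable B & AE (fun x => B x <-> E x).
Proof.
move=> mE.
have : (completed_algebra_gen mu).-sigma.-measurable E.
  by rewrite completed_caratheodory_measurable.
rewrite g_sigma_completed_algebra_genE => -[B mB [N [N' [mN' N0 NN']] <-]].
exists B => //; exists N'; split => // x /= h; apply: NN'.
apply: contrapT => nN; apply: h; split; first by left.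
by case.
Qed.

Lemma AE_leb (P : R -> Prop) : AE P -> {ae lebR, forall x, P x}.
Proof. by move=> [N [mN N0 PN]]; exists N; split => //; exact: Borel_leb. Qed.

Lemma leb_AE (P : R -> Prop) : {ae lebR, forall x, P x} -> AE P.
Proof.
move=> [N [mN N0 PN]].
have : (completed_algebra_gen mu).-sigma.-measurable N.
  by rewrite completed_caratheodory_measurable.
rewrite g_sigma_completed_algebra_genE => -[B mB [Z [Z' [mZ' Z0 ZZ']] E]].
have B0 : mu B = 0.
  apply/eqP; rewrite eq_le measure_ge0 andbT -N0.
  by apply: (@le_outer_measure _ _ ((wlength (R := R) idfun)^*)%mu); rewrite -E; exact: subsetUl.
exists (B `|` Z'); split.
- exact: measurableU.
- by apply: null_set_setU.
- move=> x /PN; rewrite -E => -[Bx|Zx]; [by left|right; exact: ZZ'].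
Qed.

Lemma meas_leb f : measurable_fun [set: R] f -> measurable_fun [set: T] (f : T -> R).
Proof.
move=> mf _ Y mY; rewrite setTI; apply: Borel_leb.
by rewrite -[X in measurable X]setTI; exact: mf.
Qed.

Lemma meas_idT : measurable_fun [set: T] (fun x : T => x : measurableTypeR R).
Proof. by move=> _ Y mY; rewrite setTI; exact: Borel_leb. Qed.

(** [mu] is the image of the completed measure under the identity map. *)
Lemma eint_leb (f : R -> \bar R) : measurable_fun [set: R] f ->
  (forall x, (0 <= f x)%E) -> (\int[lebR]_x f x = \int[mu]_x f x)%E.
Proof.
move=> mf f0.
rewrite -[LHS](@ge0_integral_pushforward _ _ T (measurableTypeR R) R
  (fun x => x) meas_idT lebR setT f)//.
Qed.

Lemma L1_leb f : measurable_fun [set: R] f ->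
  lebR.-integrable setT (EFin \o (f : T -> R)) -> L1 f.
Proof.
move=> mf /integrableP[_ fi]; apply/integrableP; split; first exact/measurable_EFinP.
move: fi; rewrite (@eint_leb (fun x => `|(f x)%:E|%E))//.
by apply: measurableT_comp => //; apply/measurable_EFinP.
Qed.

Lemma Rint_leb f : L1 f -> \int[lebR]_x f x = \int[mu]_x f x.
Proof.
move=> If; congr fine; have mf := L1_meas If.
have mE : measurable_fun [set: R] (EFin \o f) by apply/measurable_EFinP.
rewrite [LHS]integralE [RHS]integralE; congr (_ - _)%E.
- rewrite -(@eint_leb (EFin \o f)^\+%E)//; first exact: (measurable_funepos mE).
- rewrite -(@eint_leb (EFin \o f)^\-%E)//; first exact: (measurable_funeneg mE).
Qed.

(** This uses completeness of the measure. *)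
Lemma leb_measurable_ae f g : measurable_fun [set: T] (f : T -> R) -> aeq f g ->
  measurable_fun [set: T] (g : T -> R).
Proof.
move=> mf fg; apply/measurable_EFinP.
apply: (@ae_measurable_fun _ T R lebR completed_lebesgue_measure_is_complete setT (EFin \o f)).
  by apply: AE_leb; move: fg; apply: AE1 => x /= ->.
by apply/measurable_EFinP.
Qed.

Lemma Rint_leb_ae f g : L1 g -> aeq f g -> \int[lebR]_x f x = \int[mu]_x g x.
Proof.
move=> Ig fg; rewrite -Rint_leb//; congr fine.
have mg := meas_leb (L1_meas Ig).
have m1 : measurable_fun [set: T] (EFin \o (f : T -> R)).
  by apply/measurable_EFinP; exact: leb_measurable_ae mg (aeq_sym fg).
have m2 : measurable_fun [set: T] (EFin \o (g : T -> R)) by apply/measurable_EFinP.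
apply: (@ae_eq_integral _ T R lebR setT _ _ measurableT m1 m2).
by apply: AE_leb; move: fg; apply: AE1 => x /= ->.
Qed.

(** f is the supremum of the rationals q with q < f, and each of the countably
    many sets q < f has a Borel version. *)
Lemma Borel_version f : measurable_fun [set: T] (f : T -> R) ->
  exists2 g, measurable_fun [set: R] g & aeq f g.
Proof.
move=> mf.
pose q (n : nat) : R := ratr (odflt 0%Q (unpickle n)).
have mE n : measurable ([set x | q n < f x] : set T).
  rewrite (_ : mkset _ = setT `&` (f : T -> R) @^-1` `]q n, +oo[%classic).
    by apply: mf => //; exact: measurable_itv.
  by rewrite setTI; apply/seteqP; split => x /=; rewrite in_itv/= andbT.
pose B n := sval (cid2 (leb_version (mE n))).
have mB n : measurable (B n : set (measurableTypeR R)) by rewrite /B; case: cid2.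
have BE n : AE (fun x => B n x <-> q n < f x) by rewrite /B; case: cid2.
pose h n (x : R) : \bar R := if x \in B n then (q n)%:E else -oo%E.
have mh n : measurable_fun [set: R] (h n).
  apply: measurable_fun_ifT => //.
  apply: (@measurable_fun_bool _ (measurableTypeR R) _ _ true); rewrite setTI.
  rewrite (_ : _ @^-1` _ = B n)//.
  by apply/seteqP; split => x /=; [move/set_mem|move/mem_set].
pose g x := fine (esups (h ^~ x) 0%N).
exists g.
  by apply: measurableT_comp => //; exact: measurable_fun_esups.
move: (AE_all BE); apply: AE1 => x Bx.
suff : esups (h ^~ x) 0%N = (f x)%:E by rewrite /g => ->.
apply/eqP; rewrite eq_le; apply/andP; split.
  apply: ge_ereal_sup => _ [n _ <-] /=; rewrite /h; case: ifPn => xB; last exact: leNye.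
  by rewrite lee_fin ltW//; apply/Bx/set_mem.
apply/lee_subgt0Pr => e e0.
have xe : f x - e < f x by lra.
have [r] := rat_in_itvoo xe; rewrite in_itv/= => /andP[r1 r2].
apply: (@le_trans _ _ (h (pickle r) x)).
  have qr : q (pickle r) = ratr r by rewrite /q pickleK.
  have hE : h (pickle r) x = (ratr r)%:E.
    by rewrite /h mem_set ?qr//; apply/Bx; rewrite qr.
  by rewrite hE -EFinB lee_fin ltW.
by apply: ereal_sup_ubound; exists (pickle r).
Qed.

Lemma inL2_version f : inL2 f -> exists2 g, L2 g & aeq f g.
Proof.
move=> Lf; have If := Lfun2_integrable_sqr Lf.
have mf : measurable_fun [set: T] (f : T -> R).
  by move: Lf; rewrite /inL2 inE => /andP[+ _]; rewrite inE.
have [g mg fg] := Borel_version mf.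
exists g => //; split => //; apply: L1_leb; first exact: measurable_funX.
have mg2 : measurable_fun [set: T] (fun x : T => (g x ^+ 2)%:E).
  by apply/measurable_EFinP; apply: measurable_funX; exact: meas_leb.
apply/integrableP; split; first exact: mg2.
have [mf2 ] := integrableP _ _ _ If; congr (_ < _)%E.
apply: (@ae_eq_integral _ T R lebR setT _ _ measurableT); try exact: measurableT_comp.
by apply: AE_leb; move: fg; apply: AE1 => x /= ->.
Qed.

Lemma inL1_version f : inL1 f -> exists2 g, L1 g & aeq f g.
Proof.
move=> /Lfun1_integrable If.
have mf : measurable_fun [set: T] (f : T -> R).
  by apply/measurable_EFinP; exact: (measurable_int _ If).
have [g mg fg] := Borel_version mf.
exists g => //; apply: L1_leb => //.
have mg2 : measurable_fun [set: T] (fun x : T => (g x)%:E).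
  by apply/measurable_EFinP; exact: meas_leb.
apply/integrableP; split; first exact: mg2.
have [mf2 ] := integrableP _ _ _ If; congr (_ < _)%E.
apply: (@ae_eq_integral _ T R lebR setT _ _ measurableT); try exact: measurableT_comp.
by apply: AE_leb; move: fg; apply: AE1 => x /= ->.
Qed.

Lemma Lnorm2_sqr (f : T -> R) : measurable_fun [set: T] f ->
  ('N[lebR]_2%:E[EFin \o f] = (\int[lebR]_x (f x ^+ 2)%:E) `^ 2^-1)%E.
Proof.
move=> mf; rewrite unlock; congr (_ `^ _)%E; apply: eq_integral => x _ /=.
by rewrite powR_mulrn// real_normK// num_real.
Qed.

Lemma L2_inL2 f : L2 f -> inL2 f.
Proof.
move=> Lf; have mf := meas_leb (L2_meas Lf); rewrite /inL2 inE; apply/andP; split.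
  by rewrite inE.
rewrite inE /= /finite_norm Lnorm2_sqr//.
rewrite (@eint_leb (fun x => (f x ^+ 2)%:E)).
- by rewrite -EFin_Rint ?poweR_EFin ?ltry//; exact: L2_sq.
- by apply/measurable_EFinP; apply: measurable_funX; exact: L2_meas.
- by move=> x; rewrite lee_fin sqr_ge0.
Qed.

End transfer.

(** * The complex Fourier transform and the constant N *)

Section fourier_facts.
Context {R : realType}.
Local Notation mu := (@lebesgue_measure R).
Local Notation lebR := (@completed_lebesgue_measure R).
Local Notation T := (lebT R).
Implicit Types f g h G : R -> R.

Lemma cmod_sqr (z : R[i]) : cmod z ^+ 2 = complex.Re z ^+ 2 + complex.Im z ^+ 2.
Proof. by case: z => x y; rewrite /cmod /= sqr_sqrtr// addr_ge0 ?sqr_ge0. Qed.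

Lemma cmod_ge0 (z : R[i]) : 0 <= cmod z.
Proof. by case: z => x y; exact: sqrtr_ge0. Qed.

Lemma cmodM (x y : R[i]) : cmod (x * y) = cmod x * cmod y.
Proof. exact: ComplexField.Normc.normcM. Qed.

Lemma cmodV (x : R[i]) : cmod x^-1 = (cmod x)^-1.
Proof. exact: ComplexField.Normc.normcV. Qed.

Lemma fourier_Borel f g p : L1 g -> aeq f g ->
  fourier f p = ((c0 * FC g p) -i* (c0 * FS g p))%C.
Proof.
move=> Ig fg.
have E1 : \int[lebR]_x (f x * cos (p * x)) = FC g p.
  by apply: Rint_leb_ae; [exact: L1_cos|move: fg; apply: AE1 => x ->].
have E2 : \int[lebR]_x (f x * sin (p * x)) = FS g p.
  by apply: Rint_leb_ae; [exact: L1_sin|move: fg; apply: AE1 => x ->].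
rewrite /fourier E1 E2 -/c0; apply/eqP; rewrite eq_complex /=.
by rewrite !mul0r subr0 addr0 mulrN !eqxx.
Qed.

Lemma cmod_fourier_sqr f g p : L1 g -> aeq f g ->
  cmod (fourier f p) ^+ 2 = c0 ^+ 2 * (FC g p ^+ 2 + FS g p ^+ 2).
Proof. by move=> Ig fg; rewrite cmod_sqr (fourier_Borel p Ig fg) /=; ring. Qed.

Lemma cmod_symbol_sqr (a b p : R) : cmod (symbol a b p) ^+ 2 = symQ a b p.
Proof. by rewrite cmod_sqr /symbol /= sqrrN. Qed.

Lemma cmod_real (x : R) : cmod (x%:C)%C = `|x|.
Proof. by rewrite /cmod /= expr0n addr0 sqrtr_sqr. Qed.

Lemma cmod_quot_sqr f g a b p : L1 g -> aeq f g ->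
  cmod (fourier f p / symbol a b p) ^+ 2 = c0 ^+ 2 * msq g a b p.
Proof.
move=> Ig fg; rewrite cmodM cmodV exprMn exprVn cmod_symbol_sqr.
by rewrite (cmod_fourier_sqr p Ig fg) mulrA.
Qed.

Lemma cmod_quot4_sqr f g a b p : L1 g -> aeq f g ->
  cmod ((p ^+ 4)%:C%C * fourier f p / symbol a b p) ^+ 2 =
  c0 ^+ 2 * (p ^+ 8 * msq g a b p).
Proof.
move=> Ig fg; rewrite -mulrA cmodM exprMn (cmod_quot_sqr a b p Ig fg) cmod_real.
by rewrite real_normK ?num_real//; ring.
Qed.

Lemma lebT_gt0 : (0 < lebR [set: R])%E.
Proof.
apply: (@lt_le_trans _ _ (mu `]0, 1[%classic)).
  by rewrite lebesgue_measure_itv/= lte_fin ltr01 oppr0 adde0 lte_fin.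
exact: (@le_outer_measure _ _ ((wlength (R := R) idfun)^*)%mu).
Qed.

Lemma Lnormy_le (f : R -> R) (n : R) :
  ('N[lebR]_+oo[(fun p : R => (f p)%:E)] <= n%:E)%E -> (forall p, 0 <= f p) ->
  AE (fun p => f p <= n).
Proof.
rewrite unlock lebT_gt0 => /ess_supP H f0; apply: leb_AE.
have := leb_AE H => /(@AE1 R _ (fun p => f p <= n)) h.
apply: AE_leb; apply: h => p /=; rewrite lee_fin; exact: le_trans (ler_norm _).
Qed.

(** The essential bounds of N, squared and multiplied by 2 pi: the factor
    c0^2 = 1 / (2 pi) is the normalization of the Fourier transform. *)
Lemma N_ab_bounds G g (a b n : R) : L1 g -> aeq G g -> 0 <= n ->
  (N_ab G a b <= n%:E)%E ->
  AE (fun p => msq g a b p <= 2 * pi * n ^+ 2) /\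
  AE (fun p => p ^+ 8 * msq g a b p <= 2 * pi * n ^+ 2).
Proof.
move=> Ig gG n0; rewrite /N_ab ge_max => /andP[/Lnormy_le h1 /Lnormy_le h2].
have key (x y : R) : 0 <= x -> x <= n -> x ^+ 2 = c0 ^+ 2 * y -> y <= 2 * pi * n ^+ 2.
  move=> x0 xn E.
  have : x ^+ 2 <= n ^+ 2 by rewrite ler_sqr ?nnegrE.
  rewrite E -(ler_pM2l (@twopi_gt0 R)) mulrA [_ * c0 ^+ 2]mulrC c0_sqr mul1r.
  exact.
split.
- move: (h1 (fun p => cmod_ge0 _)); apply: AE1 => p H.
  exact: key (cmod_ge0 _) H (cmod_quot_sqr a b p Ig gG).
- move: (h2 (fun p => cmod_ge0 _)); apply: AE1 => p H.
  exact: key (cmod_ge0 _) H (cmod_quot4_sqr a b p Ig gG).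
Qed.

Lemma N_ab_ge0 G a b : (0 <= N_ab G a b)%E.
Proof. by rewrite /N_ab le_max Lnorm_ge0. Qed.

End fourier_facts.

(** * The nonlinearity *)

Section nemytskii.
Context {R : realType}.
Local Notation mu := (@lebesgue_measure R).
Local Notation lebR := (@completed_lebesgue_measure R).
Local Notation T := (lebT R).
Implicit Types f g h v w : R -> R.

(** Discretize: for u constant on the measurable sets floor (v (n+1)) = z the
    claim is clear, and the Lipschitz bound makes F(u_n(y), y) converge to
    F(v(y), y). *)
Lemma meas_Nem (F : R -> R -> R) (l : R) v :
  (forall u : R, measurable_fun [set: T] (F u : T -> R)) ->
  (forall u1 u2 x : R, `|F u1 x - F u2 x| <= l * `|u1 - u2|) ->
  measurable_fun [set: T] (v : T -> R) ->
  measurable_fun [set: T] (fun y : T => F (v y) y).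
Proof.
move=> mF lF mv.
pose r (n : nat) (z : int) : R := z%:~R / n.+1%:R.
pose fl (n : nat) (y : R) : int := Num.floor (v y * n.+1%:R).
have n0 n : 0 < n.+1%:R :> R by rewrite ltr0n.
have flE n y : (fl n y)%:~R <= v y * n.+1%:R < (fl n y + 1)%:~R.
  by rewrite floor_itv.
apply: (@measurable_fun_cvg _ T R setT (fun n (y : R) => F (r n (fl n y)) y)); last first.
  move=> y _; apply/cvgrPdist_le => e e0.
  have : (l / n.+1%:R) @[n --> \oo] --> (0 : R).
    by rewrite -(mulr0 l); apply: cvgM; [exact: cvg_cst|exact: cvg_harmonic].
  move=> /cvgrPdist_le/(_ _ e0); apply: filterS => n; rewrite sub0r normrN => hn.
  apply: (le_trans (lF _ _ _)); apply: le_trans hn.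
  apply: le_trans (ler_norm _).
  have l0 : 0 <= l.
    by have := lF 1 0 0; rewrite subr0 normr1 mulr1; apply: le_trans.
  rewrite ler_wpM2l// /r.
  have /andP[h1 h2] := flE n y.
  rewrite -(ler_pM2r (n0 n)) mulVf ?gt_eqF//.
  rewrite -{2}(ger0_norm (ltW (n0 n))) -normrM mulrBl divfK ?gt_eqF//.
  rewrite ger0_norm ?subr_ge0//.
  by move: h2; rewrite intrD; lra.
move=> n _ B mB; rewrite setTI.
rewrite (_ : _ @^-1` B = \bigcup_(z : int)
  ([set y | fl n y = z] `&` (F (r n z) : T -> R) @^-1` B)); last first.
  apply/seteqP; split => [y By|y [z _ [/= <-]]//].
  by exists (fl n y).
apply: countable_bigcupT_measurable => // z.
apply: measurableI; last by rewrite -[X in measurable X]setTI; exact: mF.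
rewrite (_ : mkset _ = setT `&` (v : T -> R) @^-1` `[r n z, r n (z + 1)[%classic).
  by apply: mv => //; exact: measurable_itv.
rewrite setTI; apply/seteqP; split => y /=; rewrite in_itv/= /r.
  move=> <-; have /andP[h1 h2] := flE n y.
  by rewrite ler_pdivrMr// ltr_pdivlMr// h1 h2.
rewrite ler_pdivrMr// ltr_pdivlMr// => h.
exact: floor_def.
Qed.

Lemma Nem_version (F : R -> R -> R) (k l : R) h v : assumptionA F k l h -> inL2 v ->
  exists2 f, L2 f & aeq (fun y => F (v y) y) f.
Proof.
move=> [mF _ [k0 l0 Lh h0] Fb Fl] Lv.
have mv : measurable_fun [set: T] (v : T -> R).
  by move: Lv; rewrite /inL2 inE => /andP[+ _]; rewrite inE.
have [f mf ff] := Borel_version (meas_Nem mF Fl mv).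
have [v' Lv' vv'] := inL2_version Lv.
have [h' Lh' hh'] := inL2_version Lh.
exists f => //.
have La : L2 (fun y => `|v' y|).
  by apply: (L2_le _ Lv'); [apply: measurableT_comp => //; exact: L2_meas|move=> y; rewrite normr_id].
have Lb : L2 (fun y => k * `|v' y| + h' y) by apply: L2D => //; exact: L2Z.
apply: (L2_le_ae mf Lb ler01 _).1.
apply: AE3 ff vv' hh' => y e1 e2 e3.
rewrite mul1r -e1 -e2 -e3 -real_normK ?num_real// ler_sqr ?nnegrE//.
by rewrite addr_ge0// mulr_ge0// ltW.
Qed.

Lemma Nem_lip (F : R -> R -> R) (l : R) v1 v2 w1 w2 f1 f2 :
  (forall u1 u2 x : R, `|F u1 x - F u2 x| <= l * `|u1 - u2|) ->
  L2 w1 -> L2 w2 -> L2 f1 -> L2 f2 -> aeq v1 w1 -> aeq v2 w2 ->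
  aeq (fun y => F (v1 y) y) f1 -> aeq (fun y => F (v2 y) y) f2 ->
  n2 (fun x => f1 x - f2 x) <= l ^+ 2 * n2 (fun x => w1 x - w2 x).
Proof.
move=> Fl Lw1 Lw2 Lf1 Lf2 vw1 vw2 Ff1 Ff2.
apply: (L2_le_ae _ (L2B Lw1 Lw2) (sqr_ge0 l) _).2.
  by apply: L2_meas; exact: L2B.
have H1 : AE (fun y => w1 y = v1 y /\ w2 y = v2 y) by apply: AE2 vw1 vw2 => y -> ->.
apply: AE3 Ff1 Ff2 H1 => y <- <- [-> ->].
rewrite -exprMn -[leLHS]real_normK ?num_real// -[leRHS]real_normK ?num_real//.
rewrite ler_sqr ?nnegrE// normrM.
have l0 : 0 <= l.
  by have := Fl 1 0 0; rewrite subr0 normr1 mulr1; apply: le_trans.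
by rewrite (ger0_norm l0).
Qed.

Lemma weak_derivative_versions k (u w u' w' : R -> R) : L2 u' -> L2 w' -> aeq u u' -> aeq w w' ->
  weak_derivative k u w <-> weak_der k u' w'.
Proof.
move=> Lu Lw uu ww.
have E phi : test_function phi ->
    \int[lebR]_x (u x * derive1n k phi x) = \int[mu]_x (u' x * derive1n k phi x) /\
    \int[lebR]_x (w x * phi x) = \int[mu]_x (w' x * phi x).
  move=> tp; have Lk := (tf_L12 (tf_derive1n k tp)).2; have L0 := (tf_L12 tp).2.
  split; apply: Rint_leb_ae.
  - exact: L2_mul.
  - by move: uu; apply: AE1 => x ->.
  - exact: L2_mul.
  - by move: ww; apply: AE1 => x ->.
split=> H phi tp; have [E1 E2] := E phi tp.
- by rewrite -E1 -E2; exact: H.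
- by rewrite E1 E2; exact: H.
Qed.

Lemma nonlocal_convol G F v G' f : L1 G' -> aeq G G' -> L2 f ->
  aeq (fun y => F (v y) y) f ->
  AE (fun x => nonlocal_term G F v x = convol G' f x).
Proof.
move=> IG GG Lf Ff; have [a1 _ _] := convol_L2 IG Lf.
move: a1; apply: AE1 => x Ix; rewrite /nonlocal_term /convol.
apply: Rint_leb_ae => //.
by apply: AE2 (AE_refl x GG) Ff => y -> ->.
Qed.

End nemytskii.

(** * Fixed points and the L2 Fourier transform *)

Section fourier_L2_facts.
Context {R : realType}.
Local Notation mu := (@lebesgue_measure R).
Local Notation lebR := (@completed_lebesgue_measure R).
Local Notation T := (lebT R).
Implicit Types f g w : R -> R.

(** Banach's iteration, started at 0.  The rate s = (q + 1) / 2 is used instead of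
    q because [L2_complete] requires a positive one. *)
Lemma contraction_fixpoint (Psi : (R -> R) -> R -> R) (q : R) : 0 <= q < 1 ->
  (forall w, L2 w -> L2 (Psi w)) ->
  (forall w w', L2 w -> L2 w' ->
    n2 (fun x => Psi w x - Psi w' x) <= q * n2 (fun x => w x - w' x)) ->
  exists2 w, L2 w & aeq (Psi w) w.
Proof.
move=> /andP[q0 q1] LP contr.
pose s := (q + 1) / 2.
have s0 : 0 < s by rewrite /s; lra.
have s1 : s < 1 by rewrite /s; lra.
have qs : q <= s by rewrite /s; lra.
pose w (n : nat) := iter n Psi (fun=> 0 : R).
have Lw n : L2 (w n) by elim: n => [|n IH]; [exact: L2_0|exact: LP].
pose C := n2 (fun x => w 1%N x - w 0%N x).
have C0 : 0 <= C by exact: n2_ge0.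
have inc n : n2 (fun x => w n.+1 x - w n x) <= C * s ^+ n.
  elim: n => [|n IH]; first by rewrite expr0 mulr1.
  apply: (@le_trans _ _ (q * n2 (fun x => w n.+1 x - w n x))); first exact: (contr _ _ (Lw n.+1) (Lw n)).
  apply: (@le_trans _ _ (s * (C * s ^+ n))); last by rewrite exprS mulrCA.
  by apply: ler_pM => //; exact: n2_ge0.
have s01 : 0 < s < 1 by rewrite s0.
have [g Lg wg] := L2_complete C0 s01 Lw inc.
exists g => //.
have LPg := LP _ Lg.
apply: (@lim2_unique _ (fun n => w n.+1)) => //.
- apply: (@lim2_le _ _ _ _ q wg) => n; exact: (contr _ _ (Lw n) Lg).
- by rewrite /lim2; move: wg; rewrite -(cvg_shiftS (fun n => n2 (fun x => w n x - g x))).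
Qed.

Lemma lim2_opp (fn : nat -> R -> R) f : (forall n, L2 (fn n)) -> L2 f -> lim2 fn f ->
  lim2 (fun n p => fn n (- p)) (fun p => f (- p)).
Proof.
move=> Ln Lf H; apply: (@lim2_le _ _ _ _ 1 H) => n; rewrite mul1r.
rewrite -(n2_refl 0 (L2B (Ln n) Lf)).
by rewrite le_eqVlt; apply/orP; left; apply/eqP; congr n2; apply/funext => x; rewrite sub0r.
Qed.

Lemma Hart_FC_FS g p : L1 g -> Hart g p = c0 * FC g p + c0 * FS g p.
Proof.
move=> Ig; rewrite -mulrDr /Hart /FC /FS -RintD; [|exact: L1_cos|exact: L1_sin].
by congr (_ * _); apply: eq_Rintegral => x _; rewrite /cas mulrDr.
Qed.

(** The Fourier transform of a truncation has as real and imaginary parts the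
    even part C and minus the odd part, S, of its Hartley transform.  These
    converge in L2 to the corresponding parts of [U f], and by hypothesis also to
    the real and imaginary parts of [F0hat]. *)
Lemma fourier_L2_Hartley f f0 (F0hat : R -> R[i]) : L2 f -> aeq f0 f ->
  fourier_L2 f0 F0hat ->
  AE (fun p => complex.Re (F0hat p) = 2^-1 * (U f p + U f (- p)) /\
               complex.Im (F0hat p) = - 2^-1 * (U f p - U f (- p))).
Proof.
move=> Lf ff [/inL2_version[r Lr rr] /inL2_version[i Li ii] lim].
have LU := L2_U Lf.
pose H n := Hart (trunc n f).
have I12 n := L12_trunc n Lf.
have It n : L1 (trunc n f) by case: (I12 n).
have LH n : L2 (H n) by exact: L2_Hart.
have limH : lim2 H (U f) by case: (U_specP Lf).
have limHo := lim2_opp LH LU limH.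
have LHo n := L2_opp (LH n); have LUo := L2_opp LU.
pose C n p := 2^-1 * (H n p + H n (- p)).
pose S n p := - 2^-1 * (H n p - H n (- p)).
have LC n : L2 (C n) by apply: L2Z; exact: L2D.
have LS n : L2 (S n) by apply: L2Z; exact: L2B.
have limC : lim2 C (fun p => 2^-1 * (U f p + U f (- p))).
  apply: lim2Z; [by move=> n; exact: L2D|exact: L2D|].
  exact: lim2D.
have limS : lim2 S (fun p => - 2^-1 * (U f p - U f (- p))).
  apply: lim2Z; [by move=> n; exact: L2B|exact: L2B|].
  exact: lim2B.
have HC n p : c0 * FC (trunc n f) p = C n p.
  by rewrite /C /H !Hart_FC_FS// FC_even FS_odd//; field.
have HS n p : - (c0 * FS (trunc n f) p) = S n p.
  by rewrite /S /H !Hart_FC_FS// FC_even FS_odd//; field.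
pose A n := n2 (fun p => C n p - r p) + n2 (fun p => S n p - i p).
have A0 n : 0 <= A n by rewrite addr_ge0 ?n2_ge0.
have norm n : ('N[lebR]_2%:E[(fun p : R =>
    (cmod (fourier (fun x => f0 x * \1_`[- n%:R, n%:R] x) p - F0hat p))%:E)] =
    (Num.sqrt (A n))%:E)%E.
  have tr : aeq (fun x => f0 x * \1_`[- n%:R, n%:R] x) (trunc n f).
    by move: ff; apply: AE1 => x; rewrite /trunc => ->.
  pose B p := (C n p - r p) ^+ 2 + (S n p - i p) ^+ 2.
  have LCr := L2B (LC n) Lr; have LSi := L2B (LS n) Li.
  have IB : L1 B by apply: L1D; exact: L2_sq.
  have E2 : aeq (fun p =>
      cmod (fourier (fun x => f0 x * \1_`[- n%:R, n%:R] x) p - F0hat p) ^+ 2) B.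
    apply: AE2 rr ii => p e1 e2.
    rewrite cmod_sqr (fourier_Borel p (It n) tr).
    by rewrite /B -e1 -e2 -HC -HS; case: (F0hat p) => x y.
  have mc : measurable_fun [set: T] (fun p : T =>
      cmod (fourier (fun x => f0 x * \1_`[- n%:R, n%:R] x) p - F0hat p)).
    have mB : measurable_fun [set: R] (fun p => Num.sqrt (B p)).
      exact: (measurableT_comp (cont_meas (@sqrt_continuous R)) (L1_meas IB)).
    apply: (leb_measurable_ae (meas_leb mB)).
    by move: E2; apply: AE1 => p <-; rewrite sqrtr_sqr ger0_norm// cmod_ge0.
  rewrite (Lnorm2_sqr mc).
  have -> : (\int[lebR]_x
      (cmod (fourier (fun x => f0 x * \1_`[- n%:R, n%:R] x) x - F0hat x) ^+ 2)%:E = (A n)%:E)%E.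
    transitivity (\int[lebR]_x (B x)%:E)%E.
      apply: ae_eq_integral.
      - exact: measurableT.
      - by apply/measurable_EFinP; exact: measurable_funX.
      - by apply/measurable_EFinP; exact: meas_leb (L1_meas IB).
      - by apply: AE_leb; move: E2; apply: AE1 => x /= ->.
    rewrite eint_leb; last by move=> x; rewrite lee_fin addr_ge0 ?sqr_ge0.
      rewrite -EFin_Rint// RintD//; exact: L2_sq.
    by apply/measurable_EFinP; exact: L1_meas.
  by rewrite poweR_EFin powR12_sqrt.
have limA : A n @[n --> \oo] --> 0.
  have sq : Num.sqrt (A n) @[n --> \oo] --> (0 : R).
    have : (Num.sqrt (A n))%:E @[n --> \oo] --> (0 : R)%:E.
      by move: lim; apply: cvg_trans; apply: near_eq_cvg; apply: nearW => n; rewrite norm.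
    exact: fine_cvg.
  have -> : A = (fun n => Num.sqrt (A n) * Num.sqrt (A n)).
    by apply/funext => n; rewrite -expr2 sqr_sqrtr.
  by rewrite -(mulr0 (0 : R)); exact: cvgM.
have limCr : lim2 C r.
  by apply: (@lim2_le _ _ _ _ 1 limA) => n; rewrite mul1r lerDl n2_ge0.
have limSi : lim2 S i.
  by apply: (@lim2_le _ _ _ _ 1 limA) => n; rewrite mul1r lerDr n2_ge0.
have e1 : aeq r (fun p => 2^-1 * (U f p + U f (- p))).
  by apply: lim2_unique limCr limC => //; apply: L2Z; exact: L2D.
have e2 : aeq i (fun p => - 2^-1 * (U f p - U f (- p))).
  by apply: lim2_unique limSi limS => //; apply: L2Z; exact: L2B.
have e12 : AE (fun p => r p = 2^-1 * (U f p + U f (- p)) /\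
  i p = - 2^-1 * (U f p - U f (- p))) by apply: AE2 e1 e2.
by apply: AE3 rr ii e12 => p -> -> [].
Qed.

End fourier_L2_facts.

(** * Existence, uniqueness and nontriviality of the fixed point *)

Theorem theorem1 (R : realType) (G : R -> R) (F : R -> R -> R)
    (k l : R) (h : R -> R) (a b : R)
    (hG : inL1 G) (hF : assumptionA F k l h) (hb : b != 0) (ha : 0 <= a)
    (hcase : 0 < a \/
       [/\ a = 0, inL1 (fun x => x * G x) & \int[@leb R]_x G x = 0])
    (hsmall : ((2 * Num.sqrt pi)%:E * N_ab G a b * l%:E < 1)%E) :
  exists t : (R -> R) -> (R -> R),
    [/\ forall v, inH4 v -> inH4 (t v),
        forall v v', inH4 v -> inH4 v' -> ae_equal v v' ->
          ae_equal (t v) (t v'),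
        forall v u, inH4 v -> inH4 u ->
          (solves_Q G F a b v u <-> ae_equal u (t v)) &
        exists v0 : R -> R,
          [/\ inH4 v0 /\ ae_equal (t v0) v0,
              forall w, inH4 w -> ae_equal (t w) w -> ae_equal w v0,
              solves_P G F a b v0,
              forall w, inH4 w -> solves_P G F a b w -> ae_equal w v0 &
              forall F0hat : R -> R[i], fourier_L2 (F 0) F0hat ->
                @leb R (supp F0hat `&` supp (fourier G)) != 0%E ->
                ~ ae_equal v0 (fun=> 0)]].
Proof.
have [_ _ [k0 l0 _ _] _ Flip] := hF.
have [g Ig Gg] := inL1_version hG.
have [n n0 [Nn nl]] : exists2 n : R, 0 <= n &
    N_ab G a b = n%:E /\ 2 * Num.sqrt pi * n * l < 1.
  have s0 : 0 < 2 * Num.sqrt pi :> R by rewrite mulr_gt0// sqrtr_gt0 pi_gt0.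
  have N0 := N_ab_ge0 G a b.
  case: (N_ab G a b) N0 hsmall => [n| |]//.
    by rewrite -!EFinM lte_fin lee_fin => n0 nl; exists n.
  by rewrite gt0_muley ?lte_fin// gt0_mulye ?lte_fin.
(* M bounds the squared modulus of the multiplier; the contraction factor
   M l^2 is half the square of 2 sqrt(pi) n l. *)
set M := 2 * pi * n ^+ 2.
have pi0 := pi_gt0 R.
have M0 : 0 <= M by rewrite /M mulr_ge0 ?sqr_ge0// mulr_ge0// ltW.
have q01 : 0 <= M * l ^+ 2 < 1.
  rewrite mulr_ge0 ?sqr_ge0//=.
  have e0 : 0 <= 2 * Num.sqrt pi * n * l.
    by rewrite !mulr_ge0// ?sqrtr_ge0// ltW.
  have : (2 * Num.sqrt pi * n * l) ^+ 2 < 1 by rewrite expr_lt1.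
  rewrite !exprMn sqr_sqrtr ?(ltW pi0)// => H.
  have P0 : 0 <= pi * n ^+ 2 * l ^+ 2 by apply: mulr_ge0 (sqr_ge0 _); exact: mulr_ge0 (ltW pi0) (sqr_ge0 _).
  rewrite (_ : M * l ^+ 2 = 2 * (pi * n ^+ 2 * l ^+ 2)); last by rewrite /M; ring.
  move: H; rewrite (_ : 2 ^+ 2 * pi * n ^+ 2 * l ^+ 2 = 4 * (pi * n ^+ 2 * l ^+ 2)).
    by lra.
  by ring.
have [b1 b4] : AE (fun p => msq g a b p <= M) /\ AE (fun p => p ^+ 8 * msq g a b p <= M).
  by apply: (N_ab_bounds Ig Gg n0); rewrite Nn.
pose Tg := Sol g a b.
have LT f : L2 f -> L2 (Tg f) by exact: (L2_Sol Ig M0 b1).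
(* Phi v is a Borel version of y |-> F (v y) y. *)
have /boolp.choice[Phi PhiP] : forall v, exists f, inL2 v ->
    L2 f /\ aeq (fun y => F (v y) y) f.
  move=> v; have [Lv|nLv] := pselect (inL2 v); last by exists (fun=> 0) => /nLv.
  by have [f Lf vf] := Nem_version hF Lv; exists f.
pose t v := Tg (Phi v).
have Lt v : inL2 v -> L2 (t v) by move=> /PhiP[LPv _]; exact: LT.
have contr v w v' w' : inL2 v -> inL2 w -> L2 v' -> L2 w' -> aeq v v' -> aeq w w' ->
    n2 (fun x => t v x - t w x) <= M * l ^+ 2 * n2 (fun x => v' x - w' x).
  move=> Lv Lw Lv' Lw' vv ww; have [LPv Pv] := PhiP _ Lv; have [LPw Pw] := PhiP _ Lw.
  apply: (le_trans (Sol_contr Ig M0 b1 LPv LPw)); rewrite -mulrA ler_wpM2l//.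
  exact: (Nem_lip Flip Lv' Lw' LPv LPw vv ww Pv Pw).
have tH4 v : inL2 v -> inH4 (t v).
  move=> Lv; have [LPv _] := PhiP _ Lv; split; first exact: L2_inL2 (Lt _ Lv).
  move=> j /andP[_ j4]; have [w [Lw Ww _]] := Sol_deriv Ig M0 b1 b4 j4 LPv.
  exists w; split; first exact: L2_inL2.
  by apply/(weak_derivative_versions j (Lt _ Lv) Lw (aeq_refl _) (aeq_refl _)).
have tae v v' : inL2 v -> inL2 v' -> aeq v v' -> aeq (t v) (t v').
  move=> Lv Lv' vv; have [w Lw vw] := inL2_version Lv'.
  apply: n2_le0_aeq; [exact: Lt|exact: Lt|] => e e0.
  apply: (le_trans (contr _ _ _ _ Lv Lv' Lw Lw (aeq_trans vv vw) vw)).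
  rewrite (_ : (fun x => _) = fun=> 0); last by apply/funext => x; rewrite subrr.
  by rewrite n2_0 mulr0 ltW.
have Qt v u : inL2 v -> inL2 u -> solves_Q G F a b v u <-> aeq u (t v).
  move=> Lv Lu; have [LPv Pv] := PhiP _ Lv.
  have NC := nonlocal_convol Ig Gg LPv Pv.
  have Ltv := Lt _ Lv.
  split=> [[u1 [u4 [[Lu1 W1] [Lu4 W4] /leb_AE E]]]|ut].
    have [u' Lu' uu'] := inL2_version Lu.
    have [u1' Lu1' uu1'] := inL2_version Lu1.
    have [u4' Lu4' uu4'] := inL2_version Lu4.
    apply: (aeq_trans uu').
    apply: (Sol_unique Ig hb M0 b1 b4 LPv Lu' Lu1' Lu4').
    - by apply/(weak_derivative_versions 1 Lu' Lu1' uu' uu1').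
    - by apply/(weak_derivative_versions 4 Lu' Lu4' uu' uu4').
    - have E3 : AE (fun x => [/\ u' x = u x, u1' x = u1 x & u4' x = u4 x]).
        by apply: AE3 uu' uu1' uu4' => x -> -> ->.
      by apply: AE3 E NC E3 => x <- <- [-> -> ->].
  have [u1 [u4 [Lu1 Lu4 W1 W4 E]]] := Sol_solves Ig hb M0 b1 b4 LPv.
  exists u1, u4; split.
  - split; first exact: L2_inL2.
    by apply/(weak_derivative_versions 1 Ltv Lu1 ut (aeq_refl _)).
  - split; first exact: L2_inL2.
    by apply/(weak_derivative_versions 4 Ltv Lu4 ut (aeq_refl _)).
  - by apply: AE_leb; apply: AE3 E NC ut => x <- -> ->.
have [w Lw tw] : exists2 w, L2 w & aeq (t w) w.
  apply: (contraction_fixpoint q01) => [w /L2_inL2|w w' Lw Lw']; first exact: Lt.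
  exact: contr (L2_inL2 Lw) (L2_inL2 Lw') Lw Lw' (aeq_refl _) (aeq_refl _).
have Lw2 := L2_inL2 Lw.
(* w itself is only known to be in L2, whereas t w is in H4. *)
pose v0 := t w.
have v0H : inH4 v0 by exact: tH4.
have Lv0 : inL2 v0 by case: v0H.
have tv0 : aeq (t v0) v0 by exact: tae.
have fix_unique u : inL2 u -> aeq (t u) u -> aeq u v0.
  move=> Lu tu; have Ltu := Lt _ Lu; have Ltv := Lt _ Lv0.
  have d : aeq (fun x => t u x - t v0 x) (fun=> 0).
    apply: n2_eq0; first exact: L2B.
    have := contr _ _ _ _ Lu Lv0 Ltu Ltv (aeq_sym tu) (aeq_sym tv0).
    have := n2_ge0 (fun x => t u x - t v0 x).
    move: q01 => /andP[_ q1] d0 d1; apply/eqP; rewrite eq_le d0 andbT.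
    rewrite -(pmulr_rle0 _ (_ : 0 < 1 - M * l ^+ 2)) ?subr_gt0//.
    by rewrite mulrBl mul1r subr_le0.
  by apply: AE3 d tu tv0 => x /subr0_eq -> <- <-.
have PQ u : solves_P G F a b u <-> solves_Q G F a b u u.
  split=> -[u1 [u4 [W1 W4 /leb_AE E]]]; exists u1, u4; split => //;
    apply: AE_leb; move: E; apply: AE1 => x; lra.
exists t; split.
- by move=> v [Lv _]; exact: tH4.
- by move=> v v' [Lv _] [Lv' _] /leb_AE vv; apply: AE_leb; exact: tae.
- move=> v u [Lv _] [Lu _]; split.
  + by move=> /(Qt _ _ Lv Lu); exact: AE_leb.
  + by move=> /leb_AE/(Qt _ _ Lv Lu).
exists v0; split.
- by split => //; exact: AE_leb.
- by move=> u [Lu _] /leb_AE tu; apply: AE_leb; exact: fix_unique.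
- by apply/PQ/Qt => //; exact: aeq_sym.
- move=> u [Lu _] /PQ/(Qt _ _ Lu Lu) ut; apply: AE_leb.
  by apply: fix_unique => //; exact: aeq_sym.
move=> F0hat hF0 /negP supp0 /leb_AE v00; apply: supp0.
have [LPv Pv] := PhiP _ Lv0.
have F0P : aeq (F 0) (Phi v0) by apply: AE2 v00 Pv => x -> ->.
have T0 := Sol_zero Ig hb M0 b1 LPv (aeq_trans tv0 v00).
have FH := fourier_L2_Hartley LPv F0P hF0.
have : AE (fun p => ~ (supp F0hat `&` supp (fourier G)) p).
  apply: AE3 T0 (AE_opp T0) FH => p z1 z2 [HR HI] [/= s1 s2].
  have nz : FC g p ^+ 2 + FS g p ^+ 2 != 0.
    apply: contraNN s2 => /eqP z.
    have := cmod_fourier_sqr p Ig Gg; rewrite z mulr0 => /eqP.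
    by rewrite sqrf_eq0 => /eqP e; rewrite (ComplexField.Normc.eq0_normc e).
  have := z1 nz; have := z2; rewrite FC_even FS_odd// sqrrN => /(_ nz) e2 e1.
  move: HR HI s1; rewrite /supp /= e1 e2; case: (F0hat p) => x y /= -> ->.
  by rewrite addr0 subr0 !mulr0 eqxx.
move=> /AE_leb[N [mN N0 subN]]; apply/eqP/le_anti/andP; split; last exact: measure_ge0.
rewrite -N0; apply: (@le_outer_measure _ _ ((wlength (R := R) idfun)^*)%mu).
by move=> p pS; apply: subN => /=; apply.
Qed.
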